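(* Let $u$ be a homogeneous D-solution of the stationary Navier-Stokes equations in $\mathbb{R}^3$, and let $u_\rho(x)=u(x)\cdot\frac{x}{|x|}$ be the radial component of $u$ in spherical coordinates. If there is a positive constant $C$ such that $$u_\rho(x)\le \frac{C}{|x|}\qquad\text{for all } x\in\mathbb{R}^3\setminus\{0\},$$ then $u\equiv 0$.
   Context: A homogeneous D-solution in $\mathbb{R}^3$ is a vector field $u:\mathbb{R}^3\to\mathbb{R}^3$ which, with some scalar pressure $p$, satisfies $$(u\cdot\nabla)u+\nabla p-\Delta u=0,\qquad \nabla\cdot u=0\quad\text{in }\mathbb{R}^3$$ (zero forcing term), has finite Dirichlet integral $\int_{\mathbb{R}^3}|\nabla u(x)|^2\,dx<+\infty$, and vanishes at infinity, i.e. $\lim_{|x|\to\infty}u(x)=0$. The solution $(u,p)$ may be taken to be smooth (by standard interior regularity, weak solutions of this kind are smooth). *)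

(* Defs.v *)
From HB Require Import structures.
From mathcomp Require Import all_boot all_order all_algebra.
From mathcomp Require Import all_classical all_reals all_analysis.
Set Implicit Arguments.
Unset Strict Implicit.
Unset Printing Implicit Defensive.
Import Order.TTheory GRing.Theory Num.Theory.
Import numFieldNormedType.Exports.
Local Open Scope classical_set_scope.
Local Open Scope ring_scope.

(* The library norm `|x| on 'rV[R]_3 is the sup norm, so the Euclidean
   structure of R^3 is spelled out here. *)
Definition dotv (R : realType) (x y : 'rV[R]_3) : R :=
  \sum_(i < 3) x 0 i * y 0 i.

Definition enorm (R : realType) (x : 'rV[R]_3) : R := Num.sqrt (dotv x x).

Definition partial (R : realType) (V : normedModType R) (j : 'I_3)
    (f : 'rV[R]_3 -> V) : 'rV[R]_3 -> V :=
  fun x => 'D_(delta_mx 0 j) f x.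

Definition partials (R : realType) (V : normedModType R) (s : seq 'I_3)
    (f : 'rV[R]_3 -> V) : 'rV[R]_3 -> V :=
  foldr (fun j g => partial j g) f s.

(* Class C^oo: 'D_v f x is a total function (a junk value where f is not
   derivable), hence existence is required separately from continuity. *)
Definition smooth (R : realType) (V : normedModType R)
    (f : 'rV[R]_3 -> V) : Prop :=
  forall s : seq 'I_3,
    continuous (partials s f) /\
    (forall (j : 'I_3) (x : 'rV[R]_3),
       derivable (partials s f) x (delta_mx 0 j)).

Definition gradient (R : realType) (p : 'rV[R]_3 -> R) (x : 'rV[R]_3) :
    'rV[R]_3 :=
  \row_(j < 3) partial j p x.

Definition divergence (R : realType) (u : 'rV[R]_3 -> 'rV[R]_3)
    (x : 'rV[R]_3) : R :=
  \sum_(j < 3) partial j u x 0 j.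

Definition laplacian (R : realType) (u : 'rV[R]_3 -> 'rV[R]_3)
    (x : 'rV[R]_3) : 'rV[R]_3 :=
  \sum_(j < 3) partial j (partial j u) x.

(* (v . nabla) u *)
Definition convection (R : realType) (v u : 'rV[R]_3 -> 'rV[R]_3)
    (x : 'rV[R]_3) : 'rV[R]_3 :=
  \sum_(j < 3) v x 0 j *: partial j u x.

Definition stationary_navier_stokes (R : realType)
    (u : 'rV[R]_3 -> 'rV[R]_3) (p : 'rV[R]_3 -> R) : Prop :=
  forall x : 'rV[R]_3,
    convection u u x + gradient p x - laplacian u x = 0 /\
    divergence u x = 0.

(* |nabla u(x)|^2, the squared Frobenius norm of the Jacobian matrix *)
Definition sqr_norm_grad (R : realType) (u : 'rV[R]_3 -> 'rV[R]_3)
    (x : 'rV[R]_3) : R :=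
  \sum_(j < 3) \sum_(i < 3) (partial j u x 0 i) ^+ 2.

(* The library has no measure on 'rV[R]_3: Lebesgue measure on R^3 is taken
   as the threefold product measure on R * R * R, whose points are turned
   into row vectors by vec3. *)
Definition vec3 (R : realType) (z : R * R * R) : 'rV[R]_3 :=
  \row_(i < 3) [:: z.1.1; z.1.2; z.2]`_i.

Definition dirichlet_integral (R : realType) (u : 'rV[R]_3 -> 'rV[R]_3) :
    \bar R :=
  (\int[(@lebesgue_measure R \x @lebesgue_measure R) \x @lebesgue_measure R]_z
     (sqr_norm_grad u (vec3 z))%:E)%E.

Definition vanishes_at_infinity (R : realType)
    (u : 'rV[R]_3 -> 'rV[R]_3) : Prop :=
  forall e : R, 0 < e ->
    exists M : R, forall x : 'rV[R]_3, M < enorm x -> enorm (u x) < e.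

Definition homogeneous_D_solution (R : realType)
    (u : 'rV[R]_3 -> 'rV[R]_3) : Prop :=
  [/\ smooth u,
      exists p : 'rV[R]_3 -> R, smooth p /\ stationary_navier_stokes u p,
      (dirichlet_integral u < +oo)%E &
      vanishes_at_infinity u].

(* u_rho; only meaningful for x != 0. *)
Definition radial_component (R : realType) (u : 'rV[R]_3 -> 'rV[R]_3)
    (x : 'rV[R]_3) : R :=
  dotv (u x) ((enorm x)^-1 *: x).

(* Main.v *)
(* Let v = u, Q = p + |v|^2/2 and let w be the vorticity.  Then
   grad Q = Lap v - w x v, and Q is a subsolution: Lap Q - v . grad Q = |w|^2.

   1. Hardy's inequality gives |v|^2/(1 + |x|^2) in L^1.  Testing the equation
      against differences of smoothed Newtonian fields (whose Jacobian is
      symmetric, so that Lap v drops out) expresses differences of smoothed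
      means of Q through (w x v) . x/|x|^3.  Hence the means at scale n around 0
      converge to some l, with error o(1/n).
   2. Moving the centre, |Q(y) - l| is at most the integral of |w x v|/|x - y|^2,
      which for y far away is at most eps + C_eps (|grad v|^2 * k)(y) with k
      integrable.  So (Q - l - eps)_+ is integrable, and testing the subsolution
      inequality with a convex function of it shows Q <= l.
   3. Test Lap Q - v . grad Q = |w|^2 against the cutoff phi_R = (1 - |x|^2/R^2)_+^3.
      Since Q - l <= 0 and x . v <= C, the integral of |w|^2 phi_R is at most a
      multiple of R |mean_R(Q) - l| = o(1), so w = 0 and Lap v = 0.  Then
      2 int |grad v|^2 phi_R = int |v|^2 Lap phi_R tends to 0 by Hardy, so v is
      constant, hence 0. *)
Require Import Defs.
From HB Require Import structures.
From mathcomp Require Import all_boot all_order all_algebra.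
From mathcomp Require Import all_classical all_reals all_analysis.
From mathcomp Require Import measurable_realfun.
From mathcomp Require Import ring lra.
Set Implicit Arguments.
Unset Strict Implicit.
Unset Printing Implicit Defensive.
Import Order.TTheory GRing.Theory Num.Theory.
Import numFieldNormedType.Exports.
Local Open Scope classical_set_scope.
Local Open Scope ring_scope.

(** * Lebesgue measure on the space of points *)

(** No decay of the pressure is known beforehand, so Q is reached only through compactly supported
    test fields. Differences of two scales are taken because a single Newtonian field has no compact
    support, while two of them coincide beyond the larger scale. What remains, w x v, pairs with the
    two quantities at hand: v in the Hardy weight and grad v in L^2. The majorant of |Q - l| is a
    convolution that is integrable but need not be small at every far point, hence a maximum
    principle based on integrability in place of decay. The profiles are coordinated: the gradient
    of (1 - |x|^2/R^2)_+^3 carries (1 - |x|^2/R^2)_+^2, which is the profile of the mollifier, and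
    the mollifier is the divergence of a polynomial correction of x/|x|^3. So the last test meets
    exactly the means of Q that were controlled; as it costs a factor R, their convergence must come
    with the rate o(1/R). Masses are not normalised: in the code [l] is a limit of means of total
    mass 4 pi, and the bound reads [Q x <= l / moll_mass]. *)

Notation leb := (@lebesgue_measure _).
Notation point R := (measurableTypeR R * measurableTypeR R * measurableTypeR R)%type.

Section product_lebesgue.
Context {R : realType}.
Notation RT := (measurableTypeR R).

Definition leb2 : set (RT * RT) -> \bar R :=
  (@lebesgue_measure R \x @lebesgue_measure R)%E.

HB.instance Definition _ := Measure.on leb2.

Definition square (c : RT * RT) (r : R) : set (RT * RT) :=
  `[c.1 - r, c.1 + r] `*` `[c.2 - r, c.2 + r].

Definition cube (c : point R) (r : R) : set (point R) :=
  square c.1 r `*` `[c.2 - r, c.2 + r].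

Lemma leb_itv_center (c r : R) : 0 <= r ->
  @lebesgue_measure R `[c - r, c + r] = (2 * r)%:E.
Proof.
move=> r0; rewrite lebesgue_measure_itv/= lte_fin.
case: ltP => [_|rle]; first by rewrite -EFinD; congr EFin; ring.
have r00 : r = 0 by lra.
by rewrite r00 mulr0.
Qed.

Lemma measurable_square c (r : R) : measurable (square c r).
Proof. by rewrite /square; apply: measurableX => /=; exact: measurable_itv. Qed.

Lemma leb2_square c (r : R) : 0 <= r -> leb2 (square c r) = ((2 * r) ^+ 2)%:E.
Proof. by move=> r0; rewrite /leb2 product_measure1E//= !leb_itv_center. Qed.

Lemma itv_centerE (c r t : R) : (t \in `[c - r, c + r]) = (`|t - c| <= r).
Proof.
by rewrite in_itv/= ler_norml; apply/andP/andP => -[? ?]; split; lra.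
Qed.

Lemma squareP c (r : R) z :
  square c r z <-> `|z.1 - c.1| <= r /\ `|z.2 - c.2| <= r.
Proof. by rewrite /square/= !itv_centerE; split. Qed.

Lemma leb2_sigma_finite : sigma_finite setT leb2.
Proof.
exists (fun n => square (0, 0) n%:R).
  apply/esym/seteqP; split=> // z _.
  exists (Num.trunc (`|z.1| + `|z.2|)).+1 => //; apply/squareP; rewrite !subr0.
  have zn := ltW (truncnS_gt (`|z.1| + `|z.2|)).
  by split; apply: le_trans zn; rewrite ?lerDl ?lerDr.
move=> n; split; first exact: measurable_square.
by rewrite leb2_square ?ltry.
Qed.

HB.instance Definition _ := Measure_isSigmaFinite.Build _ _ _ leb2
  leb2_sigma_finite.

(** Unfolds to the measure in [dirichlet_integral]; it bears a name so that sigma-finiteness,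
    required by Tonelli's theorem, can be attached to it. *)
Definition leb3 : set (RT * RT * RT) -> \bar R :=
  (leb2 \x @lebesgue_measure R)%E.

HB.instance Definition _ := Measure.on leb3.

Lemma measurable_cube c (r : R) : measurable (cube c r).
Proof. by apply: measurableX => //; exact: measurable_square. Qed.

Lemma leb3_cube c (r : R) : 0 <= r -> leb3 (cube c r) = ((2 * r) ^+ 3)%:E.
Proof.
move=> r0; rewrite /leb3 product_measure1E//=; last exact: measurable_square.
by rewrite leb2_square// leb_itv_center// -EFinM -exprSr.
Qed.

Lemma leb3_sigma_finite : sigma_finite setT leb3.
Proof.
exists (fun n => cube (0, 0, 0) n%:R).
  apply/esym/seteqP; split=> // z _.
  pose s := `|z.1.1| + `|z.1.2| + `|z.2|.
  have s1 := normr_ge0 z.1.1; have s2 := normr_ge0 z.1.2.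
  have s3 := normr_ge0 z.2.
  exists (Num.trunc s).+1 => //; rewrite /cube/=.
  have := ltW (truncnS_gt s); rewrite {}/s => sn; split.
    by apply/squareP; rewrite !subr0; split; apply: le_trans sn; lra.
  by rewrite /= itv_centerE subr0; apply: le_trans sn; lra.
move=> n; split; first exact: measurable_cube.
by rewrite leb3_cube ?ltry.
Qed.

HB.instance Definition _ := Measure_isSigmaFinite.Build _ _ _ leb3
  leb3_sigma_finite.

End product_lebesgue.

(** * Points of the product space as row vectors *)

Section coordinates.
Context {R : realType}.
Implicit Types (x : 'rV[R]_3) (z : point R).

Lemma ord3P (P : 'I_3 -> Prop) : P 0 -> P 1 -> P 2%:R -> forall i, P i.
Proof.
move=> P0 P1 P2 [[|[|[|//]]] i3].
- by rewrite (_ : Ordinal i3 = 0)//; exact/val_inj.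
- by rewrite (_ : Ordinal i3 = 1)//; exact/val_inj.
- by rewrite (_ : Ordinal i3 = 2%:R)//; exact/val_inj.
Qed.

Lemma sum3E (V : nmodType) (F : 'I_3 -> V) :
  \sum_(i < 3) F i = F 0 + F 1 + F 2%:R.
Proof.
rewrite !big_ord_recr big_ord0/= add0r.
by congr (F _ + F _ + F _); exact/val_inj.
Qed.

Lemma vec3_surj x : vec3 (x 0 0, x 0 1, x 0 2%:R) = x.
Proof. by apply/rowP; apply: ord3P; rewrite mxE. Qed.

Lemma vec3_0 z : vec3 z 0 0 = z.1.1. Proof. by rewrite mxE. Qed.

Lemma vec3_1 z : vec3 z 0 1 = z.1.2. Proof. by rewrite mxE. Qed.

Lemma vec3_2 z : vec3 z 0 2%:R = z.2. Proof. by rewrite mxE. Qed.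

Definition vec3E := (vec3_0, vec3_1, vec3_2).

Lemma cubeP (r : R) (c z : point R) :
  cube c r z <-> forall i, `|vec3 z 0 i - vec3 c 0 i| <= r.
Proof.
rewrite /cube; split => [[/squareP[? ?]]|zr].
  by rewrite /= itv_centerE => ?; apply: ord3P; rewrite !vec3E.
split; last by rewrite /= itv_centerE; have := zr 2%:R; rewrite !vec3E.
by apply/squareP; have := zr 0; have := zr 1; rewrite !vec3E.
Qed.

Lemma compact_cube (r : R) : compact [set x : 'rV[R]_3 | forall i, `|x 0 i| <= r].
Proof.
rewrite (_ : mkset _ = [set x : 'rV[R]_3 | forall i, `[- r, r]%classic (x ord0 i)]).
  by apply: (@rV_compact R 3 (fun=> [set` `[- r, r]])) => i; exact: segment_compact.
by apply/seteqP; split=> x xr i; move: (xr i); rewrite /= in_itv/= -ler_norml.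
Qed.

(** Measurability refers to the product sigma-algebra, continuity to row vectors: the preimage of an
    open half-line is a countable union of cubes with rational data. *)
Lemma measurable_comp_vec3 (f : 'rV[R]_3 -> R) : continuous f ->
  measurable_fun [set: point R] (f \o @vec3 R).
Proof.
move=> cf; apply: (measurability _ (RGenOInfty.measurableE R)) => //.
move=> /= _ [_ [a ->] <-]; rewrite setTI.
pose rcube (q : rat * rat * rat * nat) : set (point R) :=
  let e := q.2.+1%:R^-1 : R in
  (`]ratr q.1.1.1 - e, ratr q.1.1.1 + e[ `*`
   `]ratr q.1.1.2 - e, ratr q.1.1.2 + e[) `*`
   `]ratr q.1.2 - e, ratr q.1.2 + e[.
set U := _ @^-1` _.
have -> : U = \bigcup_q (if `[< rcube q `<=` U >] then rcube q else set0).
  apply/seteqP; split=> [z Uz|z [q _]]; last by case: ifPn => // /asboolP; apply.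
  have /= : \forall y \near vec3 z, a < f y.
    have : nbhs (f (vec3 z)) [set t | a < t].
      apply: open_nbhs_nbhs; split; first exact: open_gt.
      by move: Uz; rewrite /U /= in_itv/= andbT.
    by move/cf.
  move=> /nbhs_ballP[e /= e0 eU].
  (* With 2/(n+1) < e, a cube of half-side 1/(n+1) that contains z stays in the e-ball around z. *)
  pose n := Num.trunc (2 / e); have n0 : 0 < n.+1%:R^-1 :> R by rewrite invr_gt0.
  have ne : 2 / n.+1%:R < e.
    rewrite ltr_pdivrMr// mulrC -ltr_pdivrMr//.
    exact: truncnS_gt.
  have appr (t : R) : exists q : rat,
      t \in `]ratr q - n.+1%:R^-1, ratr q + n.+1%:R^-1[.
    move: n0; set w := n.+1%:R^-1 => n0.
    have /rat_in_itvoo[q] : t - w < t + w by lra.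
    by rewrite in_itv/= => /andP[q1 q2]; exists q; rewrite in_itv/=; apply/andP; split; lra.
  have [q0 q0z] := appr z.1.1; have [q1 q1z] := appr z.1.2; have [q2 q2z] := appr z.2.
  exists (q0, q1, q2, n) => //; case: ifPn => [_|/asboolP]; first by split; [split|].
  case=> y -[[/= y0 y1] y2]; rewrite /U /= in_itv/= andbT; apply: eU.
  move: n0 ne y0 y1 y2 q0z q1z q2z; set w := n.+1%:R^-1 => n0 ne y0 y1 y2 q0z q1z q2z.
  split => // i j; rewrite ord1; move: j.
  apply: ord3P; rewrite !vec3E /ball/= ltr_norml.
  - move: y0 q0z; rewrite !in_itv/= => /andP[? ?] /andP[? ?]; apply/andP; split; lra.
  - move: y1 q1z; rewrite !in_itv/= => /andP[? ?] /andP[? ?]; apply/andP; split; lra.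
  - move: y2 q2z; rewrite !in_itv/= => /andP[? ?] /andP[? ?]; apply/andP; split; lra.
apply: countable_bigcupT_measurable => // q.
case: ifPn => // _; apply: measurableX => //; exact: measurableX.
Qed.

End coordinates.

(** * Integrals of compactly supported functions *)

Section bounded_support.
Context {R : realType}.
Implicit Types (f g : 'rV[R]_3 -> R).

Definition bsupp f := exists M : R, forall (x : 'rV[R]_3) i, M < `|x 0 i| -> f x = 0.

Definition Cc f := continuous f /\ bsupp f.

Definition vint f : R := \int[leb3]_z f (vec3 z).

Lemma eq_Cc f g : f =1 g -> Cc f -> Cc g.
Proof. by move=> /funext ->. Qed.

Lemma eq_vint f g : f =1 g -> vint f = vint g.
Proof. by move=> /funext ->. Qed.

Lemma bsuppM f g : bsupp f -> bsupp (fun x => g x * f x).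
Proof. by move=> [M f0]; exists M => x i /f0 ->; rewrite mulr0. Qed.

Lemma bsupp_comp f (h : 'rV[R]_3 -> R) :
  (forall x, f x = 0 -> h x = 0) -> bsupp f -> bsupp h.
Proof. by move=> fh [M f0]; exists M => x i /f0 /fh. Qed.

Lemma bsuppD f g : bsupp f -> bsupp g -> bsupp (fun x => f x + g x).
Proof.
move=> [M f0] [N g0]; exists (Num.max M N) => x i.
by rewrite gt_max => /andP[/f0 -> /g0 ->]; rewrite addr0.
Qed.

Lemma CcD f g : Cc f -> Cc g -> Cc (fun x => f x + g x).
Proof.
move=> [cf sf] [cg sg]; split; last exact: bsuppD.
by move=> x; apply: continuousD; [exact: cf|exact: cg].
Qed.

Lemma CcMl f g : continuous g -> Cc f -> Cc (fun x => g x * f x).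
Proof.
move=> cg [cf sf]; split; last exact: bsuppM.
by move=> x; apply: continuousM; [exact: cg|exact: cf].
Qed.

Lemma CcMr f g : continuous g -> Cc f -> Cc (fun x => f x * g x).
Proof.
by move=> cg /(CcMl cg); apply: eq_Cc => x; rewrite mulrC.
Qed.

Lemma CcZ f k : Cc f -> Cc (fun x => k * f x).
Proof. exact: (CcMl (@cst_continuous _ _ k)). Qed.

Lemma CcN f : Cc f -> Cc (fun x => - f x).
Proof. by move=> /(CcZ (-1)); apply: eq_Cc => x; rewrite mulN1r. Qed.

Lemma CcB f g : Cc f -> Cc g -> Cc (fun x => f x - g x).
Proof. by move=> cf cg; apply: CcD => //; exact: CcN. Qed.

Lemma Cc_abs f : Cc f -> Cc (fun x => `|f x|).
Proof.
move=> [cf sf]; split.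
  by move=> x; apply: (cvg_comp f Num.norm (cf x)); exact: norm_continuous.
by apply: bsupp_comp sf => x ->; rewrite normr0.
Qed.

Lemma Cc_sum (F : 'I_3 -> 'rV[R]_3 -> R) :
  (forall i, Cc (F i)) -> Cc (fun x => \sum_(i < 3) F i x).
Proof.
move=> CF.
rewrite (_ : (fun x => _) = (fun x => F 0 x + F 1 x + F 2%:R x)).
  by apply: CcD => //; exact: CcD.
by apply/funext => x; rewrite sum3E.
Qed.

Lemma bounded_supp_integrable d (T : measurableType d)
    (mu : {measure set T -> \bar R}) (h : T -> R) (A : set T) (K : R) :
  measurable A -> (mu A < +oo)%E -> measurable_fun [set: T] h ->
  (forall x, `|h x| <= K) -> (forall x, ~ A x -> h x = 0) ->
  mu.-integrable [set: T] (EFin \o h).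
Proof.
move=> mA Aoo mh hK h0.
have -> : EFin \o h = (EFin \o h) \_ A.
  apply/funext => x; rewrite patchE; case: ifPn => // /negP xA /=.
  by rewrite h0// => Ax; apply: xA; rewrite inE.
apply: (integrable_mkcond _ mA).1.
apply: measurable_bounded_integrable => //.
  exact: measurable_funTS.
by exists K; split; [exact: num_real|move=> M KM x _; exact: (le_trans (hK x) (ltW KM))].
Qed.

Lemma Cc_bounded f : Cc f -> exists2 K, 0 <= K & forall x, `|f x| <= K.
Proof.
move=> [cf [M f0]]; pose N := Num.max M 0.
have N0 : 0 <= N by rewrite /N le_max lexx orbT.
pose A := [set x : 'rV[R]_3 | forall i, `|x 0 i| <= N].
have A0 : A !=set0 by exists 0 => i /=; rewrite mxE normr0.
have cfA : {within A, continuous (fun x => `|f x|)}.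
  apply: continuous_subspaceT => x.
  by apply: (cvg_comp f Num.norm (cf x)); exact: norm_continuous.
have [c _ fc] := EVT_max_rV A0 (@compact_cube R N) cfA.
exists `|f c| => // x; have [xN|/existsNP[i]] := pselect (forall i, `|x 0 i| <= N).
  by apply: fc; rewrite inE.
by move/negP; rewrite -ltNge gt_max => /andP[/f0 -> _]; rewrite normr0.
Qed.

Lemma Cc_bounded_cube f : Cc f -> exists K M : R, [/\ 0 <= K, 0 <= M,
  forall x, `|f x| <= K & forall (x : 'rV[R]_3) i, M < `|x 0 i| -> f x = 0].
Proof.
move=> Cf; have [K K0 fK] := Cc_bounded Cf; have [_ [M f0]] := Cf.
exists K, (Num.max M 0); split=> //; first by rewrite le_max lexx orbT.
by move=> x i; rewrite gt_max => /andP[/f0].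
Qed.

Lemma notin_cube0 (M : R) (z : point R) : ~ cube (0, 0, 0) M z ->
  exists i, M < `|vec3 z 0 i|.
Proof.
move/cubeP/existsNP => [i /negP]; rewrite -ltNge => iM; exists i.
suff z0 : vec3 ((0, 0, 0) : point R) 0 i = 0 by move: iM; rewrite z0 subr0.
by move: i {iM}; apply: ord3P; rewrite vec3E.
Qed.

Lemma Cc_integrable f : Cc f ->
  leb3.-integrable [set: point R] (EFin \o (f \o @vec3 R)).
Proof.
move=> Cf; have [K [M [K0 M0 fK f0]]] := Cc_bounded_cube Cf.
have coo : (leb3 (cube (0%R, 0%R, 0%R) M) < +oo)%E by rewrite leb3_cube// ltry.
apply: (@bounded_supp_integrable _ _ _ _ (cube (0, 0, 0) M) K) => //.
- exact: measurable_cube.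
- by apply: measurable_comp_vec3; case: Cf.
- by move=> z; exact: fK.
- by move=> z /notin_cube0[i] /f0.
Qed.

Lemma vintD f g : Cc f -> Cc g -> vint (fun x => f x + g x) = vint f + vint g.
Proof. by move=> Cf Cg; rewrite /vint RintegralD//; exact: Cc_integrable. Qed.

Lemma vintB f g : Cc f -> Cc g -> vint (fun x => f x - g x) = vint f - vint g.
Proof. by move=> Cf Cg; rewrite /vint RintegralB//; exact: Cc_integrable. Qed.

Lemma vintZ f k : Cc f -> vint (fun x => k * f x) = k * vint f.
Proof. by move=> Cf; rewrite /vint RintegralZl//; exact: Cc_integrable. Qed.

Lemma vintN f : Cc f -> vint (fun x => - f x) = - vint f.
Proof.
by move=> Cf; rewrite -mulN1r -vintZ//; apply: eq_vint => x; rewrite mulN1r.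
Qed.

Lemma vint_sum (F : 'I_3 -> 'rV[R]_3 -> R) : (forall i, Cc (F i)) ->
  vint (fun x => \sum_(i < 3) F i x) = \sum_(i < 3) vint (F i).
Proof.
move=> CF.
rewrite (_ : (fun x => _) = (fun x => F 0 x + F 1 x + F 2%:R x)).
  by rewrite sum3E vintD ?vintD//; exact: CcD.
by apply/funext => x; rewrite sum3E.
Qed.

Lemma le_vint f g : Cc f -> Cc g -> (forall x, f x <= g x) ->
  vint f <= vint g.
Proof.
move=> Cf Cg fg; apply: le_Rintegral; [by []|exact: Cc_integrable|
  exact: Cc_integrable|by move=> z _; exact: fg].
Qed.

Lemma ler_norm_vint f : Cc f -> `|vint f| <= vint (fun x => `|f x|).
Proof. by move=> Cf; apply: le_normr_Rintegral => //; exact: Cc_integrable. Qed.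

Lemma vint_EFin f : Cc f -> (vint f)%:E = (\int[leb3]_z (f (vec3 z))%:E)%E.
Proof.
move=> /Cc_integrable fi; rewrite /vint /Rintegral fineK//.
exact: integrable_fin_num.
Qed.

Lemma integral_cst_cube (c : point R) (r k : R) : 0 <= r ->
  (\int[leb3]_(z in cube c r) k%:E = (k * (2 * r) ^+ 3)%:E)%E.
Proof.
move=> r0; rewrite integral_cst; last exact: measurable_cube.
by rewrite EFinM -(leb3_cube c r0).
Qed.

(** By continuity [f] is at least [f x / 2] on a small cube, whose volume is positive. *)
Lemma vint_gt0 f x : Cc f -> (forall y, 0 <= f y) -> 0 < f x -> 0 < vint f.
Proof.
move=> Cf f0 fx0.
have [/= e e0 ef] : exists2 e : R, 0 < e & forall y : 'rV[R]_3,
    (forall i, `|y 0 i - x 0 i| <= e) -> f x / 2 <= f y.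
  have /nbhs_ballP[e /= e0 eU] : \forall y \near x, f x / 2 < f y.
    have : nbhs (f x) [set t | f x / 2 < t].
      by apply: open_nbhs_nbhs; split; [exact: open_gt|rewrite /=; lra].
    by move/(Cf.1 x).
  exists (e / 2); first by lra.
  move=> y ye; apply/ltW/eU; split=> // i j; rewrite ord1 /ball/= distrC.
  by apply: le_lt_trans (ye j) _; lra.
rewrite -lte_fin vint_EFin//.
pose c : point R := (x 0 0, x 0 1, x 0 2%:R).
apply: (@lt_le_trans _ _ (\int[leb3]_(z in cube c e) (f x / 2)%:E)%E).
  rewrite integral_cst_cube ?ltW// lte_fin mulr_gt0 ?exprn_gt0//; lra.
apply: (@le_trans _ _ (\int[leb3]_(z in cube c e) (f (vec3 z))%:E)%E).
  apply: ge0_le_integral => //.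
  - exact: measurable_cube.
  - by move=> z _; rewrite lee_fin; lra.
  - apply/measurable_EFinP; apply: measurable_funTS.
    by apply: measurable_comp_vec3; case: Cf.
  - by move=> z /cubeP; rewrite vec3_surj => /ef; rewrite lee_fin.
apply: ge0_subset_integral => //.
- exact: measurable_cube.
- by apply/measurable_EFinP; apply: measurable_comp_vec3; case: Cf.
- by move=> z _; rewrite lee_fin.
Qed.

End bounded_support.

(** * Integration by parts *)

Section integration_by_parts.
Context {R : realType}.
Implicit Types (f g : 'rV[R]_3 -> R).
Local Notation e_ j := (delta_mx 0 j : 'rV[R]_3).

(** Reduces directional derivatives to one variable, where the mean value theorem and the
    fundamental theorem of calculus are available. *)
Lemma is_derive_line (V W : normedModType R) (f : V -> W) (x v : V) (t : R) :
  derivable f (x + t *: v) v ->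
  is_derive t 1 (fun s => f (x + s *: v)) ('D_v f (x + t *: v)).
Proof.
move=> df; rewrite /derive.
have E : (fun h : R => h^-1 *: (((fun s : R => f (x + s *: v)) \o shift t) (h *: 1) -
    f (x + t *: v))) =
    (fun h : R => h^-1 *: ((f \o shift (x + t *: v)) (h *: v) - f (x + t *: v))).
  apply/funext => h; congr (_ *: (f _ - _)).
  by rewrite /= scaler1 scalerDl addrCA.
by rewrite -E; apply: DeriveDef => //; rewrite /derivable E.
Qed.

Lemma nbhs_gt (M t : R) : M < t -> nbhs t [set s : R | M < s].
Proof. by move=> Mt; apply: open_nbhs_nbhs; split; first exact: open_gt. Qed.

Lemma integral_derive_bsupp (h h' : R -> R) (M : R) :
  (forall t : R, is_derive t 1 h (h' t)) -> continuous h' ->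
  (forall t : R, M < `|t| -> h t = 0) -> (\int[leb]_t (h' t)%:E = 0)%E.
Proof.
(* The added 1 makes both endpoints of [-N, N] satisfy the strict inequality under which [h] is
   known to vanish. *)
move=> dh ch' h0; pose N := Num.max M 0 + 1.
have N0 : 0 < N by rewrite ltr_wpDl// le_max lexx orbT.
have MN : M < N by rewrite ltr_pwDr// le_max lexx.
have h'0 (t : R) : M < `|t| -> h' t = 0.
  move=> Mt; rewrite -(@derive_val _ _ _ _ _ _ _ (dh t)).
  have <- : 'D_1 (cst 0 : R -> R) t = 0 by rewrite derive_cst.
  apply: near_eq_derive.
  have : nbhs (`|t| : R) [set s : R | M < s] by exact: nbhs_gt.
  move=> /(@norm_continuous _ R t) nt; near=> s; apply: h0; near: s; exact: nt.
have -> : (fun t => (h' t)%:E) = (EFin \o h') \_ `[- N, N].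
  apply/funext => t; rewrite patchE; case: ifPn => //=.
  by rewrite notin_setE /= in_itv/= -ler_norml => /negP; rewrite -ltNge => /(lt_trans MN)/h'0 ->.
rewrite -integral_mkcond (@continuous_FTC2 _ _ h).
- by rewrite !h0 ?normrN ?gtr0_norm// sube0.
- by lra.
- exact: continuous_subspaceT.
- split; [by move=> t _; apply: ex_derive| |].
  + apply: cvg_at_right_filter; apply: differentiable_continuous.
    by apply/derivable1_diffP; apply: ex_derive.
  + apply: cvg_at_left_filter; apply: differentiable_continuous.
    by apply/derivable1_diffP; apply: ex_derive.
- by move=> t _; rewrite derive1E derive_val.
Unshelve. all: by end_near. Qed.

Lemma vec3_line0 (a b t : R) : vec3 (a, b, t) = vec3 (a, b, 0) + t *: e_ 2%:R.
Proof.
by apply/rowP; apply: ord3P; rewrite !mxE/= ?mulr0 ?mulr1 ?addr0 ?add0r.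
Qed.

Lemma vec3_line1 (a b t : R) : vec3 (a, t, b) = vec3 (a, 0, b) + t *: e_ 1.
Proof.
by apply/rowP; apply: ord3P; rewrite !mxE/= ?mulr0 ?mulr1 ?addr0 ?add0r.
Qed.

Lemma vec3_line2 (a b t : R) : vec3 (t, a, b) = vec3 (0, a, b) + t *: e_ 0.
Proof.
by apply/rowP; apply: ord3P; rewrite !mxE/= ?mulr0 ?mulr1 ?addr0 ?add0r.
Qed.

Lemma bsupp_partial j f : bsupp f -> bsupp (partial j f).
Proof.
move=> [M f0]; exists M => x i Mx; rewrite /partial.
have <- : 'D_(e_ j) (cst 0 : _ -> R) x = 0 by rewrite derive_cst.
apply: near_eq_derive.
have : nbhs (`|x 0 i| : R) [set s : R | M < s] by exact: nbhs_gt.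
have cx : {for x, continuous (fun y : 'rV[R]_3 => `|y 0 i|)}.
  apply: (@continuous_comp _ _ _ (fun y : 'rV[R]_3 => y 0 i)).
    exact: coord_continuous.
  exact: norm_continuous.
by move=> /cx nx; near=> y; apply: (f0 _ i); near: y; exact: nx.
Unshelve. all: by end_near. Qed.

(** By Fubini the j-th variable may be integrated innermost, and the integral over every line
    parallel to that axis is 0. *)
Lemma integral_partial j f : (forall x, derivable f x (e_ j)) -> bsupp f ->
  continuous (partial j f) -> (\int[leb3]_z (partial j f (vec3 z))%:E = 0)%E.
Proof.
move=> df sf cpf.
have Cpf : Cc (partial j f) by split; [|exact: bsupp_partial].
have line (v : R -> 'rV[R]_3) x0 : (forall t, v t = x0 + t *: e_ j) ->
    (\int[leb]_t (partial j f (v t))%:E = 0)%E.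
  move=> vE; have [M f0] := sf.
  have vj t : v t 0 j = x0 0 j + t by rewrite vE !mxE !eqxx/= mulr1.
  (* On the line the j-th coordinate is [x0 0 j + t], so beyond this radius it exceeds M in absolute
     value. *)
  apply: (@integral_derive_bsupp (f \o v) _ (`|M| + `|x0 0 j|)).
  - move=> t; rewrite vE (_ : f \o v = fun s => f (x0 + s *: e_ j)).
      exact: is_derive_line.
    by apply/funext => s /=; rewrite vE.
  - rewrite (_ : (fun t => _) = partial j f \o (fun t => x0 + t *: e_ j)).
      move=> t; apply: continuous_comp; last exact: cpf.
      apply: continuousD; first exact: cst_continuous.
      by apply: continuousZl; exact: cvg_id.
    by apply/funext => s /=; rewrite vE.
  - move=> t Mt; apply: (f0 _ j); rewrite vj.
    have := lerB_normD (x0 0 j) t; have := ler_norm M.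
    have := ler_normB (x0 0 j + t) (x0 0 j).
    by rewrite addrAC subrr add0r; move: Mt; lra.
have Ci := Cc_integrable Cpf.
have [K [M [K0 M0 fK f0]]] := Cc_bounded_cube Cpf.
have Ci2 t : leb2.-integrable [set: (measurableTypeR R * measurableTypeR R)%type]
    (fun z => (partial j f (vec3 (z, t)))%:E).
  apply: (@bounded_supp_integrable _ _ _ leb2 (fun z => partial j f (vec3 (z, t)))
    (square (0, 0) M) K).
  - exact: measurable_square.
  - have : (leb2 (square (0%R, 0%R) M) < +oo)%E by rewrite leb2_square// ltry.
    by [].
  - have := measurable_comp_vec3 cpf; move/measurable_fun_pair1 => /(_ t).
    exact.
  - by move=> z; exact: fK.
  - move=> z /squareP/not_andP[] /negP; rewrite -ltNge subr0 => Mz.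
      by apply: (f0 _ 0); rewrite vec3E.
    by apply: (f0 _ 1); rewrite vec3E.
move: j df cpf Cpf line Ci fK f0 Ci2; apply: ord3P => df cpf Cpf line Ci fK f0 Ci2.
- rewrite /leb3 -integral21_prod_meas1// integral0_eq// => t _.
  rewrite /fubini_G /leb2 -integral21_prod_meas1//.
  rewrite integral0_eq// => b _; apply: (line (fun s => vec3 (s, b, t))) => s.
  exact: vec3_line2.
- rewrite /leb3 -integral21_prod_meas1// integral0_eq// => t _.
  rewrite /fubini_G /leb2 -integral12_prod_meas1//.
  rewrite integral0_eq// => b _; apply: (line (fun s => vec3 (b, s, t))) => s.
  exact: vec3_line1.
- rewrite /leb3 -integral12_prod_meas1// integral0_eq// => -[a b] _.
  apply: (line (fun s => vec3 (a, b, s))) => s.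
  exact: vec3_line0.
Qed.

Lemma vint_partial j f : (forall x, derivable f x (e_ j)) -> bsupp f ->
  continuous (partial j f) -> vint (partial j f) = 0.
Proof. by move=> df sf cf; rewrite /vint /Rintegral integral_partial. Qed.

End integration_by_parts.

(** * Differentiability classes *)

Section differentiability_classes.
Context {R : realType}.
Implicit Types (f g : 'rV[R]_3 -> R).
Local Notation e_ j := (delta_mx 0 j : 'rV[R]_3).

(** Only derivatives along the axes are required, and only to finite order, because the test
    functions below are glued profiles used as C^1 or C^2 functions. *)
Fixpoint Ck (k : nat) f : Prop :=
  continuous f /\
  if k is k'.+1 then
    forall j, (forall x, derivable f x (e_ j)) /\ Ck k' (partial j f)
  else True.

Fixpoint Dk (k : nat) (h : R -> R) : Prop :=
  continuous h /\
  if k is k'.+1 then (forall t, derivable h t 1) /\ Dk k' (derive1 h) else True.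

Lemma Ck_continuous k f : Ck k f -> continuous f.
Proof. by case: k => [|k] []. Qed.

Lemma Ck_derivable k f j x : Ck k.+1 f -> derivable f x (e_ j).
Proof. by move=> [_ /(_ j)[]]. Qed.

Lemma Ck_partial k f j : Ck k.+1 f -> Ck k (partial j f).
Proof. by move=> [_ /(_ j)[]]. Qed.

Lemma CkW k f : Ck k.+1 f -> Ck k f.
Proof.
elim: k f => [|k IH] f; first by move=> /Ck_continuous.
move=> Cf; split; first exact: Ck_continuous Cf.
by move=> j; split=> [x|]; [exact: Ck_derivable Cf|exact/IH/Ck_partial].
Qed.

Lemma Dk_continuous k h : Dk k h -> continuous h.
Proof. by case: k => [|k] []. Qed.

Lemma is_derive_from_line (V W : normedModType R) (f : V -> W) (x v : V) (d : W) :
  is_derive (0 : R) 1 (fun s => f (x + s *: v)) d -> is_derive x v f d.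
Proof.
move=> fd.
have E : (fun h : R => h^-1 *: (((fun s : R => f (x + s *: v)) \o shift 0) (h *: 1) -
    f (x + 0 *: v))) =
    (fun h : R => h^-1 *: ((f \o shift x) (h *: v) - f x)).
  apply/funext => h; congr (_ *: (f _ - f _)).
    by rewrite /= scaler1 addr0 addrC.
  by rewrite scale0r addr0.
apply: DeriveDef.
  by rewrite /derivable -E; exact: (@ex_derive _ _ _ _ _ _ _ fd).
by rewrite /derive -E; exact: (@derive_val _ _ _ _ _ _ _ fd).
Qed.

Lemma is_derive_chain (V : normedModType R) (f : V -> R) (h : R -> R) (x v : V) :
  derivable f x v -> derivable h (f x) 1 ->
  is_derive x v (h \o f) (derive1 h (f x) * 'D_v f x).
Proof.
move=> df dh; apply: is_derive_from_line.
apply: (@is_derive1_comp _ h (fun s => f (x + s *: v))).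
  by rewrite derive1E scale0r addr0; exact: derivableP.
have := @is_derive_line _ _ _ f x v 0; rewrite scale0r addr0; exact.
Qed.

Lemma partial_comp j f (h : R -> R) :
  (forall x, derivable f x (e_ j)) -> (forall t, derivable h t 1) ->
  partial j (fun x => h (f x)) = fun x => derive1 h (f x) * partial j f x.
Proof.
move=> df dh; apply/funext => x.
by have fh := is_derive_chain (df x) (dh (f x)); rewrite /partial (derive_val (is_derive := fh)).
Qed.

Lemma partialD j f g :
  (forall x, derivable f x (e_ j)) -> (forall x, derivable g x (e_ j)) ->
  partial j (fun x => f x + g x) = fun x => partial j f x + partial j g x.
Proof. by move=> df dg; apply/funext => x; rewrite /partial deriveD. Qed.

Lemma partialM j f g :
  (forall x, derivable f x (e_ j)) -> (forall x, derivable g x (e_ j)) ->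
  partial j (fun x => f x * g x) =
  fun x => f x * partial j g x + g x * partial j f x.
Proof. by move=> df dg; apply/funext => x; rewrite /partial deriveM. Qed.

Lemma partial_cst j (c : R) : partial j (fun=> c) = fun=> 0.
Proof. by apply/funext => x; rewrite /partial derive_cst. Qed.

Lemma is_derive_coord (x : 'rV[R]_3) (i j : 'I_3) :
  is_derive x (e_ j) (fun y : 'rV[R]_3 => y 0 i) (i == j)%:R.
Proof.
apply: is_derive_from_line.
rewrite (_ : (fun s => _) = (fun s : R => x 0 i + s * (i == j)%:R)).
  by apply: is_derive_eq; rewrite /= ?scaler0 ?add0r ?addr0 -?[_ *: _]/(_ * _) ?mulr1 ?mul1r.
by apply/funext => s; rewrite !mxE eqxx.
Qed.

Lemma partial_coord (i j : 'I_3) :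
  partial j (fun y : 'rV[R]_3 => y 0 i) = fun=> (i == j)%:R.
Proof. by apply/funext => x; rewrite /partial (derive_val (is_derive := is_derive_coord x i j)). Qed.

Lemma Ck_cst k (c : R) : Ck k (fun=> c).
Proof.
elim: k c => [|k IH] c; split=> //; try exact: cst_continuous.
move=> j; split=> [x|]; first exact: derivable_cst.
by rewrite partial_cst; exact: IH.
Qed.

Lemma Ck_coord k i : Ck k (fun y : 'rV[R]_3 => y 0 i).
Proof.
case: k => [|k]; split=> //; try exact: coord_continuous.
move=> j; split=> [x|]; last by rewrite partial_coord; exact: Ck_cst.
exact: (@ex_derive _ _ _ _ _ _ _ (is_derive_coord x i j)).
Qed.

Lemma CkD k f g : Ck k f -> Ck k g -> Ck k (fun x => f x + g x).
Proof.
elim: k f g => [|k IH] f g Cf Cg.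
  split=> // x; apply: continuousD; first exact: (Ck_continuous Cf).
  exact: (Ck_continuous Cg).
split.
  move=> x; apply: continuousD; first exact: (Ck_continuous Cf).
  exact: (Ck_continuous Cg).
move=> j; split=> [x|].
  by apply: derivableD; [exact: Ck_derivable Cf|exact: Ck_derivable Cg].
rewrite partialD; [|by move=> x; exact: Ck_derivable Cf|by move=> x; exact: Ck_derivable Cg].
by apply: IH; exact: Ck_partial.
Qed.

Lemma CkM k f g : Ck k f -> Ck k g -> Ck k (fun x => f x * g x).
Proof.
elim: k f g => [|k IH] f g Cf Cg.
  split=> // x; apply: continuousM; first exact: (Ck_continuous Cf).
  exact: (Ck_continuous Cg).
split.
  move=> x; apply: continuousM; first exact: (Ck_continuous Cf).
  exact: (Ck_continuous Cg).
move=> j; split=> [x|].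
  by apply: derivableM; [exact: Ck_derivable Cf|exact: Ck_derivable Cg].
rewrite partialM; [|by move=> x; exact: Ck_derivable Cf|by move=> x; exact: Ck_derivable Cg].
by apply: CkD; apply: IH; [exact: CkW|exact: Ck_partial|exact: CkW|exact: Ck_partial].
Qed.

Lemma Ck_comp k f (h : R -> R) : Dk k h -> Ck k f -> Ck k (fun x => h (f x)).
Proof.
elim: k f h => [|k IH] f h Dh Cf.
  split=> // x; apply: continuous_comp; first exact: (Ck_continuous Cf).
  exact: (Dk_continuous Dh).
split.
  move=> x; apply: continuous_comp; first exact: (Ck_continuous Cf).
  exact: (Dk_continuous Dh).
have dh := Dh.2.1.
move=> j; have df x : derivable f x (e_ j) by exact: Ck_derivable Cf.
split=> [x|].
  by have fh := is_derive_chain (df x) (dh (f x)); exact: (@ex_derive _ _ _ _ _ _ _ fh).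
rewrite partial_comp//; apply: CkM; last exact: Ck_partial.
by apply: IH; [exact: Dh.2.2|exact: CkW].
Qed.

Lemma CkZ k f (c : R) : Ck k f -> Ck k (fun x => c * f x).
Proof. by apply: CkM; exact: Ck_cst. Qed.

Lemma CkN k f : Ck k f -> Ck k (fun x => - f x).
Proof.
by move=> /(CkZ (-1)); rewrite (_ : (fun x => -1 * f x) = fun x => - f x)//;
  apply/funext => x; rewrite mulN1r.
Qed.

Lemma CkB k f g : Ck k f -> Ck k g -> Ck k (fun x => f x - g x).
Proof. by move=> Cf Cg; apply: CkD => //; exact: CkN. Qed.

Lemma Ck_sum k (F : 'I_3 -> 'rV[R]_3 -> R) :
  (forall i, Ck k (F i)) -> Ck k (fun x => \sum_(i < 3) F i x).
Proof.
move=> CF; rewrite (_ : (fun x => _) = (fun x => F 0 x + F 1 x + F 2%:R x)).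
  by apply: CkD => //; exact: CkD.
by apply/funext => x; rewrite sum3E.
Qed.

Lemma partial_sum j (F : 'I_3 -> 'rV[R]_3 -> R) :
  (forall i x, derivable (F i) x (e_ j)) ->
  partial j (fun x => \sum_(i < 3) F i x) = fun x => \sum_(i < 3) partial j (F i) x.
Proof.
move=> dF; rewrite (_ : (fun x => \sum_(i < 3) F i x) = \sum_(i < 3) F i).
  by apply/funext => x; rewrite /partial derive_sum.
by apply/funext => x; rewrite fct_sumE.
Qed.

Lemma smooth_scalar_Ck (p : 'rV[R]_3 -> R) : smooth p -> forall k, Ck k p.
Proof.
move=> sp k; rewrite -[p]/(partials [::] p); move: [::] => s.
elim: k s => [|k IH] s; split=> //; try exact: (sp s).1.
by move=> j; split; [exact: (sp s).2|exact: (IH (j :: s))].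
Qed.

Lemma partial_coord_fun (u : 'rV[R]_3 -> 'rV[R]_3) i j :
  (forall x, derivable u x (e_ j)) ->
  partial j (fun x => u x 0 i) = fun x => partial j u x 0 i.
Proof. by move=> du; apply/funext => x; rewrite /partial derive_mx// mxE. Qed.

Lemma smooth_vector_Ck (u : 'rV[R]_3 -> 'rV[R]_3) i : smooth u ->
  forall k, Ck k (fun x => u x 0 i).
Proof.
move=> su k; rewrite -[u]/(partials [::] u); move: [::] => s.
have cs s' : continuous (fun x => partials s' u x 0 i).
  move=> x; apply: (@continuous_comp _ _ _ (partials s' u) (fun M : 'rV[R]_3 => M 0 i)).
    exact: (su s').1.
  exact: coord_continuous.
elim: k s => [|k IH] s; split=> //.
move=> j; split=> [x|].
  exact: ((derivable_mxP _ _ _).1 ((su s).2 j x) 0 i).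
by rewrite partial_coord_fun; [exact: (IH (j :: s))|exact: (su s).2].
Qed.

End differentiability_classes.

(** * Symmetry of second partial derivatives *)

Section schwarz.
Context {R : realType}.
Implicit Types (f : 'rV[R]_3 -> R).
Local Notation e_ j := (delta_mx 0 j : 'rV[R]_3).

(** The mean value theorem is applied along [e_ i] to the increment in direction [e_ j], and once
    more along [e_ j]. The second difference itself is symmetric in i and j, which [partialC]
    exploits. *)
Lemma second_difference_MVT f i j (x : 'rV[R]_3) (h : R) : 0 < h -> Ck 2 f ->
  exists c d : R, [/\ c \in `[0, h], d \in `[0, h] &
    f (x + h *: e_ j + h *: e_ i) - f (x + h *: e_ i) - f (x + h *: e_ j) + f x
    = h ^+ 2 * partial j (partial i f) (x + c *: e_ i + d *: e_ j)].
Proof.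
move=> h0 Cf; have Cif := Ck_partial i Cf.
have dl y (k : 'I_3) (g : 'rV[R]_3 -> R) (t : R) : Ck 1 g ->
    is_derive t 1 (fun s => g (y + s *: e_ k)) (partial k g (y + t *: e_ k)).
  by move=> Cg; apply: is_derive_line; exact: Ck_derivable Cg.
have cl y (k : 'I_3) (g : 'rV[R]_3 -> R) (a b : R) : Ck 1 g ->
    {within `[a, b], continuous (fun s => g (y + s *: e_ k))}.
  move=> Cg; apply: continuous_subspaceT => t.
  apply: differentiable_continuous; apply/derivable1_diffP.
  exact: (@ex_derive _ _ _ _ _ _ _ (dl y k g t Cg)).
have C1f := CkW Cf.
pose g1 s := f (x + h *: e_ j + s *: e_ i) - f (x + s *: e_ i).
have dg1 (t : R) : t \in `]0, h[ -> is_derive t 1 g1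
    (partial i f (x + h *: e_ j + t *: e_ i) - partial i f (x + t *: e_ i)).
  by move=> _; apply: is_deriveB; exact: dl.
have cg1 : {within `[0, h], continuous g1}.
  by move=> t; apply: continuousB; exact: cl.
have [c ch] := MVT_segment (ltW h0) dg1 cg1.
rewrite /g1 !scale0r !addr0 subr0 => E1.
pose g2 s := partial i f (x + c *: e_ i + s *: e_ j).
have dg2 (t : R) : t \in `]0, h[ -> is_derive t 1 g2
    (partial j (partial i f) (x + c *: e_ i + t *: e_ j)).
  by move=> _; exact: dl.
have [d dh] := MVT_segment (ltW h0) dg2 (cl _ _ _ _ _ Cif).
rewrite /g2 !scale0r !addr0 subr0 => E2.
exists c, d; split=> //.
move: E1; rewrite (addrAC x (h *: e_ j) (c *: e_ i)) E2 => E1.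
set P := partial j _ _ in E1 *.
have -> : h ^+ 2 * P = P * h * h by ring.
by rewrite -E1; ring.
Qed.

Lemma lt_half_dist_neq (p q A B : R) :
  `|p - A| < `|p - q| / 2 -> `|q - B| < `|p - q| / 2 -> B <> A.
Proof.
by move=> + + BA; rewrite BA => ? ?; have := ler_distD A p q;
  rewrite (distrC A q); lra.
Qed.

Lemma partialC f i j : Ck 2 f ->
  partial i (partial j f) = partial j (partial i f).
Proof.
move=> Cf; apply/funext => x; apply/eqP/negP => /negP ne.
set a := partial i (partial j f) in ne *; set b := partial j (partial i f) in ne *.
have ca : continuous a := Ck_continuous (Ck_partial i (Ck_partial j Cf)).
have cb : continuous b := Ck_continuous (Ck_partial j (Ck_partial i Cf)).
pose eps := `|a x - b x| / 2.
have e0 : 0 < eps by rewrite divr_gt0// normr_gt0 subr_eq0.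
have na : \forall y \near x, `|a x - a y| < eps by have /cvgrPdist_lt := ca x; apply.
have nb : \forall y \near x, `|b x - b y| < eps by have /cvgrPdist_lt := cb x; apply.
have /nbhs_ballP[r /= r0 rab] :
    nbhs x [set y | `|a x - a y| < eps /\ `|b x - b y| < eps].
  exact: (filterI na nb).
(* Two displacements of length at most h, possibly along the same axis, stay inside the ball of
   radius r. *)
pose h := r / 4.
have h0 : 0 < h by rewrite divr_gt0.
have inb k l (c d : R) : c \in `[0, h] -> d \in `[0, h] ->
    ball x r (x + c *: e_ k + d *: e_ l).
  rewrite !in_itv/= => /andP[c0 ch] /andP[d0 dh].
  split=> // m n; rewrite ord1 /ball/= !mxE eqxx/=.
  rewrite -addrA opprD addrA subrr add0r normrN.
  apply: (@le_lt_trans _ _ (h + h)); last by rewrite /h; lra.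
  rewrite ger0_norm; last by rewrite addr_ge0// mulr_ge0.
  by apply: lerD; [case: (n == k)|case: (n == l)]; rewrite /= ?mulr1 ?mulr0// ltW.
have [c [d [ch dh E1]]] := second_difference_MVT i j x h0 Cf.
have [c' [d' [ch' dh' E2]]] := second_difference_MVT j i x h0 Cf.
have ba : b (x + c *: e_ i + d *: e_ j) = a (x + c' *: e_ j + d' *: e_ i).
  apply: (@mulfI _ (h ^+ 2)); first by rewrite expf_neq0// gt_eqF.
  apply: (etrans (esym E1)); apply: (etrans _ E2).
  by rewrite (addrAC x (h *: e_ j) (h *: e_ i)); ring.
have [_ /= h1] := rab _ (inb i j _ _ ch dh).
have [/= h2 _] := rab _ (inb j i _ _ ch' dh').
exact: lt_half_dist_neq h2 h1 ba.
Qed.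

End schwarz.

(** * The head pressure *)

Section head_pressure.
Context {R : realType}.
Local Notation e_ j := (delta_mx 0 j : 'rV[R]_3).
Implicit Types (f g : 'rV[R]_3 -> R) (v : 'I_3 -> 'rV[R]_3 -> R).

(* [vort_cross v] is (curl v) x v, written without the cross product. *)
Definition vort_cross v (i : 'I_3) (x : 'rV[R]_3) : R :=
  \sum_(j < 3) v j x * (partial j (v i) x - partial i (v j) x).

(** The double sum counts each component of the curl twice; the factor one half makes this |curl
    v|^2. *)
Definition sqr_vort v (x : 'rV[R]_3) : R :=
  2^-1 * \sum_(i < 3) \sum_(j < 3) (partial i (v j) x - partial j (v i) x) ^+ 2.

Definition lap f (x : 'rV[R]_3) : R := \sum_(j < 3) partial j (partial j f) x.

Definition solenoidal v := forall x, \sum_(j < 3) partial j (v j) x = 0.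

(* The stationary Navier-Stokes equations for the head pressure
   Q = p + |v|^2 / 2. *)
Definition head_eqn v (Q : 'rV[R]_3 -> R) :=
  forall i x, partial i Q x = lap (v i) x - vort_cross v i x.

Lemma sqr_vort_ge0 v x : 0 <= sqr_vort v x.
Proof.
by rewrite mulr_ge0 ?invr_ge0//; apply: sumr_ge0 => i _; apply: sumr_ge0 => j _;
  exact: sqr_ge0.
Qed.

(** The pointwise algebra behind Lap Q - v . grad Q = |w|^2: [a i j] stands for the derivative d_i
    v_j, [t i j k] for d_i d_j v_k and [w] for v. The two hypotheses are Schwarz's theorem and the
    differentiated incompressibility. *)
Lemma head_subsolution_algebra (a : 'I_3 -> 'I_3 -> R)
    (t : 'I_3 -> 'I_3 -> 'I_3 -> R) (w : 'I_3 -> R) :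
  (forall i j k, t i j k = t j i k) -> (forall j, \sum_(i < 3) t j i i = 0) ->
  - (\sum_(i < 3) \sum_(j < 3) (w j * (t i j i - t i i j) + (a j i - a i j) * a i j))
  - \sum_(i < 3) w i * (\sum_(j < 3) t j j i - \sum_(j < 3) w j * (a j i - a i j))
  = 2^-1 * \sum_(i < 3) \sum_(j < 3) (a i j - a j i) ^+ 2.
Proof.
move=> tC t0; have := t0 0; have := t0 1; have := t0 2%:R; rewrite !sum3E.
rewrite (tC 1 0 1) (tC 2%:R 0 2%:R) (tC 0 1 0) (tC 2%:R 1 2%:R) (tC 0 2%:R 0)
  (tC 1 2%:R 1).
move: (t 0 0 0) (t 0 1 1) (t 0 2%:R 2%:R) (t 1 0 0) (t 1 1 1) (t 1 2%:R 2%:R)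
  (t 2%:R 0 0) (t 2%:R 1 1) (t 2%:R 2%:R 2%:R).
move=> t000 t011 t022 t100 t111 t122 t200 t211 t222 h2 h1 h0.
(* Incompressibility eliminates the three entries with equal indices; what is left is a polynomial
   identity. *)
have -> : t000 = - (t011 + t022) by lra.
have -> : t111 = - (t100 + t122) by lra.
have -> : t222 = - (t200 + t211) by lra.
by field.
Qed.

Variable v : 'I_3 -> 'rV[R]_3 -> R.
Hypothesis Cv : forall i k, Ck k (v i).
Hypothesis dv0 : solenoidal v.

Let dv k i j x : derivable (partial i (v j)) x (e_ k).
Proof. exact: (@Ck_derivable _ 0 _ _ _ (Ck_partial i (Cv j 2))). Qed.

Lemma solenoidal_partial j x : \sum_(i < 3) partial j (partial i (v i)) x = 0.
Proof.
have := congr1 (fun f => partial j f x) (funext dv0).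
rewrite partial_cst partial_sum; last by move=> i y; exact: dv.
exact.
Qed.

Lemma solenoidal_lap x : \sum_(i < 3) partial i (lap (v i)) x = 0.
Proof.
have dd i j y k : derivable (partial j (partial j (v i))) y (e_ k).
  exact: (@Ck_derivable _ 0 _ _ _ (Ck_partial j (Ck_partial j (Cv i 3)))).
rewrite (eq_bigr (fun i => \sum_(j < 3) partial j (partial j (partial i (v i))) x)).
  rewrite exchange_big big1//= => j _.
  have E : (fun y => \sum_(i < 3) partial j (partial i (v i)) y) = fun=> 0.
    by apply/funext => y; exact: solenoidal_partial.
  have := congr1 (fun f => partial j f x) E.
  rewrite partial_cst partial_sum; first by [].
  by move=> i y; exact: (@Ck_derivable _ 0 _ _ _ (Ck_partial j (Ck_partial i (Cv i 3)))).
move=> i _; rewrite /lap partial_sum; last by move=> j y; exact: dd.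
apply: eq_bigr => j _; rewrite (partialC i j (Ck_partial j (Cv i 3))).
by rewrite (partialC i j (Cv i 2)).
Qed.

Lemma Ck_lap i k : Ck k (lap (v i)).
Proof. by apply: Ck_sum => j; exact/Ck_partial/Ck_partial. Qed.

Lemma Ck_vort_cross i k : Ck k (vort_cross v i).
Proof.
by apply: Ck_sum => j; apply: CkM => //; apply: CkB; exact: Ck_partial.
Qed.

Lemma partial_vort_cross k i x : partial k (vort_cross v i) x =
  \sum_(j < 3) (v j x * (partial k (partial j (v i)) x - partial k (partial i (v j)) x) +
     (partial j (v i) x - partial i (v j) x) * partial k (v j) x).
Proof.
have dB j y : derivable (fun y => partial j (v i) y - partial i (v j) y) y (e_ k).
  by apply: derivableB; exact: dv.
have dvj j y : derivable (v j) y (e_ k) by exact: Ck_derivable (Cv j 1).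
rewrite /vort_cross partial_sum; last by move=> j y; exact: derivableM.
apply: eq_bigr => j _; rewrite partialM//; congr (_ * _ + _).
by rewrite /partial deriveB//; exact: dv.
Qed.

Variable Q : 'rV[R]_3 -> R.
Hypothesis CQ : forall k, Ck k Q.
Hypothesis vQ : head_eqn v Q.

(** The divergence of the head equation: Lap v contributes nothing, being solenoidal like v. *)
Lemma lap_head x : lap Q x = - \sum_(i < 3) partial i (vort_cross v i) x.
Proof.
rewrite -[LHS](addr0) -[in LHS](oppr0) -[in LHS](solenoidal_lap x) /lap.
rewrite -sumrB -sumrN; apply: eq_bigr => i _.
rewrite (funext (vQ i)) /partial deriveB; last 2 first.
  exact: Ck_derivable (Ck_lap i 1).
  exact: Ck_derivable (Ck_vort_cross i 1).
by rewrite addrAC subrr add0r.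
Qed.

Lemma head_subsolution x :
  lap Q x - \sum_(i < 3) v i x * partial i Q x = sqr_vort v x.
Proof.
rewrite lap_head; under eq_bigr do rewrite partial_vort_cross.
under [X in _ - X]eq_bigr do rewrite vQ.
rewrite /lap /vort_cross /sqr_vort.
apply: (@head_subsolution_algebra (fun i j => partial i (v j) x)
  (fun i j k => partial i (partial j (v k)) x) (fun i => v i x)).
- by move=> i j k; rewrite (partialC i j (Cv k 2)).
- by move=> j; exact: solenoidal_partial.
Qed.

End head_pressure.

(** * Weak forms of the equations *)

Section integral_identities.
Context {R : realType}.
Local Notation e_ j := (delta_mx 0 j : 'rV[R]_3).
Implicit Types (f g phi : 'rV[R]_3 -> R) (v X : 'I_3 -> 'rV[R]_3 -> R).

Lemma vint_IBP j f g : Ck 1 f -> Ck 1 g -> bsupp g ->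
  vint (fun x => f x * partial j g x) = - vint (fun x => partial j f x * g x).
Proof.
move=> Cf Cg sg.
have df x : derivable f x (e_ j) := Ck_derivable Cf.
have dg x : derivable g x (e_ j) := Ck_derivable Cg.
have cf := Ck_continuous Cf; have cg := Ck_continuous Cg.
have cpf := Ck_continuous (Ck_partial j Cf).
have cpg := Ck_continuous (Ck_partial j Cg).
have : vint (partial j (fun x => f x * g x)) = 0.
  apply: vint_partial.
  - by move=> x; exact: derivableM.
  - exact: bsuppM.
  - exact: (Ck_continuous (Ck_partial j (CkM Cf Cg))).
have C1 : Cc (fun x => f x * partial j g x).
  by apply: CcMl => //; split => //; exact: bsupp_partial.
have C2 : Cc (fun x => partial j f x * g x) by apply: CcMl.
rewrite partialM// (eq_vint (g := fun x => f x * partial j g x + partial j f x * g x)).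
  by rewrite vintD// => /eqP; rewrite addr_eq0 => /eqP.
by move=> x; rewrite (mulrC (g x)).
Qed.

Lemma vint_IBP' j f g : Ck 1 f -> Ck 1 g -> bsupp g ->
  vint (fun x => partial j f x * g x) = - vint (fun x => f x * partial j g x).
Proof. by move=> Cf Cg sg; rewrite vint_IBP// opprK. Qed.

Lemma vint_div f X : Ck 1 f -> (forall i, Ck 1 (X i)) ->
  (forall i, bsupp (X i)) ->
  vint (fun x => f x * \sum_(i < 3) partial i (X i) x) =
  - vint (fun x => \sum_(i < 3) partial i f x * X i x).
Proof.
move=> Cf CX sX.
have C1 i : Cc (fun x => f x * partial i (X i) x).
  apply: CcMl; first exact: (Ck_continuous Cf).
  by split; [exact: (Ck_continuous (Ck_partial i (CX i)))|exact: bsupp_partial].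
have C2 i : Cc (fun x => partial i f x * X i x).
  apply: CcMl; first exact: (Ck_continuous (Ck_partial i Cf)).
  by split; [exact: (Ck_continuous (CX i))|].
rewrite (eq_vint (g := fun x => \sum_(i < 3) f x * partial i (X i) x)); last first.
  by move=> x; rewrite mulr_sumr.
rewrite (vint_sum C1) (vint_sum C2) -sumrN.
by apply: eq_bigr => i _; rewrite vint_IBP.
Qed.

Lemma vint_lap f phi : Ck 2 f -> Ck 2 phi -> bsupp phi ->
  vint (fun x => lap f x * phi x) = vint (fun x => f x * lap phi x).
Proof.
move=> Cf Cp sp.
have C0 (g : 'rV[R]_3 -> R) j : Ck 2 g -> continuous (partial j (partial j g)).
  by move=> Cg; exact: (Ck_continuous (Ck_partial j (Ck_partial j Cg))).
have C1 j : Cc (fun x => partial j (partial j f) x * phi x).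
  by apply: CcMl; [exact: C0|split => //; exact: (Ck_continuous Cp)].
have C2 j : Cc (fun x => f x * partial j (partial j phi) x).
  apply: CcMl; [exact: (Ck_continuous Cf)|split; first exact: C0].
  by apply: bsupp_partial; exact: bsupp_partial.
rewrite (eq_vint (g := fun x => \sum_(j < 3) partial j (partial j f) x * phi x));
  last by move=> x; rewrite /lap mulr_suml.
rewrite [RHS](eq_vint (g := fun x => \sum_(j < 3) f x * partial j (partial j phi) x));
  last by move=> x; rewrite /lap mulr_sumr.
rewrite (vint_sum C1) (vint_sum C2); apply: eq_bigr => j _.
rewrite vint_IBP'//; [|exact: Ck_partial|exact: CkW].
rewrite -vint_IBP//; [exact: CkW|exact: Ck_partial|exact: bsupp_partial].
Qed.

Lemma vint_advection v f phi : (forall i, Ck 1 (v i)) -> solenoidal v ->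
  Ck 1 f -> Ck 1 phi -> bsupp phi ->
  vint (fun x => (\sum_(i < 3) v i x * partial i f x) * phi x) =
  - vint (fun x => f x * \sum_(i < 3) v i x * partial i phi x).
Proof.
move=> Cv dv0 Cf Cp sp.
have E := @vint_div f (fun i x => v i x * phi x) Cf.
rewrite (eq_vint (g := fun x => \sum_(i < 3) partial i f x * (v i x * phi x)));
  last first.
  by move=> x; rewrite mulr_suml; apply: eq_bigr => i _; rewrite mulrCA mulrA.
rewrite -[LHS]opprK; congr (- _); rewrite -E; last 2 first.
- by move=> i; exact: CkM.
- by move=> i; exact: bsuppM.
apply: eq_vint => x; congr (_ * _).
rewrite (eq_bigr (fun i => v i x * partial i phi x + phi x * partial i (v i) x)).
  by rewrite big_split/= -mulr_sumr dv0 mulr0 addr0.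
move=> i _; rewrite partialM// => y; [exact: Ck_derivable (Cv i)|exact: Ck_derivable Cp].
Qed.

(* Integrating by parts twice turns the Laplacian of a solenoidal field, tested
   against a field with symmetric Jacobian, into derivatives of its divergence. *)
Lemma vint_lap_gradient v X : (forall i k, Ck k (v i)) -> solenoidal v ->
  (forall i, Ck 1 (X i)) -> (forall i, bsupp (X i)) ->
  (forall i j x, partial i (X j) x = partial j (X i) x) ->
  vint (fun x => \sum_(i < 3) lap (v i) x * X i x) = 0.
Proof.
move=> Cv dv0 CX sX symX.
have C0 i j k : continuous (partial i (partial j (v k))).
  by exact: (Ck_continuous (Ck_partial i (Ck_partial j (Cv k 2)))).
have C1 i : Cc (fun x => lap (v i) x * X i x).
  apply: CcMl; first by exact: (Ck_continuous (Ck_lap Cv i 0)).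
  by split=> //; exact: (Ck_continuous (CX i)).
have C2 i j k l : Cc (fun x => partial i (partial j (v k)) x * X l x).
  by apply: CcMl; [exact: C0|split=> //; exact: (Ck_continuous (CX l))].
rewrite (vint_sum C1).
(* After one integration by parts the symmetry of the Jacobian trades d_j X_i for d_i X_j;
   integrating back, the sum over i produces d_j (div v). *)
have swap i j : vint (fun x => partial j (partial j (v i)) x * X i x) =
    vint (fun x => partial i (partial j (v i)) x * X j x).
  rewrite vint_IBP'//; last exact: Ck_partial.
  rewrite (eq_vint (g := fun x => partial j (v i) x * partial i (X j) x)).
    by rewrite -vint_IBP'//; exact: Ck_partial.
  by move=> x; rewrite symX.
rewrite (eq_bigr (fun i => \sum_(j < 3)
    vint (fun x => partial j (partial i (v i)) x * X j x))); last first.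
  move=> i _; rewrite (eq_vint (g := fun x => \sum_(j < 3)
      partial j (partial j (v i)) x * X i x)); last first.
    by move=> x; rewrite /lap mulr_suml.
  rewrite vint_sum//; apply: eq_bigr => j _; rewrite swap.
  by rewrite (partialC i j (Cv i 2)).
rewrite exchange_big big1//= => j _; rewrite -vint_sum//.
rewrite (eq_vint (g := fun=> 0)); first by rewrite /vint /Rintegral integral0.
by move=> x; rewrite -mulr_suml solenoidal_partial ?mul0r.
Qed.

(** A substitute for a representation formula of [Q]: on the right only v and its first derivatives
    survive, by [vint_lap_gradient]. *)
Lemma vint_head_div v Q X : (forall i k, Ck k (v i)) -> solenoidal v ->
  Ck 1 Q -> head_eqn v Q ->
  (forall i, Ck 1 (X i)) -> (forall i, bsupp (X i)) ->
  (forall i j x, partial i (X j) x = partial j (X i) x) ->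
  vint (fun x => Q x * \sum_(i < 3) partial i (X i) x) =
  vint (fun x => \sum_(i < 3) vort_cross v i x * X i x).
Proof.
move=> Cv dv0 CQ vQ CX sX symX; rewrite vint_div//.
have C1 i : Cc (fun x => lap (v i) x * X i x).
  apply: CcMl; first by exact: (Ck_continuous (Ck_lap Cv i 0)).
  by split=> //; exact: (Ck_continuous (CX i)).
have C2 i : Cc (fun x => vort_cross v i x * X i x).
  apply: CcMl; first by exact: (Ck_continuous (Ck_vort_cross Cv i 0)).
  by split=> //; exact: (Ck_continuous (CX i)).
rewrite (eq_vint (g := fun x => \sum_(i < 3) lap (v i) x * X i x -
   \sum_(i < 3) vort_cross v i x * X i x)).
  rewrite vintB; [|exact: Cc_sum|exact: Cc_sum].
  by rewrite vint_lap_gradient// sub0r opprK.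
by move=> x; rewrite -sumrB; apply: eq_bigr => i _; rewrite vQ mulrBl.
Qed.

End integral_identities.

(** * Radial test functions *)

Section radial_profiles.
Context {R : realType}.
Implicit Types (F G : R -> R) (s t c : R).

Definition ramp t : R := Num.max t 0.

Definition glue c F G : R -> R := fun s => if s < c then F s else G s.

Lemma is_derive_glue_at F G c (d : R) : F c = G c ->
  is_derive c 1 F d -> is_derive c 1 G d -> is_derive c 1 (glue c F G) d.
Proof.
move=> FG dF dG.
have cF := @ex_derive _ _ _ _ _ _ _ dF; have cG := @ex_derive _ _ _ _ _ _ _ dG.
have vF := @derive_val _ _ _ _ _ _ _ dF; have vG := @derive_val _ _ _ _ _ _ _ dG.
have lim_glue : (fun h : R => h^-1 *: ((glue c F G \o shift c) (h *: 1) - glue c F G c))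
    @ 0^' --> d.
  have lF : (fun h : R => h^-1 *: ((F \o shift c) (h *: 1) - F c)) @ 0^' --> d.
    by rewrite -vF; exact: cF.
  have lG : (fun h : R => h^-1 *: ((G \o shift c) (h *: 1) - G c)) @ 0^' --> d.
    by rewrite -vG; exact: cG.
  apply/cvgrPdist_lt => e e0.
  move/cvgrPdist_lt : lF => /(_ e e0) lF; move/cvgrPdist_lt : lG => /(_ e e0) lG.
  near=> h; have hF : `|d - h^-1 *: ((F \o shift c) (h *: 1) - F c)| < e.
    by near: h.
  have hG : `|d - h^-1 *: ((G \o shift c) (h *: 1) - G c)| < e by near: h.
  rewrite /glue /= ltxx; case: ifPn => _; last exact: hG.
  by rewrite -FG; exact: hF.
apply: DeriveDef; first by apply/cvg_ex; exists d.
exact/cvg_lim.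
Unshelve. all: by end_near. Qed.

Lemma is_derive_glue F G dF dG c :
  (forall s, s <= c -> is_derive s 1 F (dF s)) ->
  (forall s, c <= s -> is_derive s 1 G (dG s)) ->
  F c = G c -> dF c = dG c ->
  forall s, is_derive s 1 (glue c F G) (glue c dF dG s).
Proof.
move=> hF hG FG dFG s; have [sc|cs|->] := ltgtP s c.
- rewrite {2}/glue sc; apply: near_eq_is_derive (hF s (ltW sc)).
  by near=> x; rewrite /glue ifT//; near: x; exact: lt_nbhsl.
- rewrite {2}/glue ltNge ltW//=; apply: near_eq_is_derive (hG s (ltW cs)).
  near=> x; rewrite /glue ltNge ltW//=; near: x; exact: lt_nbhsr.
- rewrite {2}/glue ltxx; apply: is_derive_glue_at => //.
    by rewrite -dFG; exact: hF.
  exact: hG.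
Unshelve. all: by end_near. Qed.

Lemma is_derive_continuous F dF :
  (forall s, is_derive s 1 F (dF s)) -> continuous F.
Proof.
move=> dFs s; apply: differentiable_continuous; apply/derivable1_diffP.
exact: (@ex_derive _ _ _ _ _ _ _ (dFs s)).
Qed.

Lemma Dk_is_derive k F dF :
  (forall s, is_derive s 1 F (dF s)) -> Dk k dF -> Dk k.+1 F.
Proof.
move=> dFs Dd; split; first exact: is_derive_continuous dFs.
split; first by move=> s; exact: (@ex_derive _ _ _ _ _ _ _ (dFs s)).
rewrite (_ : derive1 F = dF)//; apply/funext => s.
by rewrite derive1E; exact: (@derive_val _ _ _ _ _ _ _ (dFs s)).
Qed.

Lemma is_derive_expr n t :
  is_derive t 1 (fun s : R => s ^+ n) (n%:R * t ^+ n.-1).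
Proof.
rewrite (_ : (fun s : R => s ^+ n) = (id : R -> R) ^+ n); last first.
  by apply/funext => s; rewrite exprfctE.
have := @is_deriveX R R id n t 1 1 (is_derive_id t 1).
by rewrite -[_ *: _]/(_ * _) mulr1.
Qed.

Lemma is_derive_rampX n t :
  is_derive t 1 (fun s => ramp s ^+ n.+2) (n.+2%:R * ramp t ^+ n.+1).
Proof.
have -> : (fun s => ramp s ^+ n.+2) = glue 0 (fun=> 0) (fun s => s ^+ n.+2).
  apply/funext => s; rewrite /glue /ramp; case: ltP => [s0|s0].
    by rewrite expr0n.
  by [].
have -> : n.+2%:R * ramp t ^+ n.+1 =
    glue 0 (fun=> 0) (fun s => n.+2%:R * s ^+ n.+1) t.
  rewrite /glue /ramp; case: ltP => [s0|s0].
    by rewrite expr0n mulr0.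
  by [].
apply: is_derive_glue; rewrite ?expr0n ?mulr0// => s _.
exact: is_derive_expr.
Qed.

Lemma continuous_ramp : continuous ramp.
Proof. by move=> t; apply: continuous_max => //; exact: cvg_cst. Qed.

Lemma ramp_ge0 t : 0 <= ramp t.
Proof. by rewrite /ramp le_max lexx orbT. Qed.

Lemma is_derive_affine (F : R -> R) (a b t d : R) : is_derive (b + a * t) 1 F d ->
  is_derive t 1 (fun s => F (b + a * s)) (d * a).
Proof.
move=> dF; apply: (@is_derive1_comp _ F (fun s => b + a * s)).
have := is_deriveD (is_derive_cst b t (1 : R)) (is_deriveZ a (is_derive_id t (1 : R))).
by rewrite add0r -[a *: 1]/(a * 1) mulr1.
Qed.

(** Truncated powers are nearly closed under differentiation, each derivative being a multiple of
    the previous power. This is what later makes the gradient of [cutoff] comparable with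
    [mollifier]. *)
Definition bump n s : R := ramp (1 - s) ^+ n.

Lemma bump_ge0 n s : 0 <= bump n s.
Proof. by rewrite exprn_ge0// ramp_ge0. Qed.

Lemma bump_out n s : 1 <= s -> bump n.+1 s = 0.
Proof. by move=> s1; rewrite /bump /ramp max_r ?expr0n// subr_le0. Qed.

Lemma bump_le1 n s : 0 <= s -> bump n s <= 1.
Proof.
move=> s0; rewrite exprn_ile1// ?ramp_ge0// /ramp ge_max ler01 andbT; lra.
Qed.

Lemma is_derive_bump n s :
  is_derive s 1 (bump n.+2) (- n.+2%:R * bump n.+1 s).
Proof.
have := @is_derive_affine (fun t => ramp t ^+ n.+2) (-1) 1 s _ (is_derive_rampX n _).
rewrite mulN1r mulrN1 -mulNr (_ : (fun t => ramp (1 + -1 * t) ^+ n.+2) = bump n.+2)//.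
by apply/funext => t; rewrite mulN1r.
Qed.

Lemma continuous_bump n : continuous (bump n).
Proof.
move=> s; apply: (@continuous_comp _ _ _ (fun s => ramp (1 - s)) (fun t => t ^+ n)).
  apply: (@continuous_comp _ _ _ (fun s => 1 - s) ramp); last exact: continuous_ramp.
  by apply: continuousB; [exact: cst_continuous|exact: cvg_id].
exact: exprn_continuous.
Qed.

Lemma Dk_scale k F (c : R) : Dk k F -> Dk k (fun s => c * F s).
Proof.
elim: k F => [|k IH] F; first by
  move=> [cF _]; split=> // s; apply: (@continuous_comp _ _ _ F ( *%R c));
  [exact: cF|exact: mulrl_continuous].
move=> [cF [dF DF]]; apply: (@Dk_is_derive _ _ (fun s => c * derive1 F s)).
  move=> s; have := derivableP (dF s); rewrite -derive1E => dFs.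
  exact: (is_deriveZ c dFs).
exact: IH.
Qed.

Lemma Dk_dilate k F (c : R) : Dk k F -> Dk k (fun s => F (c * s)).
Proof.
elim: k F => [|k IH] F.
  move=> [cF _]; split=> // s; apply: (@continuous_comp _ _ _ ( *%R c) F).
    exact: mulrl_continuous.
  exact: cF.
move=> [cF [dF DF]]; apply: (@Dk_is_derive _ _ (fun s => c * derive1 F (c * s))).
  move=> s; have := derivableP (dF (0 + c * s)); rewrite -derive1E => dFs.
  have := is_derive_affine dFs; rewrite add0r mulrC => H.
  by rewrite (_ : (fun s => F (c * s)) = fun s => F (0 + c * s))//;
    apply/funext => t; rewrite add0r.
by apply: Dk_scale; exact: IH.
Qed.

Lemma Dk_bump1 n : Dk 1 (bump n.+2).
Proof.
apply: (Dk_is_derive (is_derive_bump n)); apply: Dk_scale; split=> //.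
exact: continuous_bump.
Qed.

Lemma Dk_bump2 n : Dk 2 (bump n.+3).
Proof.
apply: (Dk_is_derive (is_derive_bump n.+1)); apply: Dk_scale; exact: Dk_bump1.
Qed.

End radial_profiles.

(** * A regularised Newtonian profile *)

Section newtonian_profile.
Context {R : realType}.
Implicit Types (s t c : R).

Lemma is_derive_invsqrtX n s : 0 < s ->
  is_derive s 1 (fun s => (Num.sqrt s) ^- n)
    (- (n%:R / 2) * (Num.sqrt s) ^- n.+2).
Proof.
move=> s0; have q0 : 0 < Num.sqrt s by rewrite sqrtr_gt0.
have qn0 : Num.sqrt s ^+ n != 0 by rewrite expf_neq0// gt_eqF.
have dq := is_derive1_sqrt s0.
have dqn : is_derive s 1 (fun s => Num.sqrt s ^+ n)
    (n%:R * Num.sqrt s ^+ n.-1 * (2 * Num.sqrt s)^-1).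
  exact: (is_derive1_comp (is_derive_expr n (Num.sqrt s)) dq).
have cqn := @ex_derive _ _ _ _ _ _ _ dqn.
apply: DeriveDef; first exact: derivableV.
rewrite deriveV// (@derive_val _ _ _ _ _ _ _ dqn) -[_ *: _]/(_ * _).
case: n {dqn cqn} qn0 => [|n] qn0; first by rewrite !mul0r !mulr0 oppr0 mul0r.
rewrite /= !exprS; move: (Num.sqrt s) q0 qn0 => q q0 _.
have := gt_eqF q0; have : q ^+ n != 0 by rewrite expf_neq0// gt_eqF.
by move: (q ^+ n) => w w0 /negbT q0'; field; rewrite ?w0 ?q0'.
Qed.

(* [newt (|x|^2)] is C^2 and coincides with [|x|^-3] outside the unit ball, the
   polynomial being the second-order Taylor expansion of [s^(-3/2)] at 1. *)
Definition newt : R -> R :=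
  glue 1 (fun s => 1 + 3 / 2 * (1 - s) + 15 / 8 * (1 - s) ^+ 2)
         (fun s => (Num.sqrt s) ^- 3).

Definition newt' : R -> R :=
  glue 1 (fun s => - (3 / 2) - 15 / 4 * (1 - s))
         (fun s => - (3 / 2) * (Num.sqrt s) ^- 5).

Lemma is_derive_quadratic (a b c s : R) :
  is_derive s 1 (fun s => a + b * (1 - s) + c * (1 - s) ^+ 2)
    (- b - c * 2 * (1 - s)).
Proof.
have d1 : is_derive s 1 (fun t => 1 - t : R) (-1).
  have := @is_derive_affine R id (-1) 1 s 1 (is_derive_id _ _).
  by rewrite mul1r; under eq_fun do rewrite mulN1r.
have d2 := @is_derive1_comp R (fun y => y ^+ 2) (fun t => 1 - t) s _ _
  (is_derive_expr 2 (1 - s)) d1.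
have H : is_derive s 1 (fun s => a + b * (1 - s) + c * (1 - s) ^+ 2)
    (0 + b * -1 + c * (2 * (1 - s) * -1)).
  exact: (is_deriveD (is_deriveD (is_derive_cst a s (1 : R)) (is_deriveZ b d1))
    (is_deriveZ c d2)).
by apply: (is_derive_eq H); ring.
Qed.

Lemma is_derive_newt s : is_derive s 1 newt (newt' s).
Proof.
apply: is_derive_glue.
- move=> t _; have := is_derive_quadratic 1 (3 / 2) (15 / 8) t.
  by rewrite (_ : 15 / 8 * 2 = 15 / 4)//; field.
- move=> t t1; apply: is_derive_invsqrtX; exact: lt_le_trans t1.
- by rewrite /= sqrtr1 expr1n invr1; ring.
- by rewrite /= sqrtr1 expr1n invr1; ring.
Qed.

Lemma is_derive_newt' s : is_derive s 1 newt'
  (glue 1 (fun=> 15 / 4) (fun s => 15 / 4 * (Num.sqrt s) ^- 7) s).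
Proof.
apply: is_derive_glue.
- move=> t _; have := is_derive_quadratic (- (3 / 2)) (- (15 / 4)) 0 t.
  rewrite mul0r mul0r subr0 opprK.
  rewrite (_ : (fun s => _) = fun s => - (3 / 2) - 15 / 4 * (1 - s))//.
  by apply/funext => y; ring.
- move=> t t1; have t0 : 0 < t by exact: lt_le_trans t1.
  apply: (is_derive_eq (is_deriveZ (- (3 / 2)) (is_derive_invsqrtX 5 t0))).
  by rewrite -[_ *: _]/(_ * _); field; rewrite gt_eqF ?sqrtr_gt0.
- by rewrite /= sqrtr1 expr1n invr1; ring.
- by rewrite /= sqrtr1 expr1n invr1; ring.
Qed.

Lemma Dk_newt : Dk 1 newt.
Proof.
apply: (Dk_is_derive is_derive_newt); split=> //.
exact: is_derive_continuous is_derive_newt'.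
Qed.

(** The left-hand side is the divergence of the field x a(|x|^2) for a = [newt], at s = |x|^2. It
    vanishes for s^(-3/2), and inside the unit ball the Taylor polynomial leaves only the quadratic
    term in 1 - s, with coefficient 105/8. *)
Lemma newt_div s : 3 * newt s + 2 * s * newt' s = 105 / 8 * bump 2 s.
Proof.
rewrite /newt /newt' /glue /bump /ramp; case: ltP => s1.
  by rewrite max_l ?subr_ge0 ?ltW//; field.
rewrite max_r ?subr_le0// expr0n mulr0.
have q0 : 0 < Num.sqrt s by rewrite sqrtr_gt0; exact: lt_le_trans s1.
have : s = Num.sqrt s ^+ 2 by rewrite sqr_sqrtr//; exact: le_trans s1.
by move: (Num.sqrt s) q0 => q q0 ->; field; rewrite gt_eqF.
Qed.

Lemma newt_ge0 s : 0 <= newt s.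
Proof.
rewrite /newt /glue; case: ltP => s1; last by rewrite invr_ge0 exprn_ge0// sqrtr_ge0.
by rewrite !addr_ge0// mulr_ge0// ?sqr_ge0//; lra.
Qed.

Lemma newt_le s : 0 < s -> newt s <= (Num.sqrt s) ^- 3.
Proof.
move=> s0; rewrite /newt /glue; case: ltP => // s1.
have q0 : 0 < Num.sqrt s by rewrite sqrtr_gt0.
have q1 : Num.sqrt s < 1 by rewrite -sqrtr1 ltr_sqrt; [exact: s1|exact: ltr01].
have : s = Num.sqrt s ^+ 2 by rewrite sqr_sqrtr// ltW.
move: (Num.sqrt s) q0 q1 => q q0 q1 ->.
rewrite -(ler_pM2r (exprn_gt0 3 q0)) mulVf; last by rewrite expf_neq0// gt_eqF.
(* The difference has a triple zero at q = 1 because the inner polynomial is a second-order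
   expansion there; the cofactor has positive coefficients. *)
rewrite -subr_ge0 (_ : _ - _ = (1 - q) ^+ 3 *
  (8 + 24 * q + 48 * q ^+ 2 + 45 * q ^+ 3 + 15 * q ^+ 4) / 8); last by field.
have p1 : 0 <= (1 - q) ^+ 3 by rewrite exprn_ge0// subr_ge0 ltW.
rewrite divr_ge0// mulr_ge0//.
by rewrite !addr_ge0// ?mulr_ge0// ?exprn_ge0// ltW.
Qed.

(** 35/8 is the value at 0 of the inner polynomial, which decreases on [0, 1]. *)
Lemma newt_le_cst s : 0 <= s -> newt s <= 35 / 8.
Proof.
move=> s0; rewrite /newt /glue; case: ltP => s1; first nra.
have q1 : 1 <= Num.sqrt s by rewrite -sqrtr1 ler_sqrt//; lra.
have q31 : 1 <= Num.sqrt s ^+ 3 by rewrite exprn_ege1.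
by apply: (@le_trans _ _ 1); [rewrite invf_le1// (lt_le_trans _ q31)|lra].
Qed.

End newtonian_profile.

(** * Radial vector fields *)

Section radial_fields.
Context {R : realType}.
Local Notation e_ j := (delta_mx 0 j : 'rV[R]_3).
Implicit Types (x : 'rV[R]_3) (r : R).

Definition dist2 (x0 x : 'rV[R]_3) : R := \sum_(i < 3) (x 0 i - x0 0 i) ^+ 2.

Lemma dist2_ge0 x0 x : 0 <= dist2 x0 x.
Proof. by apply: sumr_ge0 => i _; exact: sqr_ge0. Qed.

Lemma coord_dist2 x0 x i : (x 0 i - x0 0 i) ^+ 2 <= dist2 x0 x.
Proof.
by rewrite /dist2 (bigD1 i)//= lerDl; apply: sumr_ge0 => j _; exact: sqr_ge0.
Qed.

Lemma Ck_centered k (x0 : 'rV[R]_3) i : Ck k (fun x => x 0 i - x0 0 i).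
Proof. by apply: CkB; [exact: Ck_coord|exact: Ck_cst]. Qed.

Lemma partial_centered j (x0 : 'rV[R]_3) i :
  partial j (fun x => x 0 i - x0 0 i) = fun=> (i == j)%:R.
Proof.
rewrite partialD; last 2 first.
- by move=> x; exact: Ck_derivable (Ck_coord 1 i).
- by move=> x; exact: Ck_derivable (Ck_cst 1 _).
by rewrite partial_coord partial_cst; apply/funext => x; rewrite addr0.
Qed.

Lemma Ck_dist2 k x0 : Ck k (dist2 x0).
Proof.
rewrite (_ : dist2 x0 = fun x => \sum_(i < 3) (x 0 i - x0 0 i) * (x 0 i - x0 0 i)).
  by apply: Ck_sum => i; apply: CkM; exact: Ck_centered.
by apply/funext => x; apply: eq_bigr => i _; rewrite expr2.
Qed.

Lemma partial_dist2 j x0 : partial j (dist2 x0) = fun x => 2 * (x 0 j - x0 0 j).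
Proof.
have dc i x : derivable (fun x => x 0 i - x0 0 i) x (e_ j).
  exact: Ck_derivable (Ck_centered 1 x0 i).
rewrite (_ : dist2 x0 = fun x => \sum_(i < 3) (x 0 i - x0 0 i) * (x 0 i - x0 0 i)).
  rewrite partial_sum; last by move=> i x; exact: derivableM.
  apply/funext => x; rewrite (bigD1 j)//= big1 ?addr0.
    by rewrite partialM// partial_centered /= eqxx /=; ring.
  by move=> i ij; rewrite partialM// partial_centered /= (negbTE ij) mulr0 addr0.
by apply/funext => x; apply: eq_bigr => i _; rewrite expr2.
Qed.

Lemma bsupp_radial (F : R -> R) (M : R) x0 : (forall s, M <= s -> F s = 0) ->
  bsupp (fun x => F (dist2 x0 x)).
Proof.
(* Outside this range |x_i - x0_i| > |M| + 1, whose square is at least M. *)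
move=> F0; exists (`|M| + 1 + \sum_(i < 3) `|x0 0 i|) => x i Mx.
apply: F0; apply: le_trans (coord_dist2 x0 x i).
have x0i : `|x0 0 i| <= \sum_(i < 3) `|x0 0 i|.
  by rewrite (bigD1 i)//= lerDl; apply: sumr_ge0.
have xi : `|M| + 1 < `|x 0 i - x0 0 i|.
  by have := ler_distD 0 (x 0 i) (x0 0 i); have := lerB_dist (x 0 i) (x0 0 i); lra.
rewrite -[X in _ <= X]ger0_norm ?sqr_ge0// normrX.
move: xi (ler_norm M) (normr_ge0 M); move: (`|x 0 i - _|) (`|M|) => a b; nra.
Qed.

Variable a : R -> R.
Hypothesis Da : Dk 1 a.

Definition radial_field (x0 : 'rV[R]_3) (i : 'I_3) x := (x 0 i - x0 0 i) * a (dist2 x0 x).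

Lemma Ck_radial_field x0 i : Ck 1 (radial_field x0 i).
Proof. by apply: CkM; [exact: Ck_centered|apply: Ck_comp => //; exact: Ck_dist2]. Qed.

Lemma partial_radial x0 j : partial j (fun x => a (dist2 x0 x)) =
  fun x => derive1 a (dist2 x0 x) * (2 * (x 0 j - x0 0 j)).
Proof.
rewrite partial_comp; last by move=> t; exact: Da.2.1.
  by rewrite partial_dist2.
by move=> x; exact: Ck_derivable (Ck_dist2 1 x0).
Qed.

Lemma partial_radial_field x0 i j x : partial j (radial_field x0 i) x =
  (i == j)%:R * a (dist2 x0 x) +
  2 * (x 0 i - x0 0 i) * (x 0 j - x0 0 j) * derive1 a (dist2 x0 x).
Proof.
rewrite partialM.
- by rewrite partial_centered partial_radial /=; ring.
- by move=> y; exact: Ck_derivable (Ck_centered 1 x0 i).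
- by move=> y; exact: Ck_derivable (Ck_comp Da (Ck_dist2 1 x0)).
Qed.

(** Such a field is the gradient of a radial function; the symmetry makes it admissible in
    [vint_head_div]. *)
Lemma partial_radial_field_sym x0 i j x :
  partial i (radial_field x0 j) x = partial j (radial_field x0 i) x.
Proof. by rewrite !partial_radial_field eq_sym; ring. Qed.

Lemma div_radial_field x0 x : \sum_(i < 3) partial i (radial_field x0 i) x =
  3 * a (dist2 x0 x) + 2 * dist2 x0 x * derive1 a (dist2 x0 x).
Proof.
under eq_bigr do rewrite partial_radial_field eqxx mul1r.
by rewrite [X in 2 * X * _]/dist2 !sum3E; ring.
Qed.

Lemma bsupp_radial_field x0 i (M : R) : (forall s, M <= s -> a s = 0) ->
  bsupp (radial_field x0 i).
Proof. by move=> a0; apply: bsuppM; exact: bsupp_radial a0. Qed.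

End radial_fields.

(** * Smoothed Newtonian kernels and mollifiers *)

Section kernels.
Context {R : realType}.
Local Notation e_ j := (delta_mx 0 j : 'rV[R]_3).
Implicit Types (x : 'rV[R]_3) (r d S s : R).

(* Smoothing at scale [r] of the normalised Newtonian field |x|^-3, so that
   [mollifier] is the corresponding approximate Dirac mass, of mass 4 pi. *)
Definition newt_scaled r s : R := r ^- 3 * newt (r ^- 2 * s).

Definition mollifier (x0 : 'rV[R]_3) r x : R :=
  r ^- 3 * (105 / 8 * bump 2 (r ^- 2 * dist2 x0 x)).

(** Both scaled profiles equal s^(-3/2) beyond the larger scale, so their difference yields a
    compactly supported test field. *)
Definition newt_diff d S s : R := newt_scaled d s - newt_scaled S s.

Lemma Dk_newt_scaled r : Dk 1 (newt_scaled r).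
Proof. by apply: Dk_scale; apply: Dk_dilate; exact: Dk_newt. Qed.

Lemma is_derive_newt_scaled r s :
  is_derive s 1 (newt_scaled r) (r ^- 3 * (newt' (r ^- 2 * s) * r ^- 2)).
Proof.
have H := is_derive_affine (is_derive_newt (0 + r ^- 2 * s)).
have E : (fun s => newt (0 + r ^- 2 * s)) = fun s => newt (r ^- 2 * s).
  by apply/funext => t; rewrite add0r.
by rewrite E add0r in H; exact: (is_deriveZ (r ^- 3) H).
Qed.

Lemma is_derive_newt_diff d S s : is_derive s 1 (newt_diff d S)
  (d ^- 3 * (newt' (d ^- 2 * s) * d ^- 2) - S ^- 3 * (newt' (S ^- 2 * s) * S ^- 2)).
Proof. by apply: is_deriveB; exact: is_derive_newt_scaled. Qed.

Lemma Dk_newt_diff d S : Dk 1 (newt_diff d S).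
Proof.
apply: (Dk_is_derive (is_derive_newt_diff d S)); split=> // s.
have c r : continuous (fun s => r ^- 3 * (newt' (r ^- 2 * s) * r ^- 2)).
  have := (Dk_newt_scaled r).2.2.1; rewrite (_ : derive1 _ = fun s =>
    r ^- 3 * (newt' (r ^- 2 * s) * r ^- 2))//.
  apply/funext => t; rewrite derive1E.
  exact: (@derive_val _ _ _ _ _ _ _ (is_derive_newt_scaled r t)).
exact: (continuousB (@c d s) (@c S s)).
Qed.

Lemma newt_diff_out d S s : 0 < d -> d <= S -> S ^+ 2 <= s -> newt_diff d S s = 0.
Proof.
move=> d0 dS Ss; have S0 : 0 < S by exact: lt_le_trans dS.
have s0 : 0 < s by apply: lt_le_trans Ss; rewrite exprn_gt0.
have out r : 0 < r -> r ^+ 2 <= s -> newt_scaled r s = (Num.sqrt s) ^- 3.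
  move=> r0 rs; rewrite /newt_scaled /newt /glue ltNge.
  rewrite -[X in X <= _](@mulVf _ (r ^+ 2)) ?expf_neq0 ?gt_eqF//.
  rewrite ler_pM2l ?invr_gt0 ?exprn_gt0// rs/=.
  have -> : Num.sqrt (r ^- 2 * s) = Num.sqrt s / r.
    by rewrite sqrtrM ?invr_ge0 ?exprn_ge0 ?ltW// -exprVn sqrtr_sqr gtr0_norm
      ?invr_gt0// mulrC.
  have : 0 < Num.sqrt s by rewrite sqrtr_gt0.
  by move: (Num.sqrt s) => q q0; field; rewrite !gt_eqF.
rewrite /newt_diff !out ?subrr//.
by apply: le_trans Ss; rewrite lerXn2r// nnegrE ltW.
Qed.

Lemma div_newt_diff d S x0 x : d != 0 -> S != 0 ->
  \sum_(i < 3) partial i (radial_field (newt_diff d S) x0 i) x =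
  mollifier x0 d x - mollifier x0 S x.
Proof.
move=> d0 S0; rewrite div_radial_field; last exact: Dk_newt_diff.
rewrite derive1E (@derive_val _ _ _ _ _ _ _ (is_derive_newt_diff d S _)).
rewrite /mollifier -!newt_div /newt_diff /newt_scaled.
by move: (newt _) (newt' _) (newt _) (newt' _) => *; field; rewrite d0 S0.
Qed.

Lemma Ck_mollifier x0 r : Ck 1 (mollifier x0 r).
Proof.
apply: CkZ; apply: CkZ; apply: (Ck_comp (Dk_bump1 0)).
by apply: CkZ; exact: Ck_dist2.
Qed.

Lemma mollifier_ge0 x0 r x : 0 <= r -> 0 <= mollifier x0 r x.
Proof.
move=> r0; rewrite mulr_ge0 ?invr_ge0 ?exprn_ge0// mulr_ge0 ?bump_ge0//; lra.
Qed.

Lemma bsupp_bump n x0 r : 0 < r ->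
  bsupp (fun x => bump n.+1 (r ^- 2 * dist2 x0 x)).
Proof.
move=> r0; apply: (@bsupp_radial _ (fun s => bump n.+1 (r ^- 2 * s)) (r ^+ 2)) => s rs.
apply: bump_out; rewrite -[X in X <= _](@mulVf _ (r ^+ 2)) ?expf_neq0 ?gt_eqF//.
by rewrite ler_pM2l ?invr_gt0 ?exprn_gt0.
Qed.

Lemma bsupp_mollifier x0 r : 0 < r -> bsupp (mollifier x0 r).
Proof.
by move=> r0; apply: bsupp_comp (bsupp_bump 1 x0 r0) => x x1; rewrite /mollifier x1 !mulr0.
Qed.

Lemma Cc_mollifier x0 r : 0 < r -> Cc (mollifier x0 r).
Proof.
by move=> r0; split; [exact: (Ck_continuous (Ck_mollifier x0 r))|exact: bsupp_mollifier].
Qed.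

(** The difference of two mollifiers is the divergence of a compactly supported field and has
    integral 0; this takes the place of a change of variables. *)
Lemma vint_mollifier_scale x0 d S : 0 < d -> d <= S ->
  vint (mollifier x0 d) = vint (mollifier x0 S).
Proof.
move=> d0 dS; have S0 : 0 < S by exact: lt_le_trans dS.
apply/eqP; rewrite -subr_eq0 -vintB; [|exact: Cc_mollifier..].
have := @vint_div R (fun=> 1) (radial_field (newt_diff d S) x0) (Ck_cst 1 1) _ _.
rewrite (eq_vint (g := fun x => mollifier x0 d x - mollifier x0 S x)); last first.
  by move=> x; rewrite mul1r div_newt_diff// gt_eqF.
move=> ->; last 2 first.
- by move=> i; apply: Ck_radial_field; exact: Dk_newt_diff.
- by move=> i; apply: (@bsupp_radial_field _ _ _ _ (S ^+ 2)) => s; exact: newt_diff_out.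
rewrite (eq_vint (g := fun=> 0)); first by rewrite /vint /Rintegral integral0 oppr0.
by move=> x; rewrite big1// => i _; rewrite partial_cst mul0r.
Qed.

Lemma vint_mollifier_gt0 x0 r : 0 < r -> 0 < vint (mollifier x0 r).
Proof.
move=> r0; apply: (@vint_gt0 _ _ x0); first exact: Cc_mollifier.
  by move=> x; apply: mollifier_ge0; exact: ltW.
rewrite /mollifier /dist2 big1; last by move=> i _; rewrite subrr expr0n.
rewrite mulr0 /bump subr0 /ramp max_l// expr1n mulr1.
by rewrite mulr_gt0 ?invr_gt0 ?exprn_gt0//; lra.
Qed.

End kernels.

(** * The Hardy inequality *)

Section hardy.
Context {R : realType}.
Local Notation e_ j := (delta_mx 0 j : 'rV[R]_3).
Implicit Types (f g : 'rV[R]_3 -> R) (s t : R).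

Definition nnint f : \bar R := (\int[leb3]_z (f (vec3 z))%:E)%E.

Lemma vint_nnint f : Cc f -> (vint f)%:E = nnint f.
Proof. exact: vint_EFin. Qed.

Definition grad2 f (x : 'rV[R]_3) : R := \sum_(j < 3) partial j f x ^+ 2.

(** At s = |x|^2 this is (1 + |x|^4)^(-1/2), a regular weight comparable to 1/(1 + |x|^2). *)
Definition hardy_profile s : R := (Num.sqrt (1 + s ^+ 2))^-1.

Definition hardy_weight (x : 'rV[R]_3) : R := hardy_profile (dist2 0 x).

Lemma one_sqr_gt0 s : 0 < 1 + s ^+ 2.
Proof. by rewrite ltr_wpDr// sqr_ge0. Qed.

Lemma is_derive_hardy_profile s : is_derive s 1 hardy_profile
  (- s * (Num.sqrt (1 + s ^+ 2)) ^- 3).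
Proof.
have d1 := is_derive_invsqrtX 1 (one_sqr_gt0 s).
have d2 : is_derive s 1 (fun s => 1 + s ^+ 2) (0 + 2%:R * s ^+ 1).
  exact: (is_deriveD (is_derive_cst (1 : R) s (1 : R)) (is_derive_expr 2 s)).
have d3 := @is_derive1_comp R (fun s => Num.sqrt s ^- 1) (fun s => 1 + s ^+ 2) s _ _ d1 d2.
by apply: (is_derive_eq d3); rewrite expr1; field;
  rewrite gt_eqF// sqrtr_gt0 one_sqr_gt0.
Qed.

Lemma Dk_hardy_profile : Dk 1 hardy_profile.
Proof.
apply: (Dk_is_derive is_derive_hardy_profile); split=> // s.
have d1 := is_deriveN (is_derive_id s (1 : R)).
have d2 : is_derive s 1 (fun s => 1 + s ^+ 2) (0 + 2%:R * s ^+ 1).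
  exact: (is_deriveD (is_derive_cst (1 : R) s (1 : R)) (is_derive_expr 2 s)).
have d3 := @is_derive1_comp R (fun s => Num.sqrt s ^- 3) (fun s => 1 + s ^+ 2) s _ _
  (is_derive_invsqrtX 3 (one_sqr_gt0 s)) d2.
apply: differentiable_continuous; apply/derivable1_diffP.
exact: (@ex_derive _ _ _ _ _ _ _ (is_deriveM d1 d3)).
Qed.

Lemma hardy_profile_gt0 s : 0 < hardy_profile s.
Proof. by rewrite invr_gt0 sqrtr_gt0 one_sqr_gt0. Qed.

Lemma Ck_hardy_weight : Ck 1 hardy_weight.
Proof. exact: (Ck_comp Dk_hardy_profile (Ck_dist2 1 0)). Qed.

(** The vector-field proof of Hardy's inequality rests on a field X with div X >= w and |X|^2 <= w.
    Here X = x w, with w the weight; [hardy_field_sqr] is the other half. *)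
Lemma hardy_div x : hardy_weight x <=
  \sum_(i < 3) partial i (radial_field hardy_profile 0 i) x.
Proof.
rewrite div_radial_field; last exact: Dk_hardy_profile.
rewrite derive1E (@derive_val _ _ _ _ _ _ _ (is_derive_hardy_profile _)).
rewrite /hardy_weight /hardy_profile; move: (dist2 0 x) => s.
have := sqr_sqrtr (ltW (one_sqr_gt0 s)).
have : 0 < Num.sqrt (1 + s ^+ 2) by rewrite sqrtr_gt0 one_sqr_gt0.
move: (Num.sqrt _) => q q0 q2.
rewrite -subr_ge0 (_ : _ - _ = (q ^+ 2 - s ^+ 2) * 2 * q ^- 3); last first.
  by field; rewrite gt_eqF.
by rewrite q2 addrK mulr_ge0// ?invr_ge0 ?exprn_ge0 ?ltW//; lra.
Qed.

Lemma hardy_field_sqr x :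
  \sum_(i < 3) radial_field hardy_profile 0 i x ^+ 2 <= hardy_weight x.
Proof.
rewrite (_ : \sum_(i < 3) _ = dist2 0 x * hardy_weight x ^+ 2); last first.
  by rewrite [in RHS]/dist2 mulr_suml; apply: eq_bigr => i _; rewrite exprMn.
have := dist2_ge0 0 x.
rewrite /hardy_weight /hardy_profile; move: (dist2 0 x) => s s0.
have q0 : 0 < Num.sqrt (1 + s ^+ 2) by rewrite sqrtr_gt0 one_sqr_gt0.
have sq : s <= Num.sqrt (1 + s ^+ 2).
  by rewrite -[leLHS]ger0_norm// -sqrtr_sqr ler_wsqrtr// lerDr.
rewrite expr2 mulrA -[leRHS]mul1r; apply: ler_wpM2r.
  by rewrite invr_ge0 ltW.
by rewrite ler_pdivrMr// mul1r.
Qed.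

(* Young: -2 rho (grad . X) <= rho^2 |X|^2 / 2 + 2 |grad|^2 *)
Lemma young3 (rho w : R) (g X : 'I_3 -> R) : \sum_(i < 3) X i ^+ 2 <= w ->
  - \sum_(i < 3) 2 * rho * g i * X i <=
  2^-1 * (rho ^+ 2 * w) + 2 * \sum_(i < 3) g i ^+ 2.
Proof.
move=> Xw; have := ler_wpM2l (sqr_ge0 rho) Xw; rewrite !sum3E => H.
have := sqr_ge0 (rho * X 0 + 2 * g 0); have := sqr_ge0 (rho * X 1 + 2 * g 1).
have := sqr_ge0 (rho * X 2%:R + 2 * g 2%:R); move: H.
move: (X 0) (X 1) (X 2%:R) (g 0) (g 1) (g 2%:R) => *; nra.
Qed.

Lemma is_derive_shift_rampX (e : R) t : is_derive t 1
  (fun t => ramp (t - e) ^+ 2) (2 * ramp (t - e)).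
Proof.
have H := @is_derive_affine R (fun t => ramp t ^+ 2) 1 (- e) t _ (is_derive_rampX 0 _).
have E : (fun s => ramp (- e + 1 * s) ^+ 2) = fun t => ramp (t - e) ^+ 2.
  by apply/funext => y; rewrite mul1r addrC.
rewrite E in H; apply: (is_derive_eq H).
by rewrite mul1r mulr1 expr1 (addrC (- e)).
Qed.

Lemma Dk_shift_ramp (e : R) : Dk 1 (fun t : R => ramp (t - e) ^+ 2).
Proof.
apply: (Dk_is_derive (is_derive_shift_rampX e)).
apply: Dk_scale; split=> // t.
apply: (@continuous_comp _ _ _ (fun t => t - e) ramp); last exact: continuous_ramp.
by apply: continuousB; [exact: cvg_id|exact: cst_continuous].
Qed.

Lemma cont_D f g : continuous f -> continuous g -> continuous (fun x => f x + g x).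
Proof. by move=> cf cg x; apply: continuousD; [exact: cf|exact: cg]. Qed.

Lemma cont_M f g : continuous f -> continuous g -> continuous (fun x => f x * g x).
Proof. by move=> cf cg x; apply: continuousM; [exact: cf|exact: cg]. Qed.

Lemma cont_Z f (k : R) : continuous f -> continuous (fun x => k * f x).
Proof. by apply: cont_M => x; exact: cst_continuous. Qed.

Lemma nnint_ge0 f : (forall x, 0 <= f x) -> (0 <= nnint f)%E.
Proof. by move=> f0; apply: integral_ge0 => z _; rewrite lee_fin. Qed.

Lemma measurable_vec3E f : continuous f ->
  measurable_fun [set: point R] (fun z => (f (vec3 z))%:E).
Proof. by move=> cf; apply/measurable_EFinP; exact: measurable_comp_vec3. Qed.

Lemma le_nnint f g : continuous f -> continuous g -> (forall x, 0 <= f x) ->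
  (forall x, f x <= g x) -> (nnint f <= nnint g)%E.
Proof.
move=> cf cg f0 fg; apply: ge0_le_integral => //.
- by move=> z _; rewrite lee_fin.
- exact: measurable_vec3E.
- exact: measurable_vec3E.
- by move=> z _; rewrite lee_fin.
Qed.

Lemma nnintD f g : continuous f -> continuous g -> (forall x, 0 <= f x) ->
  (forall x, 0 <= g x) -> nnint (fun x => f x + g x) = (nnint f + nnint g)%E.
Proof.
move=> cf cg f0 g0; rewrite /nnint; under eq_integral do rewrite EFinD.
rewrite ge0_integralD//.
- by move=> z _; rewrite lee_fin.
- exact: measurable_vec3E.
- by move=> z _; rewrite lee_fin.
- exact: measurable_vec3E.
Qed.

Lemma nnintZ f (k : R) : continuous f -> (forall x, 0 <= f x) -> 0 <= k ->
  nnint (fun x => k * f x) = (k%:E * nnint f)%E.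
Proof.
move=> cf f0 k0; rewrite /nnint; under eq_integral do rewrite EFinM.
rewrite ge0_integralZl_EFin//.
- by move=> z _; rewrite lee_fin.
- exact: measurable_vec3E.
Qed.

(** With rho = (f - e)_+, integrating rho^2 div X by parts and applying Young's inequality bounds
    the left-hand side by half of itself plus 2 int |grad f|^2. The square makes rho^2 of class
    C^1. *)
Lemma hardy_truncated f (e : R) : Ck 1 f -> bsupp (fun x => ramp (f x - e)) ->
  (nnint (fun x => ramp (f x - e) ^+ 2 * hardy_weight x)%R
   <= 4%:E * nnint (grad2 f))%E.
Proof.
move=> Cf sf; pose rho x := ramp (f x - e).
have crho : continuous rho.
  move=> x; apply: (@continuous_comp _ _ _ (fun x => f x - e) ramp).
    by apply: continuousB; [exact: (Ck_continuous Cf)|exact: cst_continuous].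
  exact: continuous_ramp.
pose phi x := rho x ^+ 2; have Cphi : Ck 1 phi by exact: (Ck_comp (Dk_shift_ramp e) Cf).
have sphi : bsupp phi by apply: bsupp_comp sf => x; rewrite /phi /rho => ->; rewrite expr0n.
pose X := radial_field hardy_profile (0 : 'rV[R]_3).
have CX i : Ck 1 (X i) by exact: Ck_radial_field Dk_hardy_profile _ _.
have pphi j : partial j phi = fun x => 2 * rho x * partial j f x.
  rewrite (@partial_comp _ _ f (fun t => ramp (t - e) ^+ 2)).
  - apply/funext => x; congr (_ * _); rewrite derive1E.
    exact: (@derive_val _ _ _ _ _ _ _ (is_derive_shift_rampX e (f x))).
  - by move=> x; exact: Ck_derivable Cf.
  - by move=> t; exact: (@ex_derive _ _ _ _ _ _ _ (is_derive_shift_rampX e t)).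
have Cpsi : Cc (fun x => \sum_(i < 3) 2 * rho x * partial i f x * X i x).
  apply: Cc_sum => i; apply: CcMr; first exact: (Ck_continuous (CX i)).
  rewrite -pphi; split; first exact: (Ck_continuous (Ck_partial i Cphi)).
  exact: bsupp_partial.
have cw := Ck_continuous Ck_hardy_weight.
have w0 x : 0 <= hardy_weight x by exact: ltW (hardy_profile_gt0 _).
have Cw : Cc (fun x => phi x * hardy_weight x).
  by apply: CcMr => //; split => //; exact: (Ck_continuous Cphi).
have cg : continuous (grad2 f).
  have := @Ck_sum R 0 (fun j x => partial j f x * partial j f x).
  rewrite (_ : (fun x => _) = grad2 f).
    by move=> H; apply: (@Ck_continuous _ 0); apply: H => i; apply: CkM; exact: Ck_partial.
  by apply/funext => x; apply: eq_bigr => i _; rewrite expr2.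
have g0 x : 0 <= grad2 f x by apply: sumr_ge0 => j _; exact: sqr_ge0.
have IBP : vint (fun x => \sum_(i < 3) partial i (X i) x * phi x) =
    - vint (fun x => \sum_(i < 3) 2 * rho x * partial i f x * X i x).
  have CXp i : Cc (fun x => partial i (X i) x * phi x).
    by apply: CcMl; [exact: (Ck_continuous (Ck_partial i (CX i)))|
      split => //; exact: (Ck_continuous Cphi)].
  have CX2 i : Cc (fun x => 2 * rho x * partial i f x * X i x).
    apply: CcMr; first exact: (Ck_continuous (CX i)).
    rewrite -pphi; split; first exact: (Ck_continuous (Ck_partial i Cphi)).
    exact: bsupp_partial.
  rewrite (vint_sum CXp) (vint_sum CX2) -sumrN; apply: eq_bigr => i _.
  rewrite vint_IBP'//; congr (- _); apply: eq_vint => x.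
  by rewrite pphi mulrC.
have Cdiv : Cc (fun x => \sum_(i < 3) partial i (X i) x * phi x).
  by apply: Cc_sum => i; apply: CcMl; [exact: (Ck_continuous (Ck_partial i (CX i)))|
      split => //; exact: (Ck_continuous Cphi)].
have le1 : vint (fun x => phi x * hardy_weight x) <=
    vint (fun x => - \sum_(i < 3) 2 * rho x * partial i f x * X i x).
  rewrite vintN// -IBP; apply: le_vint => // x.
  rewrite -mulr_suml mulrC; apply: ler_wpM2r; last exact: hardy_div.
  exact: sqr_ge0.
have nn x : 0 <= phi x * hardy_weight x by rewrite mulr_ge0// sqr_ge0.
pose psi x := - \sum_(i < 3) 2 * rho x * partial i f x * X i x.
(* The comparison passes through the positive part of [psi], since [le_nnint] concerns nonnegative
   functions and the integral of [grad2 f] may be infinite. *)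
have Crpsi : Cc (fun x => ramp (psi x)).
  have [cpsi spsi] := CcN Cpsi; split.
    by move=> x; apply: (@continuous_comp _ _ _ psi ramp); [exact: cpsi|exact: continuous_ramp].
  by apply: bsupp_comp spsi => x; rewrite /psi /ramp => ->; rewrite maxxx.
have le2 : (nnint (fun x => phi x * hardy_weight x)%R <=
    (2^-1)%:E * nnint (fun x => phi x * hardy_weight x)%R + 2%:E * nnint (grad2 f))%E.
  rewrite -nnintZ//; last exact: (Cw.1).
  rewrite -nnintZ//.
  rewrite -nnintD; last 4 first.
  - exact: cont_Z Cw.1.
  - exact: cont_Z cg.
  - by move=> x; rewrite mulr_ge0.
  - by move=> x; rewrite mulr_ge0.
  rewrite -(vint_nnint Cw).
  apply: (@le_trans _ _ (vint (fun x => ramp (psi x)))%:E).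
    rewrite lee_fin; apply: (le_trans le1); apply: le_vint => //.
      exact: CcN.
    by move=> x; rewrite /ramp le_max lexx.
  rewrite (vint_nnint Crpsi); apply: le_nnint.
  - exact: Crpsi.1.
  - by apply: cont_D; apply: cont_Z; [exact: Cw.1|exact: cg].
  - by move=> x; exact: ramp_ge0.
  - move=> x; rewrite /ramp ge_max young3 ?hardy_field_sqr//=.
    by rewrite addr_ge0// mulr_ge0.
(* The left-hand side is finite, having a compactly supported integrand, so the half of it on the
   right can be absorbed. *)
move: le2; rewrite -(vint_nnint Cw).
have := nnint_ge0 g0; case: (nnint (grad2 f)) => [G| |] //=.
  by rewrite lee_fin -!EFinM -EFinD !lee_fin => ? ?; lra.
by move=> _ _; rewrite mulry gtr0_sg// mul1e leey.
Qed.

End hardy.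

Section hardy_inequality.
Context {R : realType}.
Implicit Types (f g : 'rV[R]_3 -> R) (s t : R).

Definition vanishing f := forall e : R, 0 < e ->
  exists M : R, forall (x : 'rV[R]_3) i, M < `|x 0 i| -> `|f x| < e.

Lemma ramp_le s t : s <= t -> ramp s <= ramp t.
Proof. by move=> st; rewrite /ramp ge_max !le_max st lexx orbT. Qed.

Lemma sqr_rampE t : ramp t ^+ 2 + ramp (- t) ^+ 2 = t ^+ 2.
Proof.
rewrite /ramp; have [t0|] := boolP (0 <= t).
  by rewrite max_l// max_r ?oppr_le0// expr0n addr0.
rewrite -ltNge => /ltW t0.
by rewrite max_r// max_l ?oppr_ge0// expr0n add0r sqrrN.
Qed.

Lemma bsupp_vanishing f (e : R) : 0 < e -> vanishing f ->
  bsupp (fun x => ramp (f x - e)).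
Proof.
move=> e0 /(_ e e0)[M fM]; exists M => x i /fM; rewrite ltr_norml => /andP[_ fe].
by rewrite /ramp max_r// subr_le0 ltW.
Qed.

Lemma grad2N f : Ck 1 f -> grad2 (fun x => - f x) = grad2 f.
Proof.
move=> Cf; apply/funext => x; apply: eq_bigr => j _.
by rewrite /partial deriveN ?sqrrN//; exact: Ck_derivable Cf.
Qed.

Lemma grad2_ge0 f x : 0 <= grad2 f x.
Proof. by apply: sumr_ge0 => j _; exact: sqr_ge0. Qed.

Lemma hardy_weight_gt0 (x : 'rV[R]_3) : 0 < hardy_weight x.
Proof. exact: hardy_profile_gt0. Qed.

(** The truncations of f and -f at height 1/(n+1) have bounded support and increase to the positive
    and negative parts of f. Each sign is charged the full gradient, whence 8 = 4 + 4. *)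
Lemma hardy f : Ck 1 f -> vanishing f ->
  (nnint (fun x => f x ^+ 2 * hardy_weight x)%R <= 8%:E * nnint (grad2 f))%E.
Proof.
move=> Cf vf; have Cnf := CkN Cf.
have cf := Ck_continuous Cf; have cnf := Ck_continuous Cnf.
have vnf : vanishing (fun x => - f x).
  by move=> e /vf[M fM]; exists M => x i /fM; rewrite normrN.
pose e (n : nat) : R := n.+1%:R^-1.
have e0 n : 0 < e n by rewrite invr_gt0.
pose h n x := (ramp (f x - e n) ^+ 2 + ramp (- f x - e n) ^+ 2) * hardy_weight x.
have cr g n : continuous g -> continuous (fun x => ramp (g x - e n) ^+ 2).
  move=> cg x; apply: (@continuous_comp _ _ _ g (fun t => ramp (t - e n) ^+ 2)).
    exact: cg.
  exact: (Dk_continuous (Dk_shift_ramp (e n))).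
have cw := Ck_continuous (@Ck_hardy_weight R).
have ch n : continuous (h n) by apply: cont_M => //; apply: cont_D; exact: cr.
have h0 n x : 0 <= h n x.
  by rewrite mulr_ge0 ?addr_ge0 ?sqr_ge0// ltW// hardy_weight_gt0.
have hle n : (nnint (h n) <= 8%:E * nnint (grad2 f))%E.
  have -> : nnint (h n) =
      (nnint (fun x => ramp (f x - e n) ^+ 2 * hardy_weight x)%R +
       nnint (fun x => ramp (- f x - e n) ^+ 2 * hardy_weight x)%R)%E.
    rewrite -nnintD; last 4 first.
    - by apply: cont_M => //; exact: cr.
    - by apply: cont_M => //; exact: cr.
    - by move=> x; rewrite mulr_ge0 ?sqr_ge0// ltW// hardy_weight_gt0.
    - by move=> x; rewrite mulr_ge0 ?sqr_ge0// ltW// hardy_weight_gt0.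
    by congr nnint; apply/funext => x; rewrite /h mulrDl.
  apply: (@le_trans _ _ (4%:E * nnint (grad2 f) + 4%:E * nnint (grad2 f))%E).
    apply: leeD; first by apply: hardy_truncated => //; exact: bsupp_vanishing.
    by rewrite -(grad2N Cf); apply: hardy_truncated => //; exact: bsupp_vanishing.
  rewrite -ge0_muleDl ?lee_fin// -EFinD.
  by apply: lee_wpmul2r; [exact/nnint_ge0/grad2_ge0|rewrite lee_fin; lra].
have lim_h (z : point R) : (h n (vec3 z))%:E @[n --> \oo] -->
    (f (vec3 z) ^+ 2 * hardy_weight (vec3 z))%:E.
  apply: cvg_EFin; first by near=> n.
  rewrite -sqr_rampE.
  have cvr t : ramp (t - e n) ^+ 2 @[n --> \oo] --> ramp t ^+ 2.
    have lt : t - e n @[n --> \oo] --> t.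
      rewrite -[X in _ --> X]subr0; apply: cvgB; first exact: cvg_cst.
      exact: cvg_harmonic.
    have cr2 : continuous (fun t : R => ramp t ^+ 2).
      have := Dk_continuous (Dk_shift_ramp (0 : R)).
      by rewrite (_ : (fun t => ramp (t - 0) ^+ 2) = fun t => ramp t ^+ 2)//;
        apply/funext => y; rewrite subr0.
    exact: (@continuous_cvg _ _ _ _ _ (fun n => t - e n) _ t (@cr2 t) lt).
  by apply: cvgM; [apply: cvgD; exact: cvr|exact: cvg_cst].
have -> : nnint (fun x => f x ^+ 2 * hardy_weight x) =
    (\int[leb3]_z limn (fun n => (h n (vec3 z))%:E))%E.
  by apply: eq_integral => z _; apply/esym/cvg_lim.
have ndh (z : point R) : nondecreasing_seq (fun n => (h n (vec3 z))%:E).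
  move=> m n mn; rewrite lee_fin; apply: ler_wpM2r.
    exact/ltW/hardy_weight_gt0.
  have enm : e n <= e m by rewrite lef_pV2 ?posrE// ler_nat.
  by apply: lerD; rewrite lerXn2r ?nnegrE ?ramp_ge0//; apply: ramp_le; lra.
rewrite monotone_convergence; [|by []|by move=> n; exact: measurable_vec3E|
  by move=> n z _; rewrite lee_fin|by move=> z _; exact: ndh].
apply: lime_le; last by near=> n; exact: hle.
apply: ereal_nondecreasing_is_cvgn => m n mn.
apply: ge0_le_integral => //.
- by move=> z _; rewrite lee_fin.
- exact: measurable_vec3E.
- exact: measurable_vec3E.
- by move=> z _; exact: ndh.
Unshelve. all: by end_near. Qed.

End hardy_inequality.

(** * Means of the head pressure *)

Section pressure_bounds.
Context {R : realType}.
Implicit Types (x : 'rV[R]_3) (v : 'I_3 -> 'rV[R]_3 -> R).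

Definition speed2 v x : R := \sum_(i < 3) v i x ^+ 2.

Definition gradsq v x : R := \sum_(i < 3) grad2 (v i) x.

Definition vort_cross_norm v x : R := Num.sqrt (\sum_(i < 3) vort_cross v i x ^+ 2).

(** The integrable majorant of the argument: by AM-GM it dominates 2 |v| |grad v| w^(1/2), w being
    the Hardy weight. *)
Definition hardy_energy v x : R := speed2 v x * hardy_weight x + gradsq v x.

Lemma cauchy_schwarz3 (a b : 'I_3 -> R) :
  (\sum_(i < 3) a i * b i) ^+ 2 <=
  (\sum_(i < 3) a i ^+ 2) * \sum_(i < 3) b i ^+ 2.
Proof.
rewrite !sum3E -subr_ge0.
rewrite (_ : _ - _ = (a 0 * b 1 - a 1 * b 0) ^+ 2 +
  (a 0 * b 2%:R - a 2%:R * b 0) ^+ 2 + (a 1 * b 2%:R - a 2%:R * b 1) ^+ 2); last by ring.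
by rewrite !addr_ge0// sqr_ge0.
Qed.

Lemma sumr_sqr_ge0 (a : 'I_3 -> R) : 0 <= \sum_(i < 3) a i ^+ 2.
Proof. by apply: sumr_ge0 => i _; exact: sqr_ge0. Qed.

Lemma gradsq_ge0 v x : 0 <= gradsq v x.
Proof. by apply: sumr_ge0 => i _; exact: grad2_ge0. Qed.

Lemma speed2_ge0 v x : 0 <= speed2 v x.
Proof. exact: sumr_sqr_ge0. Qed.

Lemma sqr_sub_le (a b : R) : (a - b) ^+ 2 <= 2 * (a ^+ 2 + b ^+ 2).
Proof. by have := sqr_ge0 (a + b); nra. Qed.

Lemma sum_sym3 (P : 'I_3 -> 'I_3 -> R) :
  \sum_(i < 3) \sum_(j < 3) 2 * (P j i + P i j) =
  4 * \sum_(i < 3) \sum_(j < 3) P j i.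
Proof. by rewrite !sum3E; ring. Qed.

(** Cauchy-Schwarz in each component. One factor 2 comes from (a - b)^2 <= 2 (a^2 + b^2), the other
    from every entry of grad v occurring twice. *)
Lemma vort_cross_norm_sqr v x :
  vort_cross_norm v x ^+ 2 <= 4 * (speed2 v x * gradsq v x).
Proof.
rewrite sqr_sqrtr ?sumr_sqr_ge0//.
pose c i j := partial j (v i) x - partial i (v j) x.
apply: (@le_trans _ _ (\sum_(i < 3) speed2 v x * \sum_(j < 3) c i j ^+ 2)).
  by apply: ler_sum => i _; exact: cauchy_schwarz3.
rewrite -mulr_sumr mulrCA; apply: ler_wpM2l; first exact: speed2_ge0.
apply: (@le_trans _ _ (\sum_(i < 3) \sum_(j < 3)
    2 * (partial j (v i) x ^+ 2 + partial i (v j) x ^+ 2))).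
  by apply: ler_sum => i _; apply: ler_sum => j _; exact: sqr_sub_le.
by rewrite (sum_sym3 (fun i j => partial i (v j) x ^+ 2)).
Qed.

Lemma vort_cross_norm_ge0 v x : 0 <= vort_cross_norm v x.
Proof. exact: sqrtr_ge0. Qed.

Lemma hardy_energy_ge0 v x : 0 <= hardy_energy v x.
Proof.
by rewrite addr_ge0 ?gradsq_ge0// mulr_ge0 ?speed2_ge0// ltW// hardy_weight_gt0.
Qed.

Lemma hardy_energy_AMGM v x :
  4 * (speed2 v x * gradsq v x * hardy_weight x) <= hardy_energy v x ^+ 2.
Proof.
rewrite /hardy_energy; have := sqr_ge0 (speed2 v x * hardy_weight x - gradsq v x).
by move: (speed2 _ _) (gradsq _ _) (hardy_weight _) => a b c; nra.
Qed.

Lemma abs_le_of_sqr (a b : R) : 0 <= b -> a ^+ 2 <= b ^+ 2 -> `|a| <= b.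
Proof.
move=> b0 ab; rewrite -(ger0_norm b0) -ler_sqr ?nnegrE//.
by rewrite -!normrX !ger0_norm ?sqr_ge0.
Qed.

(** The integrand that [vint_head_div] produces from the field of [newt_diff]; its integral is a
    difference of two means of Q, see [mean_diff]. *)
Definition newt_flux v d S (x0 : 'rV[R]_3) x : R :=
  \sum_(i < 3) vort_cross v i x * radial_field (newt_diff d S) x0 i x.

Lemma newt_flux_le v d S x0 x (c : R) : `|newt_diff d S (dist2 x0 x)| <= c ->
  `|newt_flux v d S x0 x| <= vort_cross_norm v x * (Num.sqrt (dist2 x0 x) * c).
Proof.
move=> ac.
have -> : newt_flux v d S x0 x =
   (\sum_(i < 3) vort_cross v i x * (x 0 i - x0 0 i)) * newt_diff d S (dist2 x0 x).
  by rewrite mulr_suml; apply: eq_bigr => i _; rewrite mulrA.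
rewrite normrM mulrA; apply: ler_pM => //.
rewrite -sqrtrM ?sumr_sqr_ge0// -sqrtr_sqr.
by apply: ler_wsqrtr; exact: cauchy_schwarz3.
Qed.

Lemma newt_scaled_ge0 r s : 0 <= r -> 0 <= @newt_scaled R r s.
Proof. by move=> r0; rewrite mulr_ge0 ?newt_ge0// invr_ge0 exprn_ge0. Qed.

Lemma newt_scaled_le r s : 0 < r -> 0 < s -> newt_scaled r s <= (Num.sqrt s : R) ^- 3.
Proof.
move=> r0 s0; have rs0 : 0 < r ^- 2 * s by rewrite mulr_gt0// invr_gt0 exprn_gt0.
apply: (@le_trans _ _ (r ^- 3 * (Num.sqrt (r ^- 2 * s)) ^- 3)).
  by apply: ler_wpM2l; [rewrite invr_ge0 exprn_ge0// ltW|exact: newt_le].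
have -> : Num.sqrt (r ^- 2 * s) = Num.sqrt s / r.
  by rewrite sqrtrM ?invr_ge0 ?exprn_ge0 ?ltW// -exprVn sqrtr_sqr gtr0_norm
    ?invr_gt0// mulrC.
have : 0 < Num.sqrt s by rewrite sqrtr_gt0.
move: (Num.sqrt s) => q q0; rewrite le_eqVlt; apply/orP; left; apply/eqP.
by field; rewrite !gt_eqF.
Qed.

Lemma newt_flux_le_inv v d S x0 x : 0 < d -> 0 < S ->
  `|newt_flux v d S x0 x| <= vort_cross_norm v x / dist2 x0 x.
Proof.
move=> d0 S0; have := dist2_ge0 x0 x; rewrite le_eqVlt => /predU1P[s0|s0].
  (* At x = x0 the flux vanishes, in agreement with the convention that division by 0 gives 0. *)
  rewrite /newt_flux big1 ?normr0; last first.
    move=> i _; rewrite /radial_field (_ : x 0 i - x0 0 i = 0) ?mul0r ?mulr0//.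
    apply/eqP; rewrite -sqrf_eq0 eq_le sqr_ge0 andbT.
    by rewrite [leRHS]s0 coord_dist2.
  by rewrite -s0 invr0 mulr0.
have ac : `|newt_diff d S (dist2 x0 x)| <= (Num.sqrt (dist2 x0 x)) ^- 3.
  have := newt_scaled_le d0 s0; have := newt_scaled_le S0 s0.
  have := newt_scaled_ge0 (dist2 x0 x) (ltW d0).
  have := newt_scaled_ge0 (dist2 x0 x) (ltW S0).
  rewrite /newt_diff ler_norml; move: (newt_scaled d _) (newt_scaled S _) => *.
  by apply/andP; split; lra.
apply: (le_trans (newt_flux_le v ac)); rewrite le_eqVlt; apply/orP; left; apply/eqP.
congr (_ * _); have : 0 < Num.sqrt (dist2 x0 x) by rewrite sqrtr_gt0.
have := sqr_sqrtr (ltW s0); move: (Num.sqrt _) => q q2 q0.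
by rewrite -q2; field; rewrite gt_eqF.
Qed.

(* The factor [r] makes this weight bounded by a multiple of (1 + |x|^4)^(-1/4)
   uniformly in the scale, while it tends to 0 pointwise. *)
Definition newt_weight r x : R :=
  r * (Num.sqrt (dist2 0 x) * newt_scaled r (dist2 0 x)).

Lemma newt_weight_ge0 r x : 0 <= r -> 0 <= newt_weight r x.
Proof. by move=> r0; rewrite mulr_ge0// mulr_ge0 ?sqrtr_ge0// newt_scaled_ge0. Qed.

(** For s <= 1 the product is at most 2 (35/8)^2 < 40; for s > 1 the bound s^(-3/2) on [newt] leaves
    at most 2. *)
Lemma newt_sqr_bound (s : R) : 0 <= s -> s * newt s ^+ 2 * (1 + s) <= 40.
Proof.
move=> s0; have n0 := newt_ge0 s; have [s1|s1] := leP s 1.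
  have n1 := newt_le_cst s0.
  have n2 : newt s ^+ 2 <= (35 / 8) ^+ 2 by rewrite lerXn2r ?nnegrE//; lra.
  have n20 := sqr_ge0 (newt s); move: (newt s ^+ 2) n2 n20 => a a1 a0.
  have sa : s * a <= a by rewrite ler_piMl.
  have sa0 : 0 <= s * a by rewrite mulr_ge0.
  have : s * a * (1 + s) <= s * a * 2 by apply: ler_wpM2l => //; lra.
  lra.
have s00 : 0 < s by lra.
have n1 := newt_le s00.
have q1 : 1 <= Num.sqrt s by rewrite -sqrtr1 ler_wsqrtr// ltW.
have := sqr_sqrtr s0; move: (Num.sqrt s) q1 n1 => q q1 n1 q2.
have q0 : 0 < q by lra.
have n2 : newt s ^+ 2 <= q ^- 6.
  rewrite (_ : q ^- 6 = (q ^- 3) ^+ 2); last by field; rewrite gt_eqF.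
  by rewrite lerXn2r ?nnegrE// invr_ge0 exprn_ge0// ltW.
apply: (@le_trans _ _ (s * q ^- 6 * (1 + s))).
  by apply: ler_wpM2r; [lra|apply: ler_wpM2l].
rewrite -q2 (_ : _ * _ = q ^- 4 + q ^- 2); last by field; rewrite gt_eqF.
have i4 : q ^- 4 <= 1 by rewrite invf_le1 ?exprn_gt0// exprn_ege1.
have i2 : q ^- 2 <= 1 by rewrite invf_le1 ?exprn_gt0// exprn_ege1.
lra.
Qed.

(** By scaling this is [newt_sqr_bound] at |x|^2/r^2, combined with (1 + |x|^4)^(1/2) <= r^2 + |x|^2
    for r >= 1. *)
Lemma newt_weight_sqr r x : 1 <= r -> newt_weight r x ^+ 2 <= 40 * hardy_weight x.
Proof.
move=> r1; have r0 : 0 < r by lra.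
rewrite /newt_weight /hardy_weight /hardy_profile /newt_scaled.
have := dist2_ge0 0 x; move: (dist2 0 x) => s s0.
pose sg := r ^- 2 * s; have sg0 : 0 <= sg by rewrite mulr_ge0// invr_ge0 sqr_ge0.
have sE : s = r ^+ 2 * sg by rewrite /sg mulVKf// expf_neq0// gt_eqF.
have H := newt_sqr_bound sg0.
rewrite !exprMn sqr_sqrtr// -/sg.
have q0 : 0 < Num.sqrt (1 + s ^+ 2) by rewrite sqrtr_gt0 one_sqr_gt0.
rewrite ler_pdivlMr//.
have qle : Num.sqrt (1 + s ^+ 2) <= r ^+ 2 * (1 + sg).
  have r2 : 1 <= r ^+ 2 by rewrite exprn_ege1.
  have rs : 0 <= r ^+ 2 * (1 + sg) by rewrite mulr_ge0 ?sqr_ge0//; lra.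
  rewrite -[leRHS]ger0_norm// -sqrtr_sqr ler_wsqrtr//.
  have : 1 + s <= r ^+ 2 * (1 + sg) by rewrite sE mulrDr mulr1 lerD2r.
  by nra.
apply: le_trans H.
apply: (@le_trans _ _ (r ^+ 2 * (s * (r ^- 3 ^+ 2 * newt sg ^+ 2)) * (r ^+ 2 * (1 + sg)))).
  apply: ler_wpM2l => //; apply: mulr_ge0; first exact: sqr_ge0.
  by apply: mulr_ge0 => //; apply: mulr_ge0; exact: sqr_ge0.
rewrite sE le_eqVlt; apply/orP; left; apply/eqP.
by move: (newt sg) => w; field; rewrite gt_eqF.
Qed.

Lemma newt_weight_le_inv r x : 0 < r ->
  newt_weight r x <= 35 / 8 * Num.sqrt (dist2 0 x) * r ^- 2.
Proof.
move=> r0; rewrite /newt_weight /newt_scaled.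
have sg0 : 0 <= r ^- 2 * dist2 0 x by rewrite mulr_ge0 ?dist2_ge0// invr_ge0 sqr_ge0.
have := newt_le_cst sg0; have := sqrtr_ge0 (dist2 0 x).
move: (Num.sqrt _) (newt _) => q w q0 w1.
rewrite (_ : r * _ = q * r ^- 2 * w); last by field; rewrite gt_eqF.
rewrite [leRHS](_ : _ = q * r ^- 2 * (35 / 8)); last by ring.
by apply: ler_wpM2l => //; rewrite mulr_ge0// invr_ge0 sqr_ge0.
Qed.

(** Squaring, the constants 4 and 40 with [hardy_energy_AMGM] give 40 times the squared energy, and
    40 <= 7^2. The bound is uniform in the scale, as dominated convergence requires. *)
Lemma vort_weight_le v r x : 1 <= r ->
  vort_cross_norm v x * newt_weight r x <= 7 * hardy_energy v x.
Proof.
move=> r1; apply: le_trans (ler_norm _) _; apply: abs_le_of_sqr.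
  by rewrite mulr_ge0// hardy_energy_ge0.
rewrite exprMn.
have H1 := vort_cross_norm_sqr v x; have H2 := newt_weight_sqr x r1.
have H3 := hardy_energy_AMGM v x.
apply: (@le_trans _ _ (4 * (speed2 v x * gradsq v x) * (40 * hardy_weight x))).
  by apply: ler_pM => //; exact: sqr_ge0.
rewrite exprMn; have := sqr_ge0 (hardy_energy v x).
by move: H3; move: (hardy_energy _ _ ^+ 2) (speed2 v x * _) (hardy_weight x) => *; nra.
Qed.

End pressure_bounds.

(** * Convergence of the means around the origin, with a rate *)

Section head_pressure_limit.
Context {R : realType}.
Implicit Types (x : 'rV[R]_3).

Variable v : 'I_3 -> 'rV[R]_3 -> R.
Variable Q : 'rV[R]_3 -> R.
Hypothesis Cv : forall i k, Ck k (v i).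
Hypothesis dv0 : solenoidal v.
Hypothesis CQ : forall k, Ck k Q.
Hypothesis vQ : head_eqn v Q.
Hypothesis hH : (nnint (hardy_energy v) < +oo)%E.

Lemma cont_sqrt (f : 'rV[R]_3 -> R) : continuous f -> continuous (fun x => Num.sqrt (f x)).
Proof.
by move=> cf x; apply: (@continuous_comp _ _ _ f Num.sqrt); [exact: cf|exact: sqrt_continuous].
Qed.

Lemma cont_sum3 (F : 'I_3 -> 'rV[R]_3 -> R) :
  (forall i, continuous (F i)) -> continuous (fun x => \sum_(i < 3) F i x).
Proof.
by move=> cF; apply: (@Ck_continuous _ 0); apply: Ck_sum => i; split.
Qed.

Lemma cont_sqr (f : 'rV[R]_3 -> R) : continuous f -> continuous (fun x => f x ^+ 2).
Proof.
move=> cf; rewrite (_ : (fun x => _) = fun x => f x * f x); first exact: cont_M.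
by apply/funext => x; rewrite expr2.
Qed.

Lemma cont_vort_cross_norm : continuous (vort_cross_norm v).
Proof.
apply: cont_sqrt; apply: cont_sum3 => i; apply: cont_sqr.
exact: (Ck_continuous (Ck_vort_cross Cv i 0)).
Qed.

Lemma cont_gradsq : continuous (gradsq v).
Proof.
apply: cont_sum3 => i; apply: cont_sum3 => j; apply: cont_sqr.
exact: (Ck_continuous (Ck_partial j (Cv i 1))).
Qed.

Lemma cont_speed2 : continuous (speed2 v).
Proof. by apply: cont_sum3 => i; apply: cont_sqr; exact: (Ck_continuous (Cv i 0)). Qed.

Lemma cont_hardy_energy : continuous (hardy_energy v).
Proof.
apply: cont_D; last exact: cont_gradsq.
by apply: cont_M; [exact: cont_speed2|exact: (Ck_continuous (@Ck_hardy_weight R))].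
Qed.

Lemma cont_newt_weight r : continuous (@newt_weight R r).
Proof.
apply: cont_Z; apply: cont_M.
  by apply: cont_sqrt; exact: (Ck_continuous (Ck_dist2 0 0)).
exact: (Ck_continuous (Ck_comp (Dk_newt_scaled r) (Ck_dist2 1 0))).
Qed.

Definition flux_weight (n : nat) : 'rV[R]_3 -> R :=
  fun x => vort_cross_norm v x * newt_weight n.+1%:R x.

Lemma cont_flux_weight n : continuous (flux_weight n).
Proof. by apply: cont_M; [exact: cont_vort_cross_norm|exact: cont_newt_weight]. Qed.

Lemma flux_weight_ge0 n x : 0 <= flux_weight n x.
Proof. by rewrite mulr_ge0 ?vort_cross_norm_ge0// newt_weight_ge0. Qed.

(** The modulus in the rate: the mean at scale n+1 will differ from its limit by at most
    [flux_tail n] divided by n+1. *)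
Definition flux_tail (n : nat) : R := fine (nnint (flux_weight n)).

Lemma natS_ge1 n : 1 <= n.+1%:R :> R.
Proof. by rewrite ler1n. Qed.

Lemma flux_weight_le n x : flux_weight n x <= 7 * hardy_energy v x.
Proof. by apply: vort_weight_le; exact: natS_ge1. Qed.

Lemma flux_tailE n : (flux_tail n)%:E = nnint (flux_weight n).
Proof.
rewrite fineK// ge0_fin_numE; last by apply: nnint_ge0 => x; exact: flux_weight_ge0.
apply: (@le_lt_trans _ _ (7%:E * nnint (hardy_energy v))%E).
  rewrite -nnintZ//; [|exact: cont_hardy_energy|exact: hardy_energy_ge0].
  apply: le_nnint; [exact: cont_flux_weight|by apply: cont_Z; exact: cont_hardy_energy|
    exact: flux_weight_ge0|exact: flux_weight_le].
by rewrite lte_mul_pinfty// lee_fin.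
Qed.

Lemma flux_weight_cvg0 x : flux_weight n x @[n --> \oo] --> 0.
Proof.
rewrite -(mulr0 (vort_cross_norm v x)); apply: cvgM; first exact: cvg_cst.
pose c : R := 35 / 8 * Num.sqrt (dist2 0 x).
have c0 : 0 <= c by rewrite mulr_ge0 ?sqrtr_ge0//.
apply: (@squeeze_cvgr _ _ _ _ (fun=> 0) (fun n => c * n.+1%:R^-1)).
- near=> n; rewrite newt_weight_ge0//=.
  apply: (le_trans (newt_weight_le_inv _ _)) => //.
  apply: ler_wpM2l => //.
  by rewrite lef_pV2 ?posrE ?exprn_gt0// expr2 ler_peMr// ler1n.
- exact: cvg_cst.
- rewrite -[X in _ --> X](mulr0 c); apply: cvgM; first exact: cvg_cst.
  exact: cvg_harmonic.
Unshelve. all: by end_near. Qed.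

Lemma integrable_nn (f : 'rV[R]_3 -> R) : continuous f -> (forall x, 0 <= f x) ->
  (nnint f < +oo)%E ->
  leb3.-integrable [set: point R] (fun z => (f (vec3 z))%:E).
Proof.
move=> cf f0 foo; apply/integrableP; split; first exact: measurable_vec3E.
rewrite (_ : (fun z : point R => `|(f (vec3 z))%:E|%E) = fun z => (f (vec3 z))%:E)//.
by apply/funext => z; rewrite /= ger0_norm.
Qed.

(** Dominated convergence: at a fixed point the weight is O(r^-2), and 7 times the Hardy energy
    dominates at all scales. This is the little o of the rate. *)
Lemma flux_tail_cvg0 : flux_tail n @[n --> \oo] --> 0.
Proof.
have g7 : leb3.-integrable [set: point R] (fun z => (7 * hardy_energy v (vec3 z))%:E).
  apply: (@integrable_nn (fun x => 7 * hardy_energy v x)).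
  - by apply: cont_Z; exact: cont_hardy_energy.
  - by move=> x; rewrite mulr_ge0// hardy_energy_ge0.
  - rewrite nnintZ//; [by rewrite lte_mul_pinfty// lee_fin|exact: cont_hardy_energy|
      exact: hardy_energy_ge0].
have [] := @dominated_convergence _ _ _ leb3 [set: point R] measurableT
  (fun n z => (flux_weight n (vec3 z))%:E) (fun=> 0%:E) _ _ _ _ g7 _.
- by move=> n; apply: measurable_vec3E; exact: cont_flux_weight.
- exact: measurable_cst.
- by apply: aeW => z _; apply: cvg_EFin; [by near=> n|exact: (flux_weight_cvg0 (vec3 z))].
- apply: aeW => z n _; rewrite /= lee_fin ger0_norm ?flux_weight_ge0//.
  exact: flux_weight_le.
move=> _ _; rewrite integral0 => H.
exact: (fine_cvg H).
Unshelve. all: by end_near. Qed.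

Definition mean (f : 'rV[R]_3 -> R) r (x0 : 'rV[R]_3) : R :=
  vint (fun x => f x * mollifier x0 r x).

Lemma Cc_newt_flux d S x0 : 0 < d -> d <= S -> Cc (newt_flux v d S x0).
Proof.
move=> d0 dS; apply: Cc_sum => i; apply: CcMl.
  exact: (Ck_continuous (Ck_vort_cross Cv i 0)).
split; first exact: (Ck_continuous (Ck_radial_field (Dk_newt_diff d S) x0 i)).
by apply: (@bsupp_radial_field _ _ _ _ (S ^+ 2)) => s; exact: newt_diff_out.
Qed.

(** The field of [newt_diff] has as divergence the difference of the two mollifiers and is tested in
    [vint_head_div]. *)
Lemma mean_diff d S x0 : 0 < d -> d <= S ->
  mean Q d x0 - mean Q S x0 = vint (newt_flux v d S x0).
Proof.
move=> d0 dS; have S0 : 0 < S by exact: lt_le_trans dS.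
have cQ := Ck_continuous (CQ 0).
rewrite -vintB; [|by apply: CcMl => //; exact: Cc_mollifier..].
rewrite /newt_flux -(vint_head_div Cv dv0 (CQ 1) vQ).
- by apply: eq_vint => x; rewrite div_newt_diff ?gt_eqF// mulrBr.
- by move=> i; apply: Ck_radial_field; exact: Dk_newt_diff.
- by move=> i; apply: (@bsupp_radial_field _ _ _ _ (S ^+ 2)) => s; exact: newt_diff_out.
- by move=> i j x; apply: partial_radial_field_sym; exact: Dk_newt_diff.
Qed.

Lemma newt_flux_le_weight n m x :
  `|newt_flux v n.+1%:R m.+1%:R 0 x| <=
  n.+1%:R^-1 * flux_weight n x + m.+1%:R^-1 * flux_weight m x.
Proof.
have n0 : 0 < n.+1%:R :> R by []; have m0 : 0 < m.+1%:R :> R by [].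
have an := newt_scaled_ge0 (dist2 0 x) (ltW n0).
have am := newt_scaled_ge0 (dist2 0 x) (ltW m0).
have ac : `|newt_diff n.+1%:R m.+1%:R (dist2 0 x)| <=
    newt_scaled n.+1%:R (dist2 0 x) + newt_scaled m.+1%:R (dist2 0 x).
  by rewrite /newt_diff; move: (newt_scaled _ _) (newt_scaled _ _) an am => a b *;
    rewrite ler_norml; apply/andP; split; lra.
apply: (le_trans (newt_flux_le v ac)); rewrite le_eqVlt; apply/orP; left; apply/eqP.
rewrite /flux_weight /newt_weight.
move: (newt_scaled n.+1%:R _) (newt_scaled m.+1%:R _) (Num.sqrt _) => a b q.
by field; rewrite !gt_eqF.
Qed.

Lemma mean0_diff n m : (n <= m)%N ->
  `|mean Q n.+1%:R 0 - mean Q m.+1%:R 0| <=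
  n.+1%:R^-1 * flux_tail n + m.+1%:R^-1 * flux_tail m.
Proof.
move=> nm; have n0 : 0 < n.+1%:R :> R by [].
have nm' : n.+1%:R <= m.+1%:R :> R by rewrite ler_nat.
have Cf := Cc_newt_flux 0 n0 nm'.
rewrite mean_diff//; apply: (le_trans (ler_norm_vint Cf)).
rewrite -lee_fin vint_nnint; last exact: Cc_abs.
have cz k : continuous (fun x => k.+1%:R^-1 * flux_weight k x).
  by apply: cont_Z; exact: cont_flux_weight.
have z0 k x : 0 <= k.+1%:R^-1 * flux_weight k x.
  by rewrite mulr_ge0 ?invr_ge0// flux_weight_ge0.
apply: (@le_trans _ _ (nnint (fun x => n.+1%:R^-1 * flux_weight n x
    + m.+1%:R^-1 * flux_weight m x))).
  apply: le_nnint => //; [exact: (Cc_abs Cf).1|exact: cont_D|exact: newt_flux_le_weight].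
rewrite nnintD// !nnintZ ?invr_ge0//; try exact: cont_flux_weight;
  try exact: flux_weight_ge0.
by rewrite -!flux_tailE -!EFinM -EFinD.
Qed.

(** [mean0_diff] makes the means a Cauchy sequence; letting m tend to infinity there removes the
    second term and keeps the factor 1/(n+1) of the first. *)
Lemma mean0_limit : exists l : R, forall n,
  n.+1%:R * `|mean Q n.+1%:R 0 - l| <= flux_tail n.
Proof.
have tail0 : (fun m => m.+1%:R^-1 * flux_tail m) @ \oo --> (0 : R).
  rewrite -(mulr0 (0 : R)); apply: cvgM; first exact: cvg_harmonic.
  exact: flux_tail_cvg0.
pose M n := mean Q n.+1%:R 0.
have cM : cvgn M.
  apply/cauchy_cvgP; apply: cauchy_exP => e e0.
  have e2 : 0 < e / 2 by rewrite divr_gt0.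
  move/cvgrPdist_lt : tail0 => /(_ _ e2)[N _ HN].
  have small k : (N <= k)%N -> k.+1%:R^-1 * flux_tail k < e / 2.
    move=> /HN /=; rewrite sub0r normrN; apply: le_lt_trans; exact: ler_norm.
  exists (M N); exists N => // n /= Nn; rewrite /ball /=.
  apply: le_lt_trans (mean0_diff Nn) _.
  by rewrite [ltRHS](splitr e) ltrD// small.
exists (limn M) => n.
suff : `|M n - limn M| <= n.+1%:R^-1 * flux_tail n.
  by rewrite -(@ler_pM2l _ n.+1%:R)// mulrA divff// mul1r.
have H1 : `|M n - M m| @[m --> \oo] --> `|M n - limn M|.
  by apply: cvg_norm; apply: cvgB => //; exact: cvg_cst.
have H2 : n.+1%:R^-1 * flux_tail n + m.+1%:R^-1 * flux_tail m @[m --> \oo]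
    --> n.+1%:R^-1 * flux_tail n + 0.
  by apply: cvgD => //; exact: cvg_cst.
rewrite addr0 in H2.
apply: (@ler_cvg_to _ _ _ _ _ _ _ _ H1 H2); exists n => // m /= nm.
exact: mean0_diff.
Qed.

End head_pressure_limit.

(** * Means at small scales and derivatives of the mollifier *)

Section mollified_means.
Context {R : realType}.
Implicit Types (x : 'rV[R]_3) (f : 'rV[R]_3 -> R) (r s t : R).

Lemma mollifier_supp r x0 x i : 0 < r -> mollifier x0 r x != 0 ->
  `|x 0 i - x0 0 i| < r.
Proof.
move=> r0; rewrite /mollifier; apply: contraNT; rewrite -leNgt => ri.
rewrite bump_out ?mulr0//.
rewrite -[X in X <= _](@mulVf _ (r ^+ 2)) ?expf_neq0 ?gt_eqF//.
rewrite ler_pM2l ?invr_gt0 ?exprn_gt0//; apply: le_trans (coord_dist2 x0 x i).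
by rewrite -[leRHS]ger0_norm ?sqr_ge0// normrX lerXn2r// nnegrE// ltW.
Qed.

Lemma mean_small f x0 : continuous f ->
  mean f n.+1%:R^-1 x0 @[n --> \oo] --> f x0 * vint (mollifier x0 1).
Proof.
move=> cf; pose c := vint (mollifier x0 1).
have c0 : 0 < c by exact: vint_mollifier_gt0.
apply/cvgrPdist_le => e e0.
have ec0 : 0 < e / c by rewrite divr_gt0.
have /cvgrPdist_le/(_ _ ec0)/nbhs_ballP[r /= r0 rf] := cf x0.
have /cvgrPdist_lt/(_ _ r0) H := @cvg_harmonic R.
near=> n; have nr : n.+1%:R^-1 < r.
  have : `|0 - harmonic n| < r by near: n; exact: H.
  by rewrite sub0r normrN ger0_norm// /harmonic /= ?invr_ge0.
have d0 : 0 < n.+1%:R^-1 :> R by rewrite invr_gt0.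
have d1 : n.+1%:R^-1 <= 1 :> R by rewrite invf_le1// ler1n.
have Cm := Cc_mollifier x0 d0.
rewrite -(vint_mollifier_scale x0 d0 d1) -vintZ// /mean -vintB; last 2 first.
- exact: CcZ.
- exact: CcMl.
have Cd : Cc (fun x => f x0 * mollifier x0 n.+1%:R^-1 x - f x * mollifier x0 n.+1%:R^-1 x).
  by apply: CcB; [exact: CcZ|exact: CcMl].
apply: (le_trans (ler_norm_vint Cd)).
(* The mass is the same at all scales, so e is the integral of e/c times the mollifier and
   integrands can be compared. *)
rewrite (_ : e = vint (fun x => e / c * mollifier x0 n.+1%:R^-1 x)); last first.
  by rewrite vintZ// (vint_mollifier_scale x0 d0 d1) -/c divfK// gt_eqF.
apply: le_vint; [exact: Cc_abs|exact: CcZ|move=> x].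
have m0 : 0 <= mollifier x0 n.+1%:R^-1 x by exact: mollifier_ge0 (ltW d0).
rewrite -mulrBl normrM (ger0_norm m0).
have [->|mx] := eqVneq (mollifier x0 n.+1%:R^-1 x) 0; first by rewrite !mulr0.
apply: ler_wpM2r => //.
apply: rf; split=> // i j; rewrite ord1 /ball/= distrC.
exact: lt_trans (mollifier_supp j d0 mx) nr.
Unshelve. all: by end_near. Qed.

Definition moll_profile r (s : R) : R := r ^- 3 * (105 / 8 * bump 2 (r ^- 2 * s)).

Definition moll_profile' r (s : R) : R :=
  r ^- 3 * (105 / 8 * (- 2 * bump 1 (r ^- 2 * s) * r ^- 2)).

Lemma is_derive_moll_profile r s :
  is_derive s 1 (moll_profile r) (moll_profile' r s).
Proof.
have H := is_derive_affine (is_derive_bump 0 (0 + r ^- 2 * s)).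
have E : (fun s => bump 2 (0 + r ^- 2 * s)) = fun s => bump 2 (r ^- 2 * s).
  by apply/funext => t; rewrite add0r.
rewrite E add0r in H.
exact: (is_deriveZ (r ^- 3) (is_deriveZ (105 / 8) H)).
Qed.

Lemma Dk_moll_profile r : Dk 1 (moll_profile r).
Proof. by apply: Dk_scale; apply: Dk_scale; apply: Dk_dilate; exact: Dk_bump1. Qed.

Lemma partial_mollifier j x0 r x : partial j (mollifier x0 r) x =
  moll_profile' r (dist2 x0 x) * (2 * (x 0 j - x0 0 j)).
Proof.
rewrite (_ : mollifier x0 r = fun x => moll_profile r (dist2 x0 x))//.
rewrite (partial_radial (Dk_moll_profile r)) derive1E.
by rewrite (@derive_val _ _ _ _ _ _ _ (is_derive_moll_profile r _)).
Qed.

Lemma is_derive_dist2_center (x0 x : 'rV[R]_3) t :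
  is_derive t 1 (fun t => dist2 (t *: x0) x)
    (- \sum_(i < 3) x0 0 i * (2 * (x 0 i - (t *: x0) 0 i))).
Proof.
have d i : is_derive t 1 (fun t : R => (x 0 i + (- x0 0 i) * t) ^+ 2)
   (2%:R * (x 0 i + (- x0 0 i) * t) ^+ 1 * (- x0 0 i)).
  exact: (is_derive_affine (is_derive_expr 2 (x 0 i + (- x0 0 i) * t))).
have E : (fun t => dist2 (t *: x0) x) = fun t : R =>
   (x 0 0 + (- x0 0 0) * t) ^+ 2 + (x 0 1 + (- x0 0 1) * t) ^+ 2 +
   (x 0 2%:R + (- x0 0 2%:R) * t) ^+ 2.
  by apply/funext => s; rewrite /dist2 sum3E !mxE !mulNr !(mulrC s).
rewrite E; apply: (is_derive_eq (is_deriveD (is_deriveD (d 0) (d 1)) (d 2%:R))).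
by rewrite sum3E !mxE; ring.
Qed.

Lemma is_derive_mollifier_center (x0 x : 'rV[R]_3) r t :
  is_derive t 1 (fun t => mollifier (t *: x0) r x)
    (- \sum_(i < 3) x0 0 i * partial i (mollifier (t *: x0) r) x).
Proof.
have H := @is_derive1_comp R (moll_profile r) (fun t => dist2 (t *: x0) x) t _ _
  (is_derive_moll_profile r _) (is_derive_dist2_center x0 x t).
apply: (is_derive_eq H); rewrite mulrN mulr_sumr; congr (- _).
by apply: eq_bigr => i _; rewrite partial_mollifier mulrCA.
Qed.

(* Enlarging the support absorbs one power of the bump function. *)
Lemma bump1_le (s : R) : 0 <= s -> bump 1 s <= 16 / 9 * bump 2 (s / 4).
Proof.
move=> s0; have [s1|s1] := leP 1 s.
  by rewrite bump_out// mulr_ge0// ?bump_ge0//; lra.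
rewrite /bump /ramp !max_l ?expr1 ?subr_ge0; [|lra|lra].
by have := sqr_ge0 s; nra.
Qed.

(** Integrals against the gradient of a mollifier thereby become means at twice the scale, with a
    gain of 1/r. *)
Lemma partial_mollifier_le j x0 r x : 0 < r ->
  `|partial j (mollifier x0 r) x| <= 64 / r * mollifier x0 (2 * r) x.
Proof.
move=> r0; rewrite partial_mollifier /moll_profile' /mollifier.
have r20 : (2 * r) ^- 2 = r ^- 2 / 4 by field; rewrite gt_eqF.
have r30 : (2 * r) ^- 3 = r ^- 3 / 8 by field; rewrite gt_eqF.
rewrite r20 r30.
have sg0 : 0 <= r ^- 2 * dist2 x0 x.
  by rewrite mulr_ge0 ?dist2_ge0// invr_ge0 exprn_ge0// ltW.
have -> : r ^- 2 / 4 * dist2 x0 x = r ^- 2 * dist2 x0 x / 4 by ring.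
have := bump1_le sg0; have b0 := bump_ge0 1 (r ^- 2 * dist2 x0 x).
have b20 := bump_ge0 2 (r ^- 2 * dist2 x0 x / 4).
(* Where the bump does not vanish, the coordinate difference is at most r. *)
have dj : bump 1 (r ^- 2 * dist2 x0 x) * `|x 0 j - x0 0 j| <=
    bump 1 (r ^- 2 * dist2 x0 x) * r.
  have [->|bx] := eqVneq (bump 1 (r ^- 2 * dist2 x0 x)) 0; first by rewrite !mul0r.
  apply: ler_wpM2l => //; rewrite leNgt; apply: contraNN bx => rj.
  rewrite bump_out// -[X in X <= _](@mulVf _ (r ^+ 2)) ?expf_neq0 ?gt_eqF//.
  rewrite ler_pM2l ?invr_gt0 ?exprn_gt0//; apply: le_trans (coord_dist2 x0 x j).
  by rewrite -[leRHS]ger0_norm ?sqr_ge0// normrX lerXn2r// ?nnegrE// ltW.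
move: b0 b20 dj; move: (bump 1 _) (bump 2 _) => b b2 b0 b20 dj bb2.
move: dj; move: (x 0 j - _) => y0 dj.
rewrite (_ : r ^- 3 * (105 / 8 * (- 2 * b * r ^- 2)) * (2 * y0) = - (r ^- 3 * r ^- 2 * (105 / 2) * b * y0));
  last by field; rewrite gt_eqF.
have A0 : 0 <= r ^- 3 * r ^- 2 * (105 / 2) * b.
  by rewrite !mulr_ge0// ?invr_ge0 ?exprn_ge0 ?ltW//; lra.
rewrite normrN normrM (ger0_norm A0); move: (`|y0|) dj => y dj.
rewrite (_ : _ * y = r ^- 3 * r ^- 2 * (105 / 2) * (b * y)); last by ring.
rewrite [leRHS](_ : _ = r ^- 3 * r ^- 2 * (105 * r * b2)); last first.
  by field; rewrite gt_eqF.
rewrite -mulrA; apply: ler_wpM2l.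
  by rewrite mulr_ge0// invr_ge0 exprn_ge0// ltW.
have : b * y <= 16 / 9 * b2 * r by apply: (le_trans dj); apply: ler_wpM2r => //; exact: ltW.
rewrite (_ : 105 * r * b2 = 105 * (b2 * r)); last by ring.
have : 0 <= b2 * r by rewrite mulr_ge0// ltW.
by rewrite -mulrA; move: (b * y) (b2 * r) => *; lra.
Qed.

End mollified_means.

(** * Dependence of the means on the centre *)

Section moving_center.
Context {R : realType}.
Implicit Types (x : 'rV[R]_3) (f : 'rV[R]_3 -> R) (r s t : R).

Lemma mollifier_le_cst x0 r x : 0 < r -> mollifier x0 r x <= r ^- 3 * (105 / 8).
Proof.
move=> r0; apply: ler_wpM2l; first by rewrite invr_ge0 exprn_ge0// ltW.
rewrite -[leRHS]mulr1; apply: ler_wpM2l; first by lra.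
by apply: bump_le1; rewrite mulr_ge0 ?dist2_ge0// invr_ge0 exprn_ge0// ltW.
Qed.

(** The domination required to differentiate under the integral sign: one function for all centres
    [t *: x0] with |t| <= T. *)
Lemma mollifier_uniform_majorant (x0 : 'rV[R]_3) r (T : R) : 0 < r -> 0 <= T ->
  exists g : 'rV[R]_3 -> R, [/\ Cc g, forall x, 0 <= g x &
    forall t x, `|t| <= T -> mollifier (t *: x0) r x <= g x].
Proof.
move=> r0 T0; pose mi i := r + T * `|x0 0 i|.
have mi0 i : 0 < mi i by rewrite ltr_wpDr// mulr_ge0.
pose m := \sum_(i < 3) mi i ^+ 2.
have m0 : 0 < m.
  by rewrite /m sum3E !addr_gt0// exprn_gt0.
pose K := r ^- 3 * (105 / 8).
have K0 : 0 < K by rewrite mulr_gt0 ?invr_gt0 ?exprn_gt0//.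
(* This is 1/(4m), and m bounds |x|^2 on all the supports, so there the bump is at least (3/4)^2 >
   1/4. *)
pose q := (2 * Num.sqrt m) ^- 2 : R.
have q0 : 0 < 2 * Num.sqrt m by rewrite mulr_gt0// sqrtr_gt0.
have qE : q = (4 * m)^-1 by rewrite /q exprMn sqr_sqrtr ?ltW//; congr (_ * _)^-1; ring.
exists (fun x => 4 * K * bump 2 (q * dist2 0 x)); split.
- apply: CcZ; split; last exact: bsupp_bump.
  apply: (@Ck_continuous _ 1); apply: (Ck_comp (Dk_bump1 0)).
  by apply: CkZ; exact: Ck_dist2.
- by move=> x; rewrite mulr_ge0 ?bump_ge0// mulr_ge0// ltW.
move=> t x tT; have [->|mx] := eqVneq (mollifier (t *: x0) r x) 0.
  by rewrite mulr_ge0 ?bump_ge0// mulr_ge0// ltW.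
apply: (le_trans (mollifier_le_cst _ _ r0)).
have xm : dist2 0 x <= m.
  apply: ler_sum => i _; rewrite mxE subr0.
  rewrite -[leLHS]ger0_norm ?sqr_ge0// normrX lerXn2r ?nnegrE//; first exact: ltW.
  have := mollifier_supp i r0 mx; rewrite mxE => xi.
  have : `|t * x0 0 i| <= T * `|x0 0 i| by rewrite normrM ler_wpM2r.
  have := ler_distD (t * x0 0 i) (x 0 i) 0; rewrite !subr0 /mi.
  by move: xi; move: (`|_ - _|) (`|t * _|) (T * _) (`|x 0 i|) => *; lra.
have sq : q * dist2 0 x <= 1 / 4.
  rewrite qE mulrC ler_pdivrMr; last by rewrite mulr_gt0.
  by move: xm; move: (dist2 0 x) => *; lra.
have sq0 : 0 <= q * dist2 0 x by rewrite mulr_ge0 ?dist2_ge0// invr_ge0 exprn_ge0 ?ltW.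
have b2 : 4^-1 <= bump 2 (q * dist2 0 x).
  rewrite /bump /ramp max_l; last lra.
  by move: (q * _) sq sq0 => s *; nra.
rewrite -/K; move: b2 K0; move: (bump 2 _) => b *; nra.
Qed.

(** Moving the centre differentiates the mollifier with a minus sign, and integration by parts
    brings the derivative onto [f]. *)
Lemma is_derive_mean_center f (x0 : 'rV[R]_3) r t0 : 0 < r -> Ck 1 f ->
  is_derive t0 1 (fun t => mean f r (t *: x0))
    (\sum_(i < 3) x0 0 i * vint (fun x => partial i f x * mollifier (t0 *: x0) r x)).
Proof.
move=> r0 Cf; have cf := Ck_continuous Cf.
have r20 : 0 < 2 * r by rewrite mulr_gt0.
(* This T covers the interval ]t0 - 1, t0 + 1[. The majorant is taken at scale 2r because that is
   the scale in [partial_mollifier_le]. *)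
have T0 : 0 <= `|t0| + 1 by rewrite addr_ge0.
have [g [Cg g0 gm]] := mollifier_uniform_majorant x0 r20 T0.
pose F (t : R) (z : point R) := f (vec3 z) * mollifier (t *: x0) r (vec3 z).
pose dF t x := f x * - \sum_(i < 3) x0 0 i * partial i (mollifier (t *: x0) r) x.
have F' t z : is_derive t 1 (F ^~ z) (dF t (vec3 z)).
  exact: (is_deriveZ (f (vec3 z)) (is_derive_mollifier_center x0 (vec3 z) r t)).
pose K := 64 / r * \sum_(i < 3) `|x0 0 i|.
have K0 : 0 <= K.
  by rewrite mulr_ge0//; [rewrite divr_ge0// ltW|apply: sumr_ge0].
pose G x := `|f x| * (K * g x).
have CG : Cc G.
  apply: CcMl; last exact: CcZ.
  by move=> x; apply: (@continuous_comp _ _ _ f Num.norm); [exact: cf|exact: norm_continuous].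
have dFG t x : `|t| <= `|t0| + 1 -> `|dF t x| <= G x.
  move=> tT; rewrite normrM normrN; apply: ler_wpM2l => //.
  apply: (le_trans (ler_norm_sum _ _ _)).
  rewrite (_ : K * g x = \sum_(i < 3) `|x0 0 i| * (64 / r * g x)); last first.
    by rewrite -mulr_suml /K mulrA; congr (_ * _); rewrite mulrC.
  apply: ler_sum => i _; rewrite normrM; apply: ler_wpM2l => //.
  apply: le_trans (partial_mollifier_le _ _ _ r0) _.
  by apply: ler_wpM2l; [rewrite divr_ge0// ltW|exact: gm].
have ab (t : R) : `]t0 - 1, t0 + 1[%classic t -> `|t| <= `|t0| + 1.
  rewrite /= in_itv/= => /andP[h1 h2].
  by rewrite ler_norml; have := ler_norm t0; have := ler_norm (- t0); rewrite normrN => *;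
    apply/andP; split; lra.
have It0 : `]t0 - 1, t0 + 1[%classic t0 by rewrite /= in_itv/=; apply/andP; split; lra.
have intF t : `]t0 - 1, t0 + 1[%classic t -> leb3.-integrable [set: point R] (EFin \o F t).
  by move=> _; apply: (@Cc_integrable _ (fun x => f x * mollifier (t *: x0) r x));
    apply: CcMl => //; exact: Cc_mollifier.
have derF t z : `]t0 - 1, t0 + 1[%classic t -> [set: point R] z -> derivable (F ^~ z) t 1.
  by move=> _ _; exact: (@ex_derive _ _ _ _ _ _ _ (F' t z)).
have G0 (z : point R) : 0 <= G (vec3 z) by rewrite mulr_ge0// mulr_ge0.
have F1E t z : partial1of2 F t z = dF t (vec3 z).
  by rewrite partial1of2E; exact: (@derive_val _ _ _ _ _ _ _ (F' t z)).
have GF t z : `]t0 - 1, t0 + 1[%classic t -> [set: point R] z ->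
    `|partial1of2 F t z| <= G (vec3 z).
  by move=> /ab tT _; rewrite F1E; exact: dFG.
have D := @derivable_under_integral R _ _ leb3 F setT measurableT t0 (t0 - 1) (t0 + 1)
  It0 intF derF (fun z => G (vec3 z)) G0 (Cc_integrable CG) GF.
have V := @differentiation_under_integral R _ _ leb3 F setT measurableT t0 (t0 - 1) (t0 + 1)
  It0 intF derF (fun z => G (vec3 z)) G0 (Cc_integrable CG) GF.
apply: DeriveDef; first exact: D.
rewrite -derive1E [LHS]V (_ : partial1of2 F t0 = fun z => dF t0 (vec3 z)); last first.
  by apply/funext => z; exact: F1E.
rewrite -/(vint (dF t0)).
have Cm i : Cc (fun x => x0 0 i * (partial i f x * mollifier (t0 *: x0) r x)).
  apply: CcZ; apply: CcMl; first exact: (Ck_continuous (Ck_partial i Cf)).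
  exact: Cc_mollifier.
have Cp i : Cc (fun x => f x * partial i (mollifier (t0 *: x0) r) x).
  apply: CcMl => //; split; first exact: (Ck_continuous (Ck_partial i (Ck_mollifier _ _))).
  by apply: bsupp_partial; exact: bsupp_mollifier.
rewrite (eq_vint (g := fun x => - \sum_(i < 3)
    x0 0 i * (f x * partial i (mollifier (t0 *: x0) r) x))); last first.
  move=> x; rewrite /dF mulrN mulr_sumr; congr (- _); apply: eq_bigr => i _.
  by rewrite mulrCA.
rewrite vintN; last by apply: Cc_sum => i; exact: CcZ.
rewrite vint_sum; last by move=> i; exact: CcZ.
rewrite -sumrN; apply: eq_bigr => i _.
rewrite vintZ// vint_IBP//; first by rewrite mulrN opprK.
  exact: Ck_mollifier.
exact: bsupp_mollifier.
Qed.

Lemma mean_center_le f (x0 : 'rV[R]_3) r (C : R) : 0 < r -> Ck 1 f ->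
  (forall i y, `|vint (fun x => partial i f x * mollifier y r x)| <= C) ->
  `|mean f r x0 - mean f r 0| <= C * \sum_(i < 3) `|x0 0 i|.
Proof.
move=> r0 Cf fC.
have d (t : R) : is_derive t 1 (fun t => mean f r (t *: x0))
    (\sum_(i < 3) x0 0 i * vint (fun x => partial i f x * mollifier (t *: x0) r x)).
  exact: is_derive_mean_center.
have cd : {within `[0, 1], continuous (fun t : R => mean f r (t *: x0))}.
  by apply: continuous_subspaceT; exact: (is_derive_continuous d).
have [c _] := MVT_segment ler01 (fun t _ => d t) cd.
rewrite scale1r scale0r subr0 mulr1 => ->.
apply: (le_trans (ler_norm_sum _ _ _)); rewrite mulr_sumr.
by apply: ler_sum => i _; rewrite normrM mulrC; apply: ler_wpM2r.
Qed.

(** The case f = 1, C = 0 of [mean_center_le], in place of translation invariance of the measure. *)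
Lemma vint_mollifier_center x0 r : 0 < r ->
  vint (mollifier x0 r) = vint (mollifier (0 : 'rV[R]_3) r).
Proof.
move=> r0; have H := @mean_center_le (fun=> 1) x0 r 0 r0 (Ck_cst 1 1) _.
apply/eqP; rewrite -subr_eq0 -normr_le0.
rewrite mul0r in H; apply: le_trans (H _).
  rewrite le_eqVlt; apply/orP; left; apply/eqP; congr (`|vint _ - vint _|);
    by apply/funext => x; rewrite mul1r.
move=> i y; rewrite (eq_vint (g := fun=> 0)).
  by rewrite /vint /Rintegral integral0 normr0.
by move=> x; rewrite partial_cst mul0r.
Qed.

End moving_center.

(** * A singular kernel *)

Section cube_kernel.
Context {R : realType}.
Implicit Types (c z : point R).

(** Dyadic cubes make the kernel measurable, symmetric and explicitly integrable. If 2^-(n+1) < |z -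
    c| <= 2^-n in the sup norm, then |z - c|^-2 <= 4^(n+1); if |z - c| >= 2^n, then |z - c|^-4 <=
    16^-n. *)
Definition cube_kernel_term (n : nat) c z : R :=
  4 ^+ n.+1 * \1_(cube c (2 ^- n)) z + 16 ^- n * \1_(cube c (2 ^+ n.+1)) z.

(* A kernel dominating |z - c|^-2 near [c] and |z - c|^-4 away from it. *)
Definition cube_kernel c z : \bar R :=
  (\sum_(0 <= n <oo) (cube_kernel_term n c z)%:E)%E.

Lemma cube_kernel_term_ge0 n c z : 0 <= cube_kernel_term n c z.
Proof. by rewrite addr_ge0// mulr_ge0// ?invr_ge0 ?exprn_ge0// indicE. Qed.

Lemma cube_kernel_ge0 c z : (0 <= cube_kernel c z)%E.
Proof. by apply: nneseries_ge0 => n _ _; rewrite lee_fin cube_kernel_term_ge0. Qed.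

Lemma cube_kernel_ge_term n c z : ((cube_kernel_term n c z)%:E <= cube_kernel c z)%E.
Proof.
apply: (@le_trans _ _ (\sum_(0 <= i < n.+1) (cube_kernel_term i c z)%:E)%E).
  rewrite big_nat_recr//=; apply: leeDr; apply: sume_ge0 => i _.
  by rewrite lee_fin cube_kernel_term_ge0.
by apply: nneseries_lim_ge => i _; rewrite lee_fin cube_kernel_term_ge0.
Qed.

Lemma in_cube c z (r : R) : (z \in cube c r) = [forall i, `|vec3 z 0 i - vec3 c 0 i| <= r].
Proof.
apply/idP/idP => [|/forallP zr]; last by rewrite inE; apply/cubeP.
by rewrite inE => /cubeP zr; apply/forallP.
Qed.

Lemma exp2_lt_eventually (a : R) : 0 < a -> exists n : nat, 2 ^- n.+1 < a.
Proof.
move=> a0; exists (Num.trunc a^-1).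
have na : a^-1 < (Num.trunc a^-1).+1%:R by exact: truncnS_gt.
rewrite invf_plt ?posrE ?exprn_gt0//; apply: (lt_le_trans na).
by rewrite -natrX ler_nat ltnW// ltn_expl.
Qed.

Lemma cube_kernel_near c z : (forall i, `|vec3 z 0 i - vec3 c 0 i| <= 1) ->
  (((dist2 (vec3 c) (vec3 z))^-1)%:E <= cube_kernel c z)%E.
Proof.
move=> z1; set s := dist2 _ _; have s0 : 0 <= s by exact: dist2_ge0.
(* At z = c the left-hand side is 0, the inverse of 0 being 0. *)
have [i0|z0] := pselect (exists i, 0 < `|vec3 z 0 i - vec3 c 0 i|); last first.
  have -> : s = 0.
    apply: big1 => i _; apply/eqP; rewrite sqrf_eq0 -normr_eq0 eq_le normr_ge0 andbT.
    by rewrite leNgt; apply/negP => ?; apply: z0; exists i.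
  by rewrite invr0 cube_kernel_ge0.
have exP : exists n, [exists i, 2 ^- n.+1 < `|vec3 z 0 i - vec3 c 0 i|].
  case: i0 => i /exp2_lt_eventually[n ni]; exists n; apply/existsP; exists i.
  exact: ni.
case: (ex_minnP exP) => n /existsP[i ni] minn.
have zn : z \in cube c (2 ^- n).
  rewrite in_cube; apply/forallP => j; case: n minn {ni} => [|n] minn.
    by rewrite expr0 invr1.
  rewrite leNgt; apply/negP => nj.
  by have := minn n; rewrite ltnn => /(_ (introT existsP (ex_intro _ j nj))).
apply: le_trans (cube_kernel_ge_term n c z).
rewrite lee_fin /cube_kernel_term indicE zn mulr1.
apply: (@le_trans _ _ (4 ^+ n.+1)); last first.
  by rewrite lerDl mulr_ge0// ?invr_ge0 ?exprn_ge0// indicE.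
have ns : 4 ^- n.+1 <= s.
  apply: le_trans (coord_dist2 (vec3 c) (vec3 z) i).
  rewrite -[leRHS]ger0_norm ?sqr_ge0// normrX.
  have -> : 4 ^- n.+1 = (2 ^- n.+1) ^+ 2 :> R.
    by rewrite exprVn -exprM mulnC exprM; congr (_ ^- _); rewrite -natrX.
  by rewrite lerXn2r ?nnegrE ?invr_ge0 ?exprn_ge0// ltW.
have n40 : 0 < 4 ^- n.+1 :> R by rewrite invr_gt0 exprn_gt0.
rewrite -[leRHS]invrK lef_pV2 ?posrE//.
exact: lt_le_trans ns.
Qed.

Lemma cube_kernel_far c z i : 1 < `|vec3 z 0 i - vec3 c 0 i| ->
  (((dist2 (vec3 c) (vec3 z))^-2)%:E <= cube_kernel c z)%E.
Proof.
move=> i1; set s := dist2 _ _.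
have exP : exists n, z \in cube c (2 ^+ n.+1).
  pose M := \sum_(j < 3) `|vec3 z 0 j - vec3 c 0 j|.
  exists (Num.trunc M); rewrite in_cube; apply/forallP => j.
  apply: (@le_trans _ _ M).
    by rewrite /M (bigD1 j)//= lerDl; apply: sumr_ge0.
  apply/ltW/(lt_le_trans (truncnS_gt M)).
  by rewrite -natrX ler_nat ltnW// ltn_expl.
case: (ex_minnP exP) => n zn minn.
apply: le_trans (cube_kernel_ge_term n c z).
rewrite lee_fin /cube_kernel_term [in X in _ + X]indicE zn mulr1.
apply: (@le_trans _ _ (16 ^- n)); last by rewrite lerDr mulr_ge0// indicE.
have ns : 4 ^+ n <= s.
  have [j nj] : exists j, 2 ^+ n <= `|vec3 z 0 j - vec3 c 0 j|.
    case: n minn {zn} => [|n] minn; first by exists i; rewrite expr0 ltW.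
    have : z \notin cube c (2 ^+ n.+1).
      by apply/negP => /minn; rewrite ltnn.
    rewrite in_cube negb_forall => /existsP[j]; rewrite -ltNge => nj.
    by exists j; exact: ltW.
  apply: le_trans (coord_dist2 (vec3 c) (vec3 z) j).
  rewrite -[leRHS]ger0_norm ?sqr_ge0// normrX.
  have -> : 4 ^+ n = (2 ^+ n) ^+ 2 :> R.
    by rewrite -exprM mulnC exprM; congr (_ ^+ _); rewrite -natrX.
  by rewrite lerXn2r ?nnegrE ?exprn_ge0.
have n40 : 0 < 4 ^+ n :> R by rewrite exprn_gt0.
have s0 : 0 < s by exact: lt_le_trans ns.
have -> : 16 ^- n = (4 ^+ n) ^- 2 :> R.
  by rewrite -exprM mulnC exprM; congr (_ ^- _); rewrite -natrX.
by rewrite lef_pV2 ?posrE ?exprn_gt0// lerXn2r// nnegrE ltW.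
Qed.

Lemma measurable_cube_pair (r : R) :
  measurable [set p : point R * point R | cube p.1 r p.2].
Proof.
pose coord (f : point R -> R) (p : point R * point R) : R := f p.2 - f p.1.
have mf : forall f : point R -> R, measurable_fun [set: point R] f ->
    measurable [set p | `|coord f p| <= r].
  move=> f mf.
  have mc : measurable_fun [set: point R * point R] (fun p => `|coord f p|).
    apply: measurableT_comp => //; apply: measurable_funB.
      by apply: measurableT_comp => //; exact: measurable_snd.
    by apply: measurableT_comp => //; exact: measurable_fst.
  have := mc measurableT `]-oo, r]%classic (measurable_itv _).
  by rewrite setTI; congr measurable; apply/seteqP; split => p /=; rewrite in_itv.
rewrite (_ : [set p | _] = [set p | `|coord (fun z => z.1.1) p| <= r] `&`
    [set p | `|coord (fun z => z.1.2) p| <= r] `&`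
    [set p | `|coord (fun z => z.2) p| <= r]).
  apply: measurableI; [apply: measurableI|]; apply: mf.
  - exact: (measurableT_comp (measurable_fst) (measurable_fst)).
  - exact: (measurableT_comp (measurable_snd) (measurable_fst)).
  - exact: measurable_snd.
apply/seteqP; split => p /=.
  by move=> /cubeP H; have := H 0; have := H 1; have := H 2%:R; rewrite !vec3E.
by move=> [[h0 h1] h2]; apply/cubeP; apply: ord3P; rewrite !vec3E.
Qed.

Lemma measurable_cube_kernel_term n :
  measurable_fun [set: point R * point R]
    (fun p => (cube_kernel_term n p.1 p.2)%:E).
Proof.
have mi (r : R) : measurable_fun [set: point R * point R]
    (fun p => \1_(cube p.1 r) p.2 : R).
  rewrite (_ : (fun p => _) =
      (\1_[set p : point R * point R | cube p.1 r p.2] : _ -> R)).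
    by apply: measurable_indic; exact: measurable_cube_pair.
  by apply/funext => p; rewrite !indicE; congr (_%:R); apply/idP/idP; rewrite !inE.
by apply/measurable_EFinP; apply: measurable_funD; apply: measurable_funM => //;
  exact: mi.
Qed.

Lemma measurable_cube_kernel : measurable_fun [set: point R * point R]
  (fun p => cube_kernel p.1 p.2).
Proof.
apply: ge0_emeasurable_sum => [n p _ _|n _]; last exact: measurable_cube_kernel_term.
by rewrite lee_fin cube_kernel_term_ge0.
Qed.

Lemma cube_kernelC c z : cube_kernel c z = cube_kernel z c.
Proof.
have cubeC (r : R) : (z \in cube c r) = (c \in cube z r).
  by rewrite !in_cube; apply: eq_forallb => i; rewrite distrC.
by apply: eq_eseriesr => n _; rewrite /cube_kernel_term !indicE !cubeC.
Qed.

Lemma measurable_cube_kernel2 c : measurable_fun [set: point R] (cube_kernel c).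
Proof.
exact: (@measurable_fun_pair2 _ _ _ _ _ _
  (fun p : point R * point R => cube_kernel p.1 p.2) c measurable_cube_kernel).
Qed.

(** The small cube contributes 32 * 2^-n and the large one 64 * 2^-n. *)
Lemma integral_cube_kernel_term n c :
  (\int[leb3]_z (cube_kernel_term n c z)%:E = (96 * 2 ^- n)%:E)%E.
Proof.
have mi (r : R) : measurable_fun [set: point R] (fun z => (\1_(cube c r) z)%:E).
  by apply/measurable_EFinP; apply: measurable_indic; exact: measurable_cube.
have ii (r k : R) : 0 <= r -> 0 <= k ->
    (\int[leb3]_z (k%:E * (\1_(cube c r) z)%:E) = (k * (2 * r) ^+ 3)%:E)%E.
  move=> r0 k0; rewrite ge0_integralZl_EFin; [|by []|by move=> z _; rewrite lee_fin indicE|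
    exact: mi|by []].
  rewrite integral_indic//; last exact: measurable_cube.
  by rewrite setIT EFinM -(leb3_cube c r0).
rewrite /cube_kernel_term; under eq_integral do rewrite EFinD !EFinM.
rewrite ge0_integralD; [|by []|by move=> z _; rewrite mule_ge0// lee_fin ?exprn_ge0//
  indicE|by apply: measurable_funeM; exact: mi|by move=> z _; rewrite mule_ge0// lee_fin
  ?invr_ge0 ?exprn_ge0// indicE|by apply: measurable_funeM; exact: mi].
rewrite !ii ?invr_ge0 ?exprn_ge0// -EFinD; congr EFin.
have -> : 4 ^+ n.+1 = 4 * 2 ^+ n * 2 ^+ n :> R.
  by rewrite exprS -mulrA -exprMn -natrM.
have -> : 16 ^- n = (2 ^+ n * 2 ^+ n * 2 ^+ n * 2 ^+ n)^-1 :> R.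
  by rewrite -!exprMn -!natrM.
have -> : 2 ^+ n.+1 = 2 * 2 ^+ n :> R by rewrite exprS.
have : 2 ^+ n != 0 :> R by rewrite expf_neq0.
by move: (2 ^+ n) => w w0; field.
Qed.

Lemma integral_cube_kernel c : (\int[leb3]_z cube_kernel c z <= 192%:E)%E.
Proof.
rewrite integral_nneseries//; last 2 first.
- move=> n; exact: (@measurable_fun_pair2 _ _ _ _ _ _ (fun p : point R * point R =>
    (cube_kernel_term n p.1 p.2)%:E) c (measurable_cube_kernel_term n)).
- by move=> n z _; rewrite lee_fin cube_kernel_term_ge0.
under eq_eseriesr do rewrite integral_cube_kernel_term.
apply: lime_le; first by apply: is_cvg_nneseries => n _ _; rewrite lee_fin mulr_ge0.
apply: nearW => n; rewrite sumEFin lee_fin.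
suff -> : \sum_(0 <= i < n) (96 * 2 ^- i) = 192 * (1 - 2 ^- n) :> R.
  have : 0 <= 2 ^- n :> R by rewrite invr_ge0 exprn_ge0.
  by move: (2 ^- n) => w; lra.
elim: n => [|n IH]; first by rewrite big_nil expr0 invr1 subrr mulr0.
rewrite big_nat_recr//= IH exprS; have : 2 ^+ n != 0 :> R by rewrite expf_neq0.
by move: (2 ^+ n) => w w0; field.
Qed.

Definition kernel_conv (g : 'rV[R]_3 -> R) c : \bar R :=
  (\int[leb3]_z ((g (vec3 z))%:E * cube_kernel c z))%E.

Lemma measurable_kernel_conv_integrand (g : 'rV[R]_3 -> R) : continuous g ->
  measurable_fun [set: point R * point R]
    (fun p => ((g (vec3 p.2))%:E * cube_kernel p.1 p.2)%E).
Proof.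
move=> cg; apply: emeasurable_funM; last exact: measurable_cube_kernel.
by apply: (measurableT_comp (measurable_vec3E cg)); exact: measurable_snd.
Qed.

(** Tonelli's theorem and the symmetry of the kernel, whose mass is at most 192. The convolution is
    thus integrable when [g] is, although it may be infinite at some points. *)
Lemma integral_kernel_conv (g : 'rV[R]_3 -> R) : continuous g ->
  (forall x, 0 <= g x) ->
  (\int[leb3]_c kernel_conv g c <= 192%:E * nnint g)%E.
Proof.
move=> cg g0; rewrite /kernel_conv.
have mF := measurable_kernel_conv_integrand cg.
have F0 (p : point R * point R) :
    (0 <= (g (vec3 p.2))%:E * cube_kernel p.1 p.2)%E.
  by rewrite mule_ge0 ?cube_kernel_ge0 ?lee_fin.
have := @fubini_tonelli _ _ _ _ R leb3 leb3
  (fun p => ((g (vec3 p.2))%:E * cube_kernel p.1 p.2)%E) mF F0.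
move=> /= ->.
apply: (@le_trans _ _ (\int[leb3]_z (192%:E * (g (vec3 z))%:E))%E); last first.
  rewrite ge0_integralZl_EFin//; first by move=> z _; rewrite lee_fin.
  exact: measurable_vec3E.
apply: ge0_le_integral => //.
- by move=> z _; apply: integral_ge0 => c _; exact: (F0 (c, z)).
- apply: (@measurable_fun_fubini_tonelli_G _ _ _ _ R leb3
    (fun p : point R * point R => ((g (vec3 p.2))%:E * cube_kernel p.1 p.2)%E)) => //.
- by apply: measurable_funeM; exact: measurable_vec3E.
move=> z _; under eq_integral do rewrite cube_kernelC.
rewrite ge0_integralZl_EFin//; last 2 first.
- by move=> c _; exact: cube_kernel_ge0.
- exact: measurable_cube_kernel2.
by rewrite muleC; apply: lee_wpmul2r; rewrite ?lee_fin// integral_cube_kernel.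
Qed.

End cube_kernel.

(** * Far-field decay of the head pressure *)

Section far_field.
Context {R : realType}.
Implicit Types (x y : 'rV[R]_3) (f : 'rV[R]_3 -> R) (r s t : R).

Lemma vanishing_dist2 f : vanishing f -> forall e : R, 0 < e ->
  exists2 M : R, 0 <= M & forall x, M < dist2 0 x -> `|f x| < e.
Proof.
move=> vf e /vf[M fM]; pose N := Num.max M 0.
have N0 : 0 <= N by rewrite /N le_max lexx orbT.
exists (3 * N ^+ 2); first by rewrite mulr_ge0 ?sqr_ge0.
move=> x; apply: contraTT; rewrite -!leNgt => ef.
have xN i : `|x 0 i| <= N.
  by rewrite leNgt; apply: contraTN ef; rewrite gt_max -ltNge => /andP[/fM].
have xN2 i : (x 0 i - (0 : 'rV[R]_3) 0 i) ^+ 2 <= N ^+ 2.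
  rewrite mxE subr0 -[leLHS]ger0_norm ?sqr_ge0// normrX.
  by rewrite lerXn2r ?nnegrE.
by rewrite /dist2 sum3E; have := xN2 0; have := xN2 1; have := xN2 2%:R; lra.
Qed.

Lemma vanishing_bounded f : continuous f -> vanishing f ->
  exists2 K : R, 0 <= K & forall x, `|f x| <= K.
Proof.
move=> cf vf; have [M fM] := vf 1 ltr01; pose N := Num.max M 0.
have N0 : 0 <= N by rewrite /N le_max lexx orbT.
pose A := [set x : 'rV[R]_3 | forall i, `|x 0 i| <= N].
have A0 : A !=set0 by exists 0 => i /=; rewrite mxE normr0.
have cfA : {within A, continuous (fun x => `|f x|)}.
  apply: continuous_subspaceT => x.
  by apply: (cvg_comp f Num.norm (cf x)); exact: norm_continuous.
have [c _ fc] := EVT_max_rV A0 (@compact_cube R N) cfA.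
exists (`|f c| + 1) => [|x]; first by rewrite addr_ge0.
have [xN|/existsNP[i]] := pselect (forall i, `|x 0 i| <= N).
  by rewrite ler_wpDr//; apply: fc; rewrite inE.
move/negP; rewrite -ltNge gt_max => /andP[/fM /ltW fx _].
by rewrite ler_wpDl.
Qed.

Lemma dist2_triangle (y x : 'rV[R]_3) : dist2 0 y <= 2 * dist2 0 x + 2 * dist2 y x.
Proof.
rewrite /dist2 !sum3E !mxE !subr0.
have H (a b : R) : a ^+ 2 <= 2 * b ^+ 2 + 2 * (b - a) ^+ 2.
  by rewrite -subr_ge0 (_ : _ - _ = (a - 2 * b) ^+ 2) ?sqr_ge0//; ring.
have := H (y 0 0) (x 0 0); have := H (y 0 1) (x 0 1).
by have := H (y 0 2%:R) (x 0 2%:R); lra.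
Qed.

(** AM-GM: 2 (U g)^(1/2) <= e + (U/e) g. It is used for b = |w x v| or a component of it, U a bound
    of |v|^2 and g = |grad v|^2. *)
Lemma near_bound (b g U e : R) : 0 < e -> 0 <= g -> 0 <= U ->
  b ^+ 2 <= 4 * (U * g) -> b <= e + U / e * g.
Proof.
move=> e0 g0 U0 bU; apply: le_trans (ler_norm _) _; apply: abs_le_of_sqr.
  by apply: addr_ge0; [exact: ltW|apply: mulr_ge0 => //; apply: divr_ge0 => //; exact: ltW].
apply: (le_trans bU); rewrite -subr_ge0 (_ : _ - _ = (e - U / e * g) ^+ 2).
  exact: sqr_ge0.
by field; rewrite gt_eqF.
Qed.

Lemma far_bound_tail (b g T t : R) : 0 <= T -> 0 <= g ->
  b ^+ 2 <= 4 * (T ^+ 2 * g) -> b * t <= T * (g + t ^+ 2).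
Proof.
move=> T0 g0 bT; apply: le_trans (ler_norm _) _; apply: abs_le_of_sqr.
  by rewrite mulr_ge0// addr_ge0// sqr_ge0.
rewrite exprMn; apply: (@le_trans _ _ (4 * (T ^+ 2 * g) * t ^+ 2)).
  by apply: ler_wpM2r => //; exact: sqr_ge0.
rewrite -subr_ge0 (_ : _ - _ = (T * (g - t ^+ 2)) ^+ 2) ?sqr_ge0//; ring.
Qed.

(** Here p = |x|^2 for x near the origin and s = |x - x0|^2. The inverse weight is at most 2s, so
    b/s <= h (2/s)^(1/2) <= h 8^(1/2)/L, and 8 <= 3^2. *)
Lemma far_bound_core (b h s p L : R) : 0 < L -> 1 <= s -> 0 <= p -> p <= s ->
  L ^+ 2 / 4 <= s -> 0 <= h -> b ^+ 2 * hardy_profile p <= h ^+ 2 ->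
  b / s <= 3 / L * h.
Proof.
move=> L0 s1 p0 ps Ls h0 bh; have s0 : 0 < s by lra.
apply: le_trans (ler_norm _) _; apply: abs_le_of_sqr.
  by rewrite mulr_ge0// divr_ge0// ltW.
have qs : Num.sqrt (1 + p ^+ 2) <= 2 * s.
  have s20 : 0 <= 2 * s by lra.
  rewrite -[leRHS]ger0_norm// -sqrtr_sqr ler_wsqrtr//; nra.
have q0 : 0 < Num.sqrt (1 + p ^+ 2) by rewrite sqrtr_gt0 one_sqr_gt0.
have b2 : b ^+ 2 <= h ^+ 2 * (2 * s).
  apply: (@le_trans _ _ (h ^+ 2 * Num.sqrt (1 + p ^+ 2))).
    by rewrite -ler_pdivrMr.
  by apply: ler_wpM2l => //; exact: sqr_ge0.
rewrite exprMn exprVn ler_pdivrMr ?exprn_gt0//.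
apply: (le_trans b2); rewrite exprMn.
rewrite (_ : (3 / L) ^+ 2 * h ^+ 2 * s ^+ 2 = h ^+ 2 * (s * (9 * s / L ^+ 2))); last first.
  by field; rewrite gt_eqF.
apply: ler_wpM2l; first exact: sqr_ge0.
rewrite mulrC; apply: ler_wpM2l; first exact: ltW.
rewrite ler_pdivlMr ?exprn_gt0//; move: Ls; move: (L ^+ 2) => l; lra.
Qed.

Definition to_point x : point R := (x 0 0, x 0 1, x 0 2%:R).

Lemma to_pointK x : vec3 (to_point x) = x.
Proof. exact: vec3_surj. Qed.

Variable v : 'I_3 -> 'rV[R]_3 -> R.
Variable Q : 'rV[R]_3 -> R.
Hypothesis Cv : forall i k, Ck k (v i).
Hypothesis dv0 : solenoidal v.
Hypothesis CQ : forall k, Ck k Q.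
Hypothesis vQ : head_eqn v Q.
Hypothesis hH : (nnint (hardy_energy v) < +oo)%E.
Hypothesis vv : forall i, vanishing (v i).

Lemma speed2_small (e : R) : 0 < e ->
  exists2 M : R, 0 <= M & forall x, M < dist2 0 x -> speed2 v x <= e ^+ 2.
Proof.
move=> e0; have e20 : 0 < e / 2 by rewrite divr_gt0.
have [M0 M00 H0] := vanishing_dist2 (vv 0) e20.
have [M1 M10 H1] := vanishing_dist2 (vv 1) e20.
have [M2 M20 H2] := vanishing_dist2 (vv 2%:R) e20.
exists (M0 + M1 + M2); first by rewrite !addr_ge0.
move=> x xM.
have sq i M : M < dist2 0 x -> (forall x, M < dist2 0 x -> `|v i x| < e / 2) ->
    v i x ^+ 2 <= e ^+ 2 / 4.
  move=> Mx /(_ x Mx) ve; rewrite -[leLHS]ger0_norm ?sqr_ge0// normrX.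
  rewrite (_ : e ^+ 2 / 4 = (e / 2) ^+ 2); last by field.
  by apply: lerXn2r; rewrite ?nnegrE//; exact: ltW.
have e22 := sqr_ge0 e.
rewrite /speed2 sum3E.
have : v 0 x ^+ 2 <= e ^+ 2 / 4.
  by apply: (sq _ M0) => //; clear -xM M10 M20; lra.
have : v 1 x ^+ 2 <= e ^+ 2 / 4.
  by apply: (sq _ M1) => //; clear -xM M00 M20; lra.
have : v 2%:R x ^+ 2 <= e ^+ 2 / 4.
  by apply: (sq _ M2) => //; clear -xM M00 M10; lra.
clear -e22; move: (e ^+ 2) e22 => *; lra.
Qed.

Lemma speed2_bounded : exists2 U : R, 0 <= U & forall x, speed2 v x <= U.
Proof.
have [K0 K00 H0] := vanishing_bounded (Ck_continuous (Cv 0 0)) (vv 0).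
have [K1 K10 H1] := vanishing_bounded (Ck_continuous (Cv 1 0)) (vv 1).
have [K2 K20 H2] := vanishing_bounded (Ck_continuous (Cv 2%:R 0)) (vv 2%:R).
exists (K0 ^+ 2 + K1 ^+ 2 + K2 ^+ 2); first by rewrite !addr_ge0// sqr_ge0.
move=> x; rewrite /speed2 sum3E.
by apply: lerD; [apply: lerD|]; rewrite -[leLHS]ger0_norm ?sqr_ge0// normrX
  lerXn2r ?nnegrE.
Qed.

Lemma nnint_gradsq_lty : (nnint (gradsq v) < +oo)%E.
Proof.
apply: le_lt_trans hH; apply: le_nnint.
- exact: cont_gradsq.
- exact: cont_hardy_energy.
- exact: gradsq_ge0.
- by move=> x; rewrite lerDr mulr_ge0 ?speed2_ge0// ltW// hardy_weight_gt0.
Qed.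

(** Three regions. Within sup-distance 1 of [x0], [near_bound] and the |x - x0|^-2 part of the
    kernel apply. Farther away with |x| > L/2, the speed is at most T and the |x - x0|^-4 part
    applies. For |x| <= L/2 the Hardy energy is used, with the gain 3/L. *)
Lemma newt_flux_pointwise (U e T L d S : R) (x0 x : 'rV[R]_3) :
  0 < e -> 0 <= U -> 0 <= T -> 0 < L -> 0 < d -> 0 < S ->
  (forall x, speed2 v x <= U) ->
  (forall x, L ^+ 2 / 4 < dist2 0 x -> speed2 v x <= T ^+ 2) ->
  L ^+ 2 <= dist2 0 x0 ->
  (`|newt_flux v d S x0 x|%:E <=
   (e + T)%:E * cube_kernel (to_point x0) (to_point x) +
   (U / e)%:E * ((gradsq v x)%:E * cube_kernel (to_point x0) (to_point x)) +
   (3 / L * hardy_energy v x + T * gradsq v x)%:E)%E.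
Proof.
move=> e0 U0 T0 L0 d0 S0 HU HT Lx0.
set k := cube_kernel _ _; set g := gradsq v x; set h := hardy_energy v x.
have g0 : 0 <= g by exact: gradsq_ge0.
have h0 : 0 <= h by exact: hardy_energy_ge0.
have k0 : (0 <= k)%E by exact: cube_kernel_ge0.
have eT0 : 0 <= e + T by lra.
have Ue0 : 0 <= U / e by rewrite divr_ge0// ltW.
have t1 : (0 <= (e + T)%:E * k)%E by rewrite mule_ge0// lee_fin.
have t2 : (0 <= (U / e)%:E * (g%:E * k))%E by rewrite !mule_ge0// lee_fin.
have L30 : 0 <= 3 / L * h by rewrite mulr_ge0// divr_ge0// ltW.
have Tg0 : 0 <= T * g by rewrite mulr_ge0.
have t3 : (0 <= (3 / L * h + T * g)%:E)%E by rewrite lee_fin addr_ge0.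
apply: (@le_trans _ _ (vort_cross_norm v x / dist2 x0 x)%:E).
  by rewrite lee_fin; exact: newt_flux_le_inv.
set b := vort_cross_norm v x; set s := dist2 x0 x.
have b2 : b ^+ 2 <= 4 * (speed2 v x * g) by exact: vort_cross_norm_sqr.
have b0 : 0 <= b by exact: vort_cross_norm_ge0.
have s0 : 0 <= s by exact: dist2_ge0.
have [near|/existsNP[i /negP]] := pselect (forall i, `|x 0 i - x0 0 i| <= 1).
  have ks : ((s^-1)%:E <= k)%E.
    by have := @cube_kernel_near R (to_point x0) (to_point x); rewrite !to_pointK; apply.
  have bU : b <= e + U / e * g.
    apply: near_bound => //; apply: (le_trans b2).
    by apply: ler_wpM2l => //; apply: ler_wpM2r.
  apply: (@le_trans _ _ ((e + U / e * g)%:E * k)%E).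
    rewrite EFinM; apply: lee_pmul; rewrite ?lee_fin ?invr_ge0//.
  apply: (@le_trans _ _ ((e + T)%:E * k + (U / e)%:E * (g%:E * k))%E); last by rewrite leeDl.
  have Ueg0 : (0 <= (U / e * g)%:E)%E by rewrite lee_fin mulr_ge0.
  rewrite EFinD ge0_muleDl//; last by rewrite lee_fin ltW.
  apply: leeD; last by rewrite EFinM muleA.
  by apply: lee_wpmul2r => //; rewrite lee_fin lerDl.
rewrite -ltNge => far.
have s1 : 1 <= s.
  apply: (@le_trans _ _ (`|x 0 i - x0 0 i| ^+ 2)); first by rewrite exprn_ege1// ltW.
  by rewrite -normrX ger0_norm ?sqr_ge0// coord_dist2.
have [Lp|pL] := ltP (L ^+ 2 / 4) (dist2 0 x).
  have ks : ((s^-1 ^+ 2)%:E <= k)%E.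
    rewrite exprVn.
    by have := @cube_kernel_far R (to_point x0) (to_point x) i; rewrite !to_pointK; apply.
  have bT : b / s <= T * g + T * s^-1 ^+ 2.
    rewrite -mulrDr; apply: far_bound_tail => //; apply: (le_trans b2).
    by apply: ler_wpM2l => //; apply: ler_wpM2r => //; exact: HT.
  apply: (@le_trans _ _ ((T * g)%:E + T%:E * k)%E).
    apply: (@le_trans _ _ ((T * g)%:E + T%:E * (s^-1 ^+ 2)%:E)%E).
      by rewrite -EFinM -EFinD lee_fin.
    by apply: leeD => //; apply: lee_wpmul2l => //; rewrite lee_fin.
  rewrite addeC; apply: leeD.
    apply: (@le_trans _ _ ((e + T)%:E * k)%E); last by rewrite leeDl.
    by apply: lee_wpmul2r => //; rewrite lee_fin lerDr ltW.
  by rewrite lee_fin lerDr.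
(* Now |x|^2 <= L^2/4 while |x0|^2 >= L^2, and |x0|^2 <= 2 |x|^2 + 2 |x - x0|^2. *)
have ps : dist2 0 x <= s /\ L ^+ 2 / 4 <= s.
  have := dist2_triangle x0 x; rewrite -/s.
  by move: Lx0 pL; move: (L ^+ 2) (dist2 0 x0) (dist2 0 x) => *; split; lra.
have bc : b / s <= 3 / L * h.
  apply: (far_bound_core (p := dist2 0 x)) => //; [exact: dist2_ge0|exact: ps.1|exact: ps.2|].
  apply: le_trans (hardy_energy_AMGM v x); rewrite -/g -/(hardy_weight x) mulrA.
  by apply: ler_wpM2r => //; exact: ltW (hardy_weight_gt0 _).
apply: (@le_trans _ _ (3 / L * h + T * g)%:E); last by rewrite leeDr// adde_ge0.
by rewrite lee_fin; apply: (le_trans bc); rewrite lerDl.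
Qed.

End far_field.

Section far_field_flux.
Context {R : realType}.
Implicit Types (x : 'rV[R]_3).

Variable v : 'I_3 -> 'rV[R]_3 -> R.
Hypothesis Cv : forall i k, Ck k (v i).
Hypothesis hH : (nnint (hardy_energy v) < +oo)%E.
Hypothesis vv : forall i, vanishing (v i).

Lemma to_point_vec3 (z : point R) : to_point (vec3 z) = z.
Proof. by case: z => [[a b] t]; rewrite /to_point !vec3E. Qed.

Lemma vint_newt_flux_le (U e T L d S : R) (x0 : 'rV[R]_3) :
  0 < e -> 0 <= U -> 0 <= T -> 0 < L -> 0 < d -> d <= S ->
  (forall x, speed2 v x <= U) ->
  (forall x, L ^+ 2 / 4 < dist2 0 x -> speed2 v x <= T ^+ 2) ->
  L ^+ 2 <= dist2 0 x0 ->
  (`|vint (newt_flux v d S x0)|%:E <=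
   (e + T)%:E * 192%:E + (U / e)%:E * kernel_conv (gradsq v) (to_point x0) +
   ((3 / L)%:E * nnint (hardy_energy v) + T%:E * nnint (gradsq v)))%E.
Proof.
move=> e0 U0 T0 L0 d0 dS HU HT Lx0; have S0 : 0 < S by exact: lt_le_trans dS.
set c := to_point x0.
have Cf := Cc_newt_flux Cv x0 d0 dS.
have eT0 : 0 <= e + T by rewrite addr_ge0// ltW.
have Ue0 : 0 <= U / e by rewrite divr_ge0// ltW.
have L30 : 0 <= 3 / L by rewrite divr_ge0// ltW.
have cg : continuous (gradsq v) by exact: cont_gradsq.
have ch : continuous (hardy_energy v) by exact: cont_hardy_energy.
have mk : measurable_fun [set: point R] (cube_kernel c) by exact: measurable_cube_kernel2.
have mg := @measurable_vec3E R (gradsq v) cg.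
have mh := @measurable_vec3E R (hardy_energy v) ch.
have mgk : measurable_fun [set: point R]
    (fun z => (gradsq v (vec3 z))%:E * cube_kernel c z)%E by exact: emeasurable_funM.
have k0 z : (0 <= cube_kernel c z)%E by exact: cube_kernel_ge0.
have g0 z : (0 <= (gradsq v (vec3 z))%:E)%E by rewrite lee_fin gradsq_ge0.
have gk0 z : (0 <= (gradsq v (vec3 z))%:E * cube_kernel c z)%E by exact: mule_ge0.
have cs : continuous (fun x => 3 / L * hardy_energy v x + T * gradsq v x).
  by apply: cont_D; exact: cont_Z.
have s0 x : 0 <= 3 / L * hardy_energy v x + T * gradsq v x.
  by rewrite addr_ge0// mulr_ge0// ?hardy_energy_ge0// gradsq_ge0.
apply: (@le_trans _ _ (vint (fun x => `|newt_flux v d S x0 x|))%:E).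
  by rewrite lee_fin; exact: ler_norm_vint.
rewrite vint_nnint; last exact: Cc_abs.
have m1 : measurable_fun [set: point R] (fun z => (e + T)%:E * cube_kernel c z)%E.
  exact: measurable_funeM.
have m2 : measurable_fun [set: point R]
    (fun z => (U / e)%:E * ((gradsq v (vec3 z))%:E * cube_kernel c z))%E.
  exact: measurable_funeM.
apply: (@le_trans _ _ (\int[leb3]_z ((e + T)%:E * cube_kernel c z +
   (U / e)%:E * ((gradsq v (vec3 z))%:E * cube_kernel c z) +
   (3 / L * hardy_energy v (vec3 z) + T * gradsq v (vec3 z))%:E))%E).
  apply: ge0_le_integral => //.
  - exact: (@measurable_vec3E R (fun x => `|newt_flux v d S x0 x|) (Cc_abs Cf).1).
  - by apply: emeasurable_funD; [exact: emeasurable_funD|exact: (measurable_vec3E cs)].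
  - move=> z _; have := newt_flux_pointwise (vec3 z) e0 U0 T0 L0 d0 S0 HU HT Lx0.
    by rewrite to_point_vec3.
rewrite ge0_integralD; [|by []|..]; last 4 first.
- by move=> z _; apply: adde_ge0; apply: mule_ge0; rewrite ?lee_fin.
- exact: emeasurable_funD.
- by move=> z _; rewrite lee_fin.
- exact: (measurable_vec3E cs).
apply: leeD; last first.
  rewrite -/(nnint (fun x => 3 / L * hardy_energy v x + T * gradsq v x)).
  rewrite nnintD; [|exact: cont_Z|exact: cont_Z|..]; last 2 first.
  - by move=> x; rewrite mulr_ge0// hardy_energy_ge0.
  - by move=> x; rewrite mulr_ge0// gradsq_ge0.
  by rewrite !nnintZ//; move=> x; [exact: hardy_energy_ge0|exact: gradsq_ge0].
rewrite ge0_integralD; [|by []|..]; last 4 first.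
- by move=> z _; apply: mule_ge0; rewrite ?lee_fin.
- by [].
- by move=> z _; apply: mule_ge0; rewrite ?lee_fin.
- by [].
apply: leeD.
  rewrite ge0_integralZl_EFin; [|by []|by move=> z _; exact: k0|by []|by []].
  by apply: lee_wpmul2l; rewrite ?lee_fin//; exact: integral_cube_kernel.
by rewrite ge0_integralZl_EFin.
Qed.

Lemma budget4 (eps a e T D : R) : 0 < eps -> a <= eps / 4 -> e * 192 = eps / 4 ->
  T * (192 + D) = eps / 4 -> (e + T) * 192 + (a + T * D) <= eps.
Proof.
move=> eps0 ha he hT; have : T * 192 + T * D = eps / 4 by rewrite -mulrDr.
by rewrite mulrDl; move: (T * D) (T * 192) (e * 192) ha he => *; lra.
Qed.

Lemma newt_flux_far (eps : R) : 0 < eps -> exists L K : R, [/\ 0 < L, 0 <= K &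
  forall d S (x0 : 'rV[R]_3), 0 < d -> d <= S -> L ^+ 2 <= dist2 0 x0 ->
  (`|vint (newt_flux v d S x0)|%:E <=
   eps%:E + K%:E * kernel_conv (gradsq v) (to_point x0))%E].
Proof.
move=> eps0.
have [U U0 HU] := speed2_bounded Cv vv.
have nH0 : (0 <= nnint (hardy_energy v))%E by apply: nnint_ge0 => x; exact: hardy_energy_ge0.
have nG0 : (0 <= nnint (gradsq v))%E by apply: nnint_ge0 => x; exact: gradsq_ge0.
have nGoo := nnint_gradsq_lty Cv hH.
have HE : nnint (hardy_energy v) = (fine (nnint (hardy_energy v)))%:E.
  by rewrite fineK// ge0_fin_numE.
have GE : nnint (gradsq v) = (fine (nnint (gradsq v)))%:E.
  by rewrite fineK// ge0_fin_numE.
have H0 : 0 <= fine (nnint (hardy_energy v)) by exact: fine_ge0.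
have D0 : 0 <= fine (nnint (gradsq v)) by exact: fine_ge0.
move: HE GE H0 D0; set H := fine _; set D := fine _ => HE GE H0 D0.
(* 192 bounds the mass of [cube_kernel], and D is the Dirichlet integral. The choices of e, of T and
   of 12 H / eps inside L consume a quarter of eps each. *)
pose e := eps / 4 / 192; pose T := eps / (4 * (192 + D)).
have e0 : 0 < e by rewrite /e !divr_gt0 ?ltr0n.
have D1 : 0 < 192 + D by lra.
have T0 : 0 < T by rewrite divr_gt0// mulr_gt0.
have [M M0 HM] := speed2_small vv T0.
(* The part 1 + 4 M ensures L^2/4 >= M, beyond which the speed is at most T. *)
pose L := 1 + 4 * M + 12 * H / eps.
have Heps : 0 <= 12 * H / eps by rewrite divr_ge0 ?mulr_ge0// ltW.
have L1 : 1 + 4 * M <= L by rewrite lerDl.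
have L0 : 0 < L by apply: lt_le_trans L1; lra.
exists L, (U / e); split => //; first by rewrite divr_ge0// ltW.
move=> d S x0 d0 dS Lx0.
have LM : M <= L ^+ 2 / 4 by move: (L) L1 => l l1; nra.
have HT x : L ^+ 2 / 4 < dist2 0 x -> speed2 v x <= T ^+ 2.
  by move=> Lx; apply: HM; exact: le_lt_trans Lx.
apply: le_trans (vint_newt_flux_le e0 U0 (ltW T0) L0 d0 dS HU HT Lx0) _.
rewrite HE GE -!EFinM -!EFinD addeAC -EFinD; apply: leeD => //; rewrite lee_fin.
have TD : T * (192 + D) = eps / 4 by rewrite /T; field; rewrite gt_eqF.
have LH : 3 / L * H <= eps / 4.
  rewrite mulrAC ler_pdivrMr//.
  apply: (@le_trans _ _ (eps / 4 * (12 * H / eps))).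
    by rewrite le_eqVlt; apply/orP; left; apply/eqP; field; rewrite gt_eqF.
  apply: ler_wpM2l; first by rewrite divr_ge0// ltW.
  by rewrite lerDr; lra.
have eE : e * 192 = eps / 4 by rewrite /e; field.
exact: budget4 eps0 LH eE TD.
Qed.

End far_field_flux.

(** * The head pressure far from the origin *)

Section head_pressure_far.
Context {R : realType}.
Implicit Types (x : 'rV[R]_3).

Variable v : 'I_3 -> 'rV[R]_3 -> R.
Variable Q : 'rV[R]_3 -> R.
Hypothesis Cv : forall i k, Ck k (v i).
Hypothesis dv0 : solenoidal v.
Hypothesis CQ : forall k, Ck k Q.
Hypothesis vQ : head_eqn v Q.
Hypothesis hH : (nnint (hardy_energy v) < +oo)%E.
Hypothesis vv : forall i, vanishing (v i).

Lemma cont_norm (f : 'rV[R]_3 -> R) : continuous f -> continuous (fun x => `|f x|).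
Proof.
move=> cf x; apply: (cvg_comp f Num.norm (cf x)); exact: norm_continuous.
Qed.

Definition moll_mass : R := vint (mollifier (0 : 'rV[R]_3) 1).

Lemma moll_mass_gt0 : 0 < moll_mass.
Proof. exact: vint_mollifier_gt0. Qed.

Lemma vint_mollifierE (y : 'rV[R]_3) (r : R) : 0 < r -> vint (mollifier y r) = moll_mass.
Proof.
move=> r0; rewrite vint_mollifier_center// /moll_mass.
have [r1|/ltW r1] := leP r 1; first exact: vint_mollifier_scale.
by apply/esym/vint_mollifier_scale.
Qed.

(** The integrable part of the bound gains r^-3 from the height of the mollifier, while the constant
    part is only averaged; 14 exceeds the constant 105/8 of [mollifier_le_cst]. *)
Lemma vint_growth_mollifier (F : 'rV[R]_3 -> R) (a b r : R) (y : 'rV[R]_3) :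
  continuous F -> (forall x, `|F x| <= a + b * gradsq v x) -> 0 <= b -> 1 <= r ->
  vint (fun x => `|F x| * mollifier y r x) <=
  a * moll_mass + b * (14 * r ^- 3 * fine (nnint (gradsq v))).
Proof.
move=> cF Fab b0 r1; have r0 : 0 < r by lra.
have cg : continuous (gradsq v) by exact: cont_gradsq.
have Cm := Cc_mollifier y r0; have m0 x := mollifier_ge0 y x (ltW r0).
have Cgm : Cc (fun x => gradsq v x * mollifier y r x) by exact: CcMl.
have CF : Cc (fun x => `|F x| * mollifier y r x).
  have := Cc_abs (CcMl cF Cm); apply: eq_Cc => x.
  by rewrite normrM (ger0_norm (m0 x)).
apply: (@le_trans _ _ (vint (fun x => a * mollifier y r x +
    b * (gradsq v x * mollifier y r x)))).
  apply: le_vint => [//||x]; first by apply: CcD; exact: CcZ.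
  by rewrite mulrA -mulrDl; apply: ler_wpM2r.
rewrite vintD; [|exact: CcZ|exact: CcZ].
rewrite (vintZ a Cm) (vintZ b Cgm) vint_mollifierE//.
rewrite lerD2l; apply: ler_wpM2l => //.
have Gfin : nnint (gradsq v) = (fine (nnint (gradsq v)))%:E.
  rewrite fineK// ge0_fin_numE; first exact: nnint_gradsq_lty.
  by apply: nnint_ge0 => x; exact: gradsq_ge0.
have r30 : 0 <= 14 * r ^- 3 by rewrite mulr_ge0// invr_ge0 exprn_ge0// ltW.
rewrite -lee_fin vint_nnint// EFinM -Gfin -nnintZ//; last exact: gradsq_ge0.
apply: le_nnint => [||x|x]; [exact: Cgm.1|exact: cont_Z| |].
  by rewrite mulr_ge0// gradsq_ge0.
rewrite mulrC; apply: ler_wpM2r; first exact: gradsq_ge0.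
apply: le_trans (mollifier_le_cst y x r0) _; rewrite mulrC; apply: ler_wpM2r.
  by rewrite invr_ge0 exprn_ge0// ltW.
by lra.
Qed.

Lemma inv_cube_le1 (r : R) : 1 <= r -> r ^- 3 <= 1.
Proof.
by move=> r1; rewrite invf_le1 ?exprn_gt0 ?exprn_ege1//; exact: lt_le_trans r1.
Qed.

Lemma partial_le_grad2 i j x : `|partial j (v i) x| <= 1 + 1 * gradsq v x.
Proof.
rewrite mul1r; apply: (@le_trans _ _ (1 + partial j (v i) x ^+ 2)).
  rewrite -[_ ^+ 2]real_normK ?num_real//; move: `|_| => a.
  by rewrite -subr_ge0 (_ : _ - _ = (a - 2^-1) ^+ 2 + 3 / 4) ?addr_ge0 ?sqr_ge0//; field.
rewrite lerD2l /gradsq (bigD1 i)//= /grad2 (bigD1 j)//= -addrA lerDl addr_ge0//.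
  by apply: sumr_ge0 => k _; exact: sqr_ge0.
by apply: sumr_ge0 => k _; exact: grad2_ge0.
Qed.

(** One derivative is moved onto the mollifier, gaining 64/r in each of the three directions. *)
Lemma vint_lap_mollifier_le i (y : 'rV[R]_3) (r : R) : 1 <= r ->
  `|vint (fun x => lap (v i) x * mollifier y r x)| <=
  192 * (moll_mass + 14 * fine (nnint (gradsq v))) / r.
Proof.
move=> r1; have r0 : 0 < r by lra.
have r20 : 0 < 2 * r by lra.
set B := _ + _.
have G0 : 0 <= fine (nnint (gradsq v)).
  by apply: fine_ge0; apply: nnint_ge0 => x; exact: gradsq_ge0.
have Cp j : Ck 1 (partial j (v i)) by apply: Ck_partial; exact: Cv.
have bm := bsupp_mollifier y r0; have Cm := Ck_mollifier y r.
have cm j : Cc (partial j (mollifier y r)).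
  by split; [exact: Ck_continuous (Ck_partial j Cm)|exact: bsupp_partial].
have Cpp j : Cc (fun x => partial j (partial j (v i)) x * mollifier y r x).
  apply: CcMl; last exact: Cc_mollifier.
  exact: (Ck_continuous (Ck_partial j (Cp j))).
rewrite (@eq_vint _ _ (fun x => \sum_(j < 3)
    partial j (partial j (v i)) x * mollifier y r x)); last first.
  by move=> x; rewrite -mulr_suml.
rewrite vint_sum//; apply: le_trans (ler_norm_sum _ _ _) _.
have H j : `|vint (fun x => partial j (partial j (v i)) x * mollifier y r x)| <= 64 / r * B.
  rewrite vint_IBP'// normrN.
  have CM : Cc (fun x => partial j (v i) x * partial j (mollifier y r) x).
    exact: (CcMl (Ck_continuous (Cp j)) (cm j)).
  have Cabs : continuous (fun x => `|partial j (v i) x|).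
    exact: cont_norm (Ck_continuous (Cp j)).
  apply: le_trans (ler_norm_vint CM) _.
  apply: (@le_trans _ _ (vint (fun x => 64 / r * (`|partial j (v i) x| * mollifier y (2 * r) x)))).
    apply: le_vint; first exact: Cc_abs.
      by apply: CcZ; apply: CcMl => //; exact: Cc_mollifier.
    move=> x; rewrite normrM mulrCA; apply: ler_wpM2l => //.
    exact: partial_mollifier_le.
  rewrite vintZ; last by apply: CcMl => //; exact: Cc_mollifier.
  apply: ler_wpM2l; first by rewrite divr_ge0// ltW.
  have r21 : 1 <= 2 * r by lra.
  apply: le_trans (vint_growth_mollifier y (Ck_continuous (Cp j))
    (partial_le_grad2 i j) ler01 r21) _.
  rewrite !mul1r lerD2l -mulrA; apply: ler_wpM2l => //.
  by apply: ler_piMl => //; exact: inv_cube_le1.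
apply: le_trans (ler_sum _ (fun j _ => H j)) _.
rewrite sum3E le_eqVlt; apply/orP; left; apply/eqP; move: (B) => b.
by field; rewrite gt_eqF.
Qed.

Lemma vort_cross_le_norm i x : `|vort_cross v i x| <= vort_cross_norm v x.
Proof.
rewrite -sqrtr_sqr ler_wsqrtr// (bigD1 i)//= lerDl.
by apply: sumr_ge0 => j _; exact: sqr_ge0.
Qed.

(** By [mean_center_le], means of Q around any two fixed centres then have the same limit at large
    scales. *)
Lemma partial_head_mollifier_le : exists2 C : R, 0 <= C &
  forall (r : R), 1 <= r -> forall i y,
    `|vint (fun x => partial i Q x * mollifier y r x)| <= C / r.
Proof.
have [U U0 HU] := speed2_bounded Cv vv.
set D := fine (nnint (gradsq v)).
have D0 : 0 <= D by apply: fine_ge0; apply: nnint_ge0 => x; exact: gradsq_ge0.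
have c0 := moll_mass_gt0.
pose A := 192 * (moll_mass + 14 * D); pose B := moll_mass + U * (14 * D).
have A0 : 0 <= A by rewrite !(mulr_ge0, addr_ge0)// ltW.
have B0 : 0 <= B by rewrite !(mulr_ge0, addr_ge0)// ltW.
exists (A + B) => [|r r1 i y]; first exact: addr_ge0.
have r0 : 0 < r by lra.
have Cm := Cc_mollifier y r0; have m0 x := mollifier_ge0 y x (ltW r0).
have cl : continuous (lap (v i)) by exact: (Ck_continuous (Ck_lap Cv i 0)).
have cB : continuous (vort_cross v i) by exact: (Ck_continuous (Ck_vort_cross Cv i 0)).
rewrite (@eq_vint _ _ (fun x => lap (v i) x * mollifier y r x -
    vort_cross v i x * mollifier y r x)); last by move=> x; rewrite vQ mulrBl.
have C1 : Cc (fun x => lap (v i) x * mollifier y r x) by exact: CcMl.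
have C2 : Cc (fun x => vort_cross v i x * mollifier y r x) by exact: CcMl.
rewrite vintB//; apply: le_trans (ler_normB _ _) _; rewrite mulrDl; apply: lerD.
  exact: vint_lap_mollifier_le.
apply: le_trans (ler_norm_vint C2) _.
rewrite (@eq_vint _ _ (fun x => `|vort_cross v i x| * mollifier y r x)); last first.
  by move=> x; rewrite normrM (ger0_norm (m0 x)).
have ri0 : 0 < r^-1 by rewrite invr_gt0.
(* [near_bound] with e = 1/r: the factor U r created in front of |grad v|^2 is outweighed by the
   r^-3 of the mollifier. *)
have bnd x : `|vort_cross v i x| <= r^-1 + U / r^-1 * gradsq v x.
  apply: le_trans (vort_cross_le_norm i x) _; apply: near_bound => //.
    exact: gradsq_ge0.
  apply: le_trans (vort_cross_norm_sqr v x) _; apply: ler_wpM2l => //.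
  by apply: ler_wpM2r; [exact: gradsq_ge0|exact: HU].
have Ur0 : 0 <= U / r^-1 by rewrite divr_ge0// ltW.
apply: le_trans (vint_growth_mollifier y cB bnd Ur0 r1) _.
rewrite -/D /B [leRHS]mulrDl [r^-1 * _]mulrC lerD2l invrK.
rewrite (_ : U * r * _ = U * (14 * D) / r * r^-1); last by field; rewrite gt_eqF.
apply: ler_piMr; last by rewrite invf_le1.
by rewrite divr_ge0 ?mulr_ge0// ltW.
Qed.

Lemma mean_center_cvg0 (y : 'rV[R]_3) :
  mean Q n.+1%:R y - mean Q n.+1%:R 0 @[n --> \oo] --> (0 : R).
Proof.
have [C C0 HC] := partial_head_mollifier_le.
set A := \sum_(i < 3) `|y 0 i|.
apply: (@squeeze_cvgr _ _ _ _ (fun n : nat => - (C * A * n.+1%:R^-1))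
  (fun n : nat => C * A * n.+1%:R^-1)).
- apply: nearW => n; rewrite -ler_norml -mulrAC.
  have r1 : 1 <= n.+1%:R :> R by rewrite ler1n.
  have r0 : 0 < n.+1%:R :> R by rewrite ltr0n.
  exact: (mean_center_le y r0 (CQ 1) (HC _ r1)).
- rewrite -oppr0; apply: cvgN; rewrite -(mulr0 (C * A)).
  by apply: cvgMr; exact: cvg_harmonic.
- rewrite -[X in _ --> X](mulr0 (C * A)).
  by apply: cvgMr; exact: cvg_harmonic.
Qed.

Section limit.
Variable l : R.
Hypothesis Ql : forall n, n.+1%:R * `|mean Q n.+1%:R 0 - l| <= flux_tail v n.

Lemma mean0_cvg : mean Q n.+1%:R 0 @[n --> \oo] --> l.
Proof.
apply/subr_cvg0; apply/norm_cvg0P.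
apply: (@squeeze_cvgr _ _ _ _ (fun=> 0) (flux_tail v)).
- apply: nearW => n; rewrite normr_ge0/=; apply: le_trans (Ql n).
  by apply: ler_peMl => //; rewrite ler1n.
- exact: cvg_cst.
- exact: flux_tail_cvg0.
Qed.

(** The scales d = 1/(n+1) and S = n+1 are sent to their limits together: the small mean tends to
    [moll_mass * Q y], the large one to [l]. *)
Lemma head_le_flux (y : 'rV[R]_3) (B : R) :
  (forall d S : R, 0 < d -> d <= S -> `|vint (newt_flux v d S y)| <= B) ->
  `|moll_mass * Q y - l| <= B.
Proof.
move=> HB.
have c1 : mean Q n.+1%:R y @[n --> \oo] --> l.
  rewrite (_ : (fun n => _) = (fun n : nat => (mean Q n.+1%:R y - mean Q n.+1%:R 0) +
    mean Q n.+1%:R 0)); last by apply/funext => n; rewrite subrK.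
  by rewrite -[l]add0r; apply: cvgD; [exact: mean_center_cvg0|exact: mean0_cvg].
have c2 : mean Q n.+1%:R^-1 y @[n --> \oo] --> moll_mass * Q y.
  rewrite mulrC -(vint_mollifierE y ltr01); apply: mean_small.
  exact: (Ck_continuous (CQ 0)).
have c3 : `|mean Q n.+1%:R^-1 y - mean Q n.+1%:R y| @[n --> \oo] -->
    `|moll_mass * Q y - l| by apply: cvg_norm; exact: cvgB.
rewrite -(cvg_lim _ c3)//; apply: limr_le; first by apply/cvg_ex; eexists; exact: c3.
apply: nearW => n /=.
have i0 : 0 < n.+1%:R^-1 :> R by rewrite invr_gt0 ltr0n.
have i1 : n.+1%:R^-1 <= n.+1%:R :> R.
  apply: (@le_trans _ _ 1); last by rewrite ler1n.
  by rewrite invf_le1 ?ltr0n// ler1n.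
by rewrite (mean_diff Cv dv0 CQ vQ)//; exact: HB.
Qed.

Lemma head_far (eps : R) : 0 < eps -> exists L K : R, [/\ 0 < L, 0 <= K &
  forall y : 'rV[R]_3, L ^+ 2 <= dist2 0 y ->
  (`|moll_mass * Q y - l|%:E <=
   eps%:E + K%:E * kernel_conv (gradsq v) (to_point y))%E].
Proof.
move=> /(newt_flux_far Cv hH vv)[L [K [L0 K0 H]]]; exists L, K; split=> // y Ly.
(* If the convolution is infinite at y the claim is void; the value -oo is excluded by the bound for
   d = S = 1. *)
move: H => /(_ _ _ y _ _ Ly); case: (_ + _)%E => [b| |] H; last 2 first.
- by rewrite leey.
- by have := H 1 1 ltr01 (lexx _).
- by rewrite lee_fin; apply: head_le_flux => d S d0 dS; rewrite -lee_fin; exact: H.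
Qed.

End limit.
End head_pressure_far.

(** * The maximum principle *)

Section convex_profile.
Context {R : realType}.
Implicit Types (s t : R).

(* A convex C^2 profile vanishing exactly on the nonpositive reals and of at
   most linear growth. *)
Definition growth s : R := ramp s ^+ 3 * (1 + ramp s) ^- 2.
Definition growth' s : R := (ramp s ^+ 3 + 3 * ramp s ^+ 2) * (1 + ramp s) ^- 3.
Definition growth'' s : R := 6 * ramp s * (1 + ramp s) ^- 4.

Lemma is_derive_expr_quot n m s : 0 <= s ->
  is_derive s 1 (fun s => s ^+ n * (1 + s) ^- m)
    (n%:R * s ^+ n.-1 * (1 + s) ^- m - m%:R * s ^+ n * (1 + s) ^- m.+1).
Proof.
move=> s0; have p0 : 0 < 1 + s by lra.
have d1 : is_derive s 1 (fun s => 1 + s) (0 + 1).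
  exact: (is_deriveD (is_derive_cst (1 : R) s (1 : R)) (is_derive_id s (1 : R))).
have d2 := @is_derive1_comp R (fun s => s ^+ m) (fun s => 1 + s) s _ _
  (is_derive_expr m _) d1.
have pm : (fun s => (1 + s) ^+ m) s != 0 by rewrite expf_neq0// gt_eqF.
have d3 := @is_deriveV R (fun s => (1 + s) ^+ m) s _ 1 pm d2.
apply: (is_derive_eq (is_deriveM (is_derive_expr n s) d3)); rewrite /GRing.scale/=.
rewrite add0r mulr1; case: m {d2 d3 pm} => [|m] /=.
  by rewrite !mul0r mulr0 !expr0; ring.
rewrite !exprS; move: (s ^+ n) (s ^+ n.-1) => a b.
have : (1 + s) ^+ m != 0 by rewrite expf_neq0// gt_eqF.
by move: ((1 + s) ^+ m) => w w0; field; rewrite w0 gt_eqF.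
Qed.

Lemma glue_rampE (F : R -> R) s : F 0 = 0 -> F (ramp s) = glue 0 (fun=> 0) F s.
Proof. by move=> F0; rewrite /glue /ramp; case: (ltP s 0) => //; rewrite F0. Qed.

Lemma is_derive_ramp_comp (F dF : R -> R) s : F 0 = 0 -> dF 0 = 0 ->
  (forall t, 0 <= t -> is_derive t 1 F (dF t)) ->
  is_derive s 1 (fun s => F (ramp s)) (dF (ramp s)).
Proof.
move=> F0 dF0 HF.
rewrite (_ : (fun s => F (ramp s)) = glue 0 (fun=> 0) F); last first.
  by apply/funext => t; exact: glue_rampE.
rewrite glue_rampE//; apply: is_derive_glue; rewrite ?F0 ?dF0//.
Qed.

Lemma is_derive_growth s : is_derive s 1 growth (growth' s).
Proof.
apply: (@is_derive_ramp_comp (fun s => s ^+ 3 * (1 + s) ^- 2)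
  (fun s => (s ^+ 3 + 3 * s ^+ 2) * (1 + s) ^- 3)).
- by rewrite expr0n mul0r.
- by rewrite !expr0n mulr0 addr0 mul0r.
move=> t t0; apply: (is_derive_eq (is_derive_expr_quot 3 2 t0)).
by rewrite /=; field; rewrite gt_eqF//; lra.
Qed.

Lemma is_derive_growth' s : is_derive s 1 growth' (growth'' s).
Proof.
apply: (@is_derive_ramp_comp (fun s => (s ^+ 3 + 3 * s ^+ 2) * (1 + s) ^- 3)
  (fun s => 6 * s * (1 + s) ^- 4)).
- by rewrite !expr0n mulr0 addr0 mul0r.
- by rewrite mulr0 mul0r.
move=> t t0.
have d := is_deriveD (is_derive_expr_quot 3 3 t0)
  (is_deriveZ 3 (is_derive_expr_quot 2 3 t0)).
rewrite (_ : (fun s => _) = (fun s => s ^+ 3 * (1 + s) ^- 3) +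
    3 *: (fun s => s ^+ 2 * (1 + s) ^- 3)); last first.
  by apply/funext => r; rewrite mulrDl -mulrA.
apply: (is_derive_eq d); rewrite /GRing.scale/=.
by field; rewrite gt_eqF//; lra.
Qed.

Lemma continuous_growth'' : continuous growth''.
Proof.
move=> s; have cr := @continuous_ramp R s.
apply: (@continuousM _ _ (fun s => 6 * ramp s) (fun s => (1 + ramp s) ^- 4) s).
  by apply: (@continuousM _ _ (fun=> 6) ramp s) => //; exact: cst_continuous.
apply: (@continuousV _ _ (fun s => (1 + ramp s) ^+ 4) s).
  by rewrite expf_neq0// gt_eqF//; have := ramp_ge0 s; lra.
apply: (@continuous_comp _ _ _ (fun s => 1 + ramp s) (fun t => t ^+ 4)).
  by apply: (@continuousD R R R (fun=> 1) ramp s) => //; exact: cst_continuous.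
exact: exprn_continuous.
Qed.

Lemma Dk_growth : Dk 2 growth.
Proof.
apply: (Dk_is_derive is_derive_growth); apply: (Dk_is_derive is_derive_growth').
by split => //; exact: continuous_growth''.
Qed.

Lemma derive1_growth : derive1 growth = growth'.
Proof.
by apply/funext => s; rewrite derive1E (@derive_val _ _ _ _ _ _ _ (is_derive_growth s)).
Qed.

Lemma derive1_growth' : derive1 growth' = growth''.
Proof.
by apply/funext => s; rewrite derive1E (@derive_val _ _ _ _ _ _ _ (is_derive_growth' s)).
Qed.

Lemma ramp1_gt0 s : 0 < 1 + ramp s.
Proof. by have := ramp_ge0 s; lra. Qed.

Lemma growth_ge0 s : 0 <= growth s.
Proof. by rewrite mulr_ge0 ?invr_ge0 ?exprn_ge0 ?ramp_ge0// ltW// ramp1_gt0. Qed.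

Lemma growth'_ge0 s : 0 <= growth' s.
Proof.
have r0 := ramp_ge0 s; apply: mulr_ge0.
  by rewrite addr_ge0 ?mulr_ge0 ?exprn_ge0.
by rewrite invr_ge0 exprn_ge0// ltW// ramp1_gt0.
Qed.

Lemma growth''_ge0 s : 0 <= growth'' s.
Proof.
apply: mulr_ge0; first by rewrite mulr_ge0 ?ramp_ge0.
by rewrite invr_ge0 exprn_ge0// ltW// ramp1_gt0.
Qed.

Lemma growth_le s : growth s <= ramp s.
Proof.
rewrite /growth ler_pdivrMr ?exprn_gt0 ?ramp1_gt0//.
have := ramp_ge0 s; move: (ramp s) => t t0.
by rewrite -subr_ge0 (_ : _ - _ = t + 2 * t ^+ 2) ?addr_ge0 ?mulr_ge0 ?exprn_ge0//; ring.
Qed.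

Lemma growth_gt0 s : 0 < s -> 0 < growth s.
Proof.
move=> s0; have r0 : 0 < ramp s by rewrite /ramp lt_max s0.
by rewrite mulr_gt0 ?invr_gt0 ?exprn_gt0// ramp1_gt0.
Qed.

(** Both derivatives vanish exactly where the positive part does. Hence [growth''] times |grad P|^2
    being 0 forces the gradient of [growth] of P to vanish. *)
Lemma growth''_eq0 s : growth'' s = 0 -> growth' s = 0.
Proof.
move/eqP; rewrite !mulf_eq0 invr_eq0 expf_eq0/= (gt_eqF (ramp1_gt0 s)) orbF.
rewrite pnatr_eq0/= => /eqP r0.
by rewrite /growth' r0 !expr0n mulr0 addr0 mul0r.
Qed.

End convex_profile.

(** * Cutoff functions *)

Section cutoff.
Context {R : realType}.
Local Notation e_ j := (delta_mx 0 j : 'rV[R]_3).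
Implicit Types (x : 'rV[R]_3) (r s t : R).

Definition cutoff r x : R := bump 3 (r ^- 2 * dist2 0 x).

Definition cutoff_slope r s : R := - 6 * r ^- 2 * bump 2 (r ^- 2 * s).

Lemma is_derive_bump_scaled n r s : is_derive s 1 (fun s => bump n.+2 (r ^- 2 * s))
  (- n.+2%:R * bump n.+1 (r ^- 2 * s) * r ^- 2).
Proof.
have := @is_derive_affine R (bump n.+2) (r ^- 2) 0 s _ (is_derive_bump n _).
rewrite add0r (_ : (fun t => bump n.+2 (0 + r ^- 2 * t)) =
  (fun t => bump n.+2 (r ^- 2 * t)))//.
by apply/funext => t; rewrite add0r.
Qed.

Lemma Ck_cutoff r : Ck 2 (cutoff r).
Proof.
apply: (@Ck_comp R 2 (dist2 0) (fun s => bump 3 (r ^- 2 * s))); last exact: Ck_dist2.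
by apply: Dk_dilate; exact: Dk_bump2.
Qed.

Lemma bsupp_cutoff r : 0 < r -> bsupp (cutoff r).
Proof. exact: bsupp_bump. Qed.

Lemma Cc_cutoff r : 0 < r -> Cc (cutoff r).
Proof. by move=> r0; split; [exact: Ck_continuous (Ck_cutoff r)|exact: bsupp_cutoff]. Qed.

Lemma Dk_cutoff_slope r : Dk 1 (cutoff_slope r).
Proof. by apply: Dk_scale; apply: Dk_dilate; exact: Dk_bump1. Qed.

Lemma partial_cutoff j r : partial j (cutoff r) = radial_field (cutoff_slope r) 0 j.
Proof.
have Db : Dk 1 (fun s : R => bump 3 (r ^- 2 * s)) by apply: Dk_dilate; exact: Dk_bump1.
rewrite (partial_radial Db); apply/funext => x.
rewrite derive1E (@derive_val _ _ _ _ _ _ _ (is_derive_bump_scaled 1 r _)).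
rewrite /radial_field /cutoff_slope; move: (r ^- 2) (x 0 j - _) (bump _ _) => a c b; ring.
Qed.

(** Arranged so that the first term is nonnegative and the second is a multiple of the profile of
    [mollifier]. *)
Lemma lap_cutoff r x : lap (cutoff r) x =
  24 * r ^- 2 * (r ^- 2 * dist2 0 x * bump 1 (r ^- 2 * dist2 0 x)) -
  18 * r ^- 2 * bump 2 (r ^- 2 * dist2 0 x).
Proof.
rewrite /lap (eq_bigr (fun i => partial i (radial_field (cutoff_slope r) 0 i) x)); last first.
  by move=> i _; rewrite partial_cutoff.
rewrite (div_radial_field (Dk_cutoff_slope r)).
have d := is_deriveZ (- 6 * r ^- 2) (is_derive_bump_scaled 0 r (dist2 0 x)).
rewrite derive1E (_ : cutoff_slope r = (- 6 * r ^- 2) *: (fun s => bump 2 (r ^- 2 * s)))//.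
rewrite (@derive_val _ _ _ _ _ _ _ d) -[_ *: (_ : R)]/(_ * _).
rewrite -[((- 6 * r ^- 2) *: (fun s : R => bump 2 (r ^- 2 * s))) _]/(- 6 * r ^- 2 * bump 2 (r ^- 2 * dist2 0 x)).
move: (r ^- 2) (dist2 0 x) (bump 2 _) (bump 1 _) => a c b2 b1; ring.
Qed.

Lemma cutoff_ge0 r x : 0 <= cutoff r x. Proof. exact: bump_ge0. Qed.

Lemma scaled_dist2_ge0 r x : 0 <= r ^- 2 * dist2 0 x.
Proof. by rewrite mulr_ge0 ?dist2_ge0// invr_ge0 sqr_ge0. Qed.

Lemma cutoff_mono r s x : 0 < r -> r <= s -> cutoff r x <= cutoff s x.
Proof.
move=> r0 rs; have s0 : 0 < s by exact: lt_le_trans rs.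
rewrite /cutoff /bump lerXn2r ?nnegrE ?ramp_ge0//; apply: ramp_le.
rewrite lerD2l lerN2; apply: ler_wpM2r; first exact: dist2_ge0.
by rewrite lef_pV2 ?posrE ?exprn_gt0// lerXn2r ?nnegrE// ltW.
Qed.

Lemma cutoff_eventually_gt0 x : exists n : nat, 0 < cutoff n.+1%:R x.
Proof.
exists (Num.trunc (dist2 0 x)); set n := Num.trunc _.
have n1 : 1 <= n.+1%:R :> R by rewrite ler1n.
have dn : dist2 0 x < n.+1%:R by exact: truncnS_gt.
rewrite /cutoff /bump exprn_gt0// /ramp lt_max subr_gt0.
rewrite mulrC ltr_pdivrMr ?mul1r ?exprn_gt0//.
by rewrite (lt_le_trans dn)// expr2 ler_peMr// (le_trans ler01).
Qed.

Lemma partial_cutoff_le j r x : 0 < r -> `|partial j (cutoff r) x| <= 6 / r.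
Proof.
move=> r0; rewrite partial_cutoff /radial_field /cutoff_slope.
have r60 : 0 <= 6 / r by rewrite divr_ge0// ltW.
have r20 : 0 < r ^+ 2 by rewrite exprn_gt0.
have [s1|s1] := leP 1 (r ^- 2 * dist2 0 x).
  by rewrite bump_out// !mulr0 normr0.
have xr : `|x 0 j - (0 : 'rV[R]_3) 0 j| <= r.
  apply: abs_le_of_sqr; first exact: ltW.
  apply: le_trans (coord_dist2 0 x j) _; apply: ltW.
  by move: s1; rewrite mulrC ltr_pdivrMr// mul1r.
rewrite normrM (_ : 6 / r = r * (6 * r ^- 2)); last by field; rewrite gt_eqF.
apply: ler_pM => //; rewrite normrM (ger0_norm (bump_ge0 _ _)).
rewrite mulNr normrN ger0_norm; last by rewrite mulr_ge0// invr_ge0 ltW.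
apply: ler_piMr; first by rewrite mulr_ge0// invr_ge0 ltW.
by apply: bump_le1; exact: scaled_dist2_ge0.
Qed.

Lemma lap_cutoff_out r x : 1 <= r ^- 2 * dist2 0 x -> lap (cutoff r) x = 0.
Proof. by move=> s1; rewrite lap_cutoff !bump_out// !mulr0 subrr. Qed.

Lemma lap_cutoff_le r x : `|lap (cutoff r) x| <= 42 * r ^- 2.
Proof.
have i0 : 0 <= r ^- 2 by rewrite invr_ge0 sqr_ge0.
have [s1|/ltW s1] := leP 1 (r ^- 2 * dist2 0 x).
  by rewrite lap_cutoff_out// normr0 mulr_ge0.
rewrite lap_cutoff; have s0 := scaled_dist2_ge0 r x.
move: (r ^- 2 * dist2 0 x) s0 s1 => s s0 s1.
have [b10 b11] : 0 <= bump 1 s /\ bump 1 s <= 1 by rewrite bump_ge0 bump_le1.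
have [b20 b21] : 0 <= bump 2 s /\ bump 2 s <= 1 by rewrite bump_ge0 bump_le1.
apply: le_trans (ler_normB _ _) _.
rewrite (_ : 42 * r ^- 2 = 24 * r ^- 2 + 18 * r ^- 2); last by rewrite -mulrDl -natrD.
have i24 : 0 <= 24 * r ^- 2 by rewrite mulr_ge0.
have i18 : 0 <= 18 * r ^- 2 by rewrite mulr_ge0.
apply: lerD; rewrite normrM (ger0_norm i24, ger0_norm i18); apply: ler_piMr => //.
  by rewrite ger0_norm ?mulr_ge0// mulr_ile1.
by rewrite ger0_norm.
Qed.

Lemma cst_of_partial0 f : Ck 1 f -> (forall j x, partial j f x = 0) ->
  forall x, f x = f 0.
Proof.
move=> Cf f0.
have line (y : 'rV[R]_3) j t : f (y + t *: e_ j) = f y.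
  rewrite -[in RHS](addr0 y) -(scale0r (e_ j)).
  apply: (is_derive_0_is_cst (f := fun t => f (y + t *: e_ j))) => s.
  have := @is_derive_line R _ _ f y (e_ j) s (@Ck_derivable R 0 f j _ Cf).
  by rewrite -/(partial j f (y + s *: e_ j)) f0.
move=> x; rewrite -(to_pointK x) /to_point vec3_line0 line vec3_line1 line vec3_line2 line.
congr f; apply/rowP; apply: ord3P; rewrite !vec3E mxE//.
Qed.

Lemma cst_nnint0 (a : R) : 0 <= a -> (nnint (fun=> a : R) < +oo)%E -> a = 0.
Proof.
move=> a0 aoo; apply/eqP; rewrite eq_le a0 andbT leNgt; apply/negP => apos.
have nn0 : (0 <= nnint (fun=> a))%E by apply: nnint_ge0 => x.
have nnE : nnint (fun=> a) = (fine (nnint (fun=> a)))%:E.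
  by rewrite fineK// ge0_fin_numE.
set A := fine _ in nnE.
have A0 : 0 <= A by exact: fine_ge0.
(* Then a r = a + A already exceeds A, and the cube of half-side r has volume at least r. *)
pose r := 1 + A / a.
have r1 : 1 <= r by rewrite lerDl divr_ge0.
have r0 : 0 <= r by exact: le_trans r1.
have : ((a * (2 * r) ^+ 3)%:E <= A%:E)%E.
  rewrite -nnE -(@integral_cst_cube R (0, 0, 0) r a r0); apply: ge0_subset_integral => //.
  exact: measurable_cube.
rewrite lee_fin; apply/negP; rewrite -ltNge.
have aA : a * r = a + A by rewrite /r; field; rewrite gt_eqF.
have : a * r <= a * (2 * r) ^+ 3.
  apply: ler_wpM2l => //; apply: (@le_trans _ _ (2 * r)).
    by rewrite ler_peMl// ler1n.
  by apply: ler_eXnr => //; rewrite mulr_ege1// ler1n.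
by rewrite aA; apply: lt_le_trans; rewrite ltrDr.
Qed.

(** The cutoffs increase with n, so a positive value of [e] at one point keeps these integrals above
    a fixed positive number from some n on. *)
Lemma eq0_of_cutoff (e : 'rV[R]_3 -> R) (b : nat -> R) :
  continuous e -> (forall x, 0 <= e x) -> b n @[n --> \oo] --> (0 : R) ->
  (forall n, vint (fun x => e x * cutoff n.+1%:R x) <= b n) -> forall x, e x = 0.
Proof.
move=> ce e0 b0 eb x; have [N N0] := cutoff_eventually_gt0 x.
apply/eqP; rewrite eq_le e0 andbT leNgt; apply/negP => ex.
have Ce n : Cc (fun y => e y * cutoff n.+1%:R y).
  by apply: CcMl => //; apply: Cc_cutoff; rewrite ltr0n.
have : 0 < vint (fun y => e y * cutoff N.+1%:R y).
  apply: (@vint_gt0 _ _ x); [exact: Ce| |exact: mulr_gt0].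
  by move=> y; rewrite mulr_ge0 ?cutoff_ge0.
apply/negP; rewrite -leNgt -(cvg_lim _ b0)//.
apply: limr_ge; first by apply/cvg_ex; eexists; exact: b0.
near=> n; apply: le_trans (eb n); apply: le_vint => // y.
apply: ler_wpM2l => //; apply: cutoff_mono; first by rewrite ltr0n.
by rewrite ler_nat ltnS; near: n; exact: nbhs_infty_ge.
Unshelve. all: by end_near. Qed.

End cutoff.

(** * The maximum principle under integrability *)

Section maximum_principle.
Context {R : realType}.
Implicit Types (x : 'rV[R]_3) (r s t : R) (f phi : 'rV[R]_3 -> R).

Variable v : 'I_3 -> 'rV[R]_3 -> R.
Hypothesis Cv : forall i k, Ck k (v i).
Hypothesis dv0 : solenoidal v.
Hypothesis vv : forall i, vanishing (v i).

Definition drift (f : 'rV[R]_3 -> R) x : R := \sum_(i < 3) v i x * partial i f x.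

Lemma cont_drift f : Ck 1 f -> continuous (drift f).
Proof.
move=> Cf; apply: cont_sum3 => i; apply: cont_M; first exact: (Ck_continuous (Cv i 0)).
exact: (Ck_continuous (Ck_partial i Cf)).
Qed.

Lemma cont_lap f : Ck 2 f -> continuous (lap f).
Proof.
by move=> Cf; apply: cont_sum3 => i; exact: (Ck_continuous (Ck_partial i (Ck_partial i Cf))).
Qed.

Lemma vint_lap_drift f phi : Ck 2 f -> Ck 2 phi -> bsupp phi ->
  vint (fun x => (lap f x - drift f x) * phi x) =
  vint (fun x => f x * (lap phi x + drift phi x)).
Proof.
move=> Cf Cphi bphi.
have Cc_phi : Cc phi by split; [exact: (Ck_continuous Cphi)|].
have cf := Ck_continuous Cf.
have Cc_lap : Cc (lap phi).
  by apply: Cc_sum => i; split; [exact: (Ck_continuous (Ck_partial i (Ck_partial i Cphi)))|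
    do 2 apply: bsupp_partial].
have Cc_drift : Cc (drift phi).
  apply: Cc_sum => i; apply: CcMl; first exact: (Ck_continuous (Cv i 0)).
  by split; [exact: (Ck_continuous (Ck_partial i Cphi))|exact: bsupp_partial].
have C1 : Cc (fun x => lap f x * phi x) by apply: CcMl => //; exact: cont_lap.
have C2 : Cc (fun x => drift f x * phi x) by apply: CcMl => //; exact: (cont_drift (CkW Cf)).
have C3 : Cc (fun x => f x * lap phi x) by exact: CcMl.
have C4 : Cc (fun x => f x * drift phi x) by exact: CcMl.
rewrite (@eq_vint _ _ (fun x => lap f x * phi x - drift f x * phi x)); last first.
  by move=> x; rewrite mulrBl.
rewrite vintB// vint_lap// (vint_advection (fun i => Cv i 1) dv0 (CkW Cf) (CkW Cphi) bphi).
rewrite opprK [RHS](@eq_vint _ _ (fun x => f x * lap phi x + f x * drift phi x)); last first.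
  by move=> x; rewrite mulrDr.
by rewrite vintD.
Qed.

Lemma Cc_cutoff_test r : 0 < r -> Cc (fun x => lap (cutoff r) x + drift (cutoff r) x).
Proof.
move=> r0; apply: CcD; apply: Cc_sum => i.
  by split; [exact: (Ck_continuous (Ck_partial i (Ck_partial i (Ck_cutoff r))))|
    do 2 apply: bsupp_partial; exact: bsupp_cutoff].
apply: CcMl; first exact: (Ck_continuous (Cv i 0)).
by split; [exact: (Ck_continuous (Ck_partial i (Ck_cutoff r)))|
  apply: bsupp_partial; exact: bsupp_cutoff].
Qed.

(** Boundedness of v alone gives this decay, which suffices against an integrable function. *)
Lemma cutoff_test_le : exists2 C : R, 0 <= C & forall r x, 1 <= r ->
  `|lap (cutoff r) x + drift (cutoff r) x| <= C / r.
Proof.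
have [U U0 HU] := speed2_bounded Cv vv.
have v1 i x : `|v i x| <= 1 + U.
  apply: abs_le_of_sqr; first by rewrite addr_ge0.
  have : v i x ^+ 2 <= U.
    apply: le_trans (HU x); rewrite /speed2 (bigD1 i)//= lerDl.
    by apply: sumr_ge0 => j _; exact: sqr_ge0.
  move/le_trans; apply; rewrite -subr_ge0 (_ : _ - _ = 1 + U + U ^+ 2); last by ring.
  by rewrite !addr_ge0 ?sqr_ge0.
exists (42 + 3 * ((1 + U) * 6)); first by rewrite !(addr_ge0, mulr_ge0).
move=> r x r1; have r0 : 0 < r by exact: lt_le_trans r1.
apply: le_trans (ler_normD _ _) _; rewrite mulrDl; apply: lerD.
  apply: le_trans (lap_cutoff_le r x) _; apply: ler_wpM2l => //.
  by rewrite lef_pV2 ?posrE ?exprn_gt0// expr2 ler_peMl// ltW.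
apply: le_trans (ler_norm_sum _ _ _) _.
have H i : `|v i x * partial i (cutoff r) x| <= (1 + U) * (6 / r).
  by rewrite normrM; apply: ler_pM => //; exact: partial_cutoff_le.
apply: le_trans (ler_sum _ (fun i _ => H i)) _.
by rewrite sum3E le_eqVlt; apply/orP; left; apply/eqP; field; rewrite gt_eqF.
Qed.

Variable P : 'rV[R]_3 -> R.
Hypothesis CP : forall k, Ck k P.
Hypothesis vP : head_eqn v P.

Let G x : R := growth (P x).

Lemma Ck_growth_head : Ck 2 G.
Proof. by apply: Ck_comp; [exact: Dk_growth|exact: CP]. Qed.

Lemma partial_growth_head j : partial j G = fun x => growth' (P x) * partial j P x.
Proof.
rewrite -derive1_growth; apply: partial_comp => [x|t].
  exact: (@Ck_derivable R 0 _ j _ (CP 1)).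
exact: (@ex_derive _ _ _ _ _ _ _ (is_derive_growth t)).
Qed.

(** The chain rule combined with [head_subsolution]; both terms are nonnegative as [growth] is
    convex and nondecreasing. *)
Lemma lap_drift_growth_head x : lap G x - drift G x =
  growth'' (P x) * grad2 P x + growth' (P x) * sqr_vort v x.
Proof.
have dg t : derivable (@growth' R) t 1.
  exact: (@ex_derive _ _ _ _ _ _ _ (is_derive_growth' t)).
have dP j y : derivable P y (delta_mx 0 j) := @Ck_derivable R 0 _ j y (CP 1).
have E j : partial j (partial j G) x =
    growth' (P x) * partial j (partial j P) x + growth'' (P x) * partial j P x ^+ 2.
  rewrite partial_growth_head partialM; first last.
  - by move=> y; exact: (@Ck_derivable R 0 _ j y (Ck_partial j (CP 2))).
  - move=> y; have := @is_derive_chain R _ P growth' y (delta_mx 0 j) (dP j y) (dg _).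
    by case.
  rewrite partial_comp// derive1_growth'.
  by move: (growth' _) (growth'' _) (partial j (partial j P) x) (partial j P x) => *; ring.
rewrite /lap (eq_bigr _ (fun j _ => E j)) /drift.
rewrite -(head_subsolution Cv dv0 vP) /lap /grad2 !sum3E !partial_growth_head.
move: (growth' _) (growth'' _) (partial 0 (partial 0 P) x) (partial 1 (partial 1 P) x)
  (partial 2%:R (partial 2%:R P) x) (partial 0 P x) (partial 1 P x) (partial 2%:R P x)
  (v 0 x) (v 1 x) (v 2%:R x) => *; ring.
Qed.

Hypothesis Goo : (nnint G < +oo)%E.

(** Tested against a cutoff at scale r, this nonnegative quantity has integral at most C/r times the
    integral of G, by [cutoff_test_le]. *)
Lemma head_gradient_energy x : growth'' (P x) * grad2 P x = 0.
Proof.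
have cP := Ck_continuous (CP 0); have cG := Ck_continuous Ck_growth_head.
have G0 y : 0 <= G y by exact: growth_ge0.
have ce : continuous (fun y => growth'' (P y) * grad2 P y).
  apply: cont_M; last first.
    apply: cont_sum3 => i; apply: cont_sqr; exact: (Ck_continuous (Ck_partial i (CP 1))).
  move=> y; apply: (@continuous_comp _ _ _ P growth''); first exact: cP.
  exact: continuous_growth''.
have GE : nnint G = (fine (nnint G))%:E by rewrite fineK// ge0_fin_numE//; exact: nnint_ge0.
have [C C0 HC] := cutoff_test_le.
apply: (@eq0_of_cutoff _ (fun y => growth'' (P y) * grad2 P y)
  (fun n => C * fine (nnint G) * n.+1%:R^-1)) => // [y||n].
- by rewrite mulr_ge0 ?growth''_ge0// grad2_ge0.
- rewrite -[X in _ --> X](mulr0 (C * fine (nnint G))).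
  by apply: cvgMr; exact: cvg_harmonic.
have s1 := @natS_ge1 R n; move: (n.+1%:R : R) s1 => s s1.
have s0 : 0 < s by exact: lt_le_trans s1.
have Cs0 : 0 <= C / s by rewrite divr_ge0// ltW.
have CL : Cc (fun y => (lap G y - drift G y) * cutoff s y).
  apply: CcMl; last exact: Cc_cutoff.
  have := cont_D (cont_lap Ck_growth_head) (@cont_Z R _ (-1) (cont_drift (CkW Ck_growth_head))).
  by rewrite (_ : (fun y => _) = (fun y => lap G y - drift G y))//;
    apply/funext => y; rewrite mulN1r.
apply: (@le_trans _ _ (vint (fun y => (lap G y - drift G y) * cutoff s y))).
  apply: le_vint => [||y]; [by apply: CcMl => //; exact: Cc_cutoff|exact: CL|].
  apply: ler_wpM2r; first exact: cutoff_ge0.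
  by rewrite lap_drift_growth_head lerDl mulr_ge0 ?growth'_ge0// sqr_vort_ge0.
rewrite (vint_lap_drift Ck_growth_head (Ck_cutoff s) (bsupp_cutoff s0)).
have CR := CcMl cG (Cc_cutoff_test s0).
apply: le_trans (ler_norm _) _; apply: le_trans (ler_norm_vint CR) _.
rewrite mulrAC -lee_fin vint_nnint; last exact: Cc_abs.
rewrite EFinM -GE -nnintZ//; apply: le_nnint => [||y|y] //.
- exact: (Cc_abs CR).1.
- exact: cont_Z.
by rewrite normrM (ger0_norm (G0 y)) mulrC; apply: ler_wpM2r => //; exact: HC.
Qed.

(** The gradient of G vanishes, so G is constant; an integrable constant is 0, and [growth] is
    positive on positive reals. *)
Lemma head_le0 x : P x <= 0.
Proof.
have pG j y : partial j G y = 0.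
  rewrite partial_growth_head.
  have /eqP := head_gradient_energy y; rewrite mulf_eq0 => /orP[/eqP/growth''_eq0->|].
    by rewrite mul0r.
  rewrite psumr_eq0; last by move=> i _; exact: sqr_ge0.
  move=> /allP/(_ j); rewrite mem_index_enum => /(_ isT)/=.
  by rewrite sqrf_eq0 => /eqP ->; rewrite mulr0.
have Gc := cst_of_partial0 (CkW Ck_growth_head) pG.
rewrite leNgt; apply/negP => /growth_gt0; rewrite -/(G x) Gc.
rewrite [G 0]cst_nnint0 ?ltxx//; first exact: growth_ge0.
by move: Goo; rewrite (_ : G = fun=> G 0)//; apply/funext.
Qed.

End maximum_principle.

(** * The upper bound for the head pressure *)

Section head_pressure_maximum.
Context {R : realType}.
Implicit Types (x : 'rV[R]_3).

Variable v : 'I_3 -> 'rV[R]_3 -> R.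
Variable Q : 'rV[R]_3 -> R.
Hypothesis Cv : forall i k, Ck k (v i).
Hypothesis dv0 : solenoidal v.
Hypothesis CQ : forall k, Ck k Q.
Hypothesis vQ : head_eqn v Q.
Hypothesis hH : (nnint (hardy_energy v) < +oo)%E.
Hypothesis vv : forall i, vanishing (v i).
Variable l : R.
Hypothesis Ql : forall n, n.+1%:R * `|mean Q n.+1%:R 0 - l| <= flux_tail v n.

Lemma head_eqn_shift (c : R) : head_eqn v (fun x => Q x + c).
Proof.
move=> i x; rewrite partialD; last 2 first.
- by move=> y; exact: (@Ck_derivable R 0 _ i y (CQ 1)).
- by move=> y; exact: (@Ck_derivable R 0 _ i y (Ck_cst 1 c)).
by rewrite partial_cst addr0 vQ.
Qed.

Lemma Ck_shift (c : R) k : Ck k (fun x => Q x + c).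
Proof. by apply: CkD; [exact: CQ|exact: Ck_cst]. Qed.

Lemma bounded_on_cube (f : 'rV[R]_3 -> R) (L : R) : 0 <= L -> continuous f ->
  exists B : R, forall x : 'rV[R]_3, (forall i, `|x 0 i| <= L) -> f x <= B.
Proof.
move=> L0 cf; pose A := [set x : 'rV[R]_3 | forall i, `|x 0 i| <= L].
have A0 : A !=set0 by exists 0 => i /=; rewrite mxE normr0.
have [c _ fc] := EVT_max_rV A0 (@compact_cube R L) (continuous_subspaceT cf).
by exists (f c) => x xL; apply: fc; rewrite inE.
Qed.

Lemma measurable_kernel_conv (g : 'rV[R]_3 -> R) : continuous g ->
  (forall x, 0 <= g x) -> measurable_fun [set: point R] (kernel_conv g).
Proof.
move=> cg g0; apply: (@measurable_fun_fubini_tonelli_F _ _ _ _ R leb3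
  (fun p : point R * point R => ((g (vec3 p.2))%:E * cube_kernel p.1 p.2)%E)).
  exact: measurable_kernel_conv_integrand.
by move=> p; rewrite mule_ge0 ?cube_kernel_ge0 ?lee_fin.
Qed.

Lemma ramp_le_scaled (m a e t : R) : 0 < m -> 0 <= t ->
  m * a - m * e <= t -> ramp (a - e) <= m^-1 * t.
Proof.
move=> m0 t0 h; have i0 : 0 <= m^-1 * t by rewrite mulr_ge0// invr_ge0 ltW.
rewrite /ramp ge_max i0 andbT.
by rewrite mulrC ler_pdivlMr// mulrC mulrBr.
Qed.

(** On a cube G is bounded by continuity. Outside, [growth] is at most the positive part, which
    [head_far] bounds by the integrable convolution. *)
Lemma nnint_growth_head (e : R) : 0 < e ->
  (nnint (fun x => growth (Q x - (l / moll_mass + e))) < +oo)%E.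
Proof.
move=> e0; have m0 : 0 < (moll_mass : R) := moll_mass_gt0.
(* [head_far] speaks of [moll_mass * Q], hence the rescaled tolerance. *)
have me0 : 0 < moll_mass * e by exact: mulr_gt0.
have [L [K [L0 K0 HL]]] := head_far Cv dv0 CQ vQ hH vv Ql me0.
pose P x := Q x - (l / moll_mass + e).
have cP : continuous P by exact: (Ck_continuous (Ck_shift _ 0)).
have cG : continuous (fun x => growth (P x)).
  by apply: (Ck_continuous (k := 2)); apply: Ck_comp; [exact: Dk_growth|exact: Ck_shift].
have [B HB] := bounded_on_cube (ltW L0) cG.
have B0 : 0 <= B.
  by apply: le_trans (HB 0 _); [exact: growth_ge0|move=> i; rewrite mxE normr0 ltW].
have Km0 : 0 <= moll_mass^-1 * K by rewrite mulr_ge0// invr_ge0 ltW.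
have g0 := @gradsq_ge0 R v; have cg := cont_gradsq Cv.
have kc0 z : (0 <= kernel_conv (gradsq v) z)%E.
  by apply: integral_ge0 => y _; rewrite mule_ge0 ?cube_kernel_ge0 ?lee_fin.
pose A := cube (0, 0, 0) L : set (point R).
have mA : measurable A by exact: measurable_cube.
have mk := measurable_kernel_conv cg g0.
have mind : measurable_fun [set: point R] ((fun=> B%:E) \_ A).
  by apply/(measurable_restrictT (fun=> B%:E) mA); exact: measurable_cst.
have ind0 z : (0 <= ((fun=> B%:E) \_ A) z)%E.
  by rewrite patchE; case: ifP => //; rewrite lee_fin.
have mkK : measurable_fun [set: point R]
    (fun z => (moll_mass^-1 * K)%:E * kernel_conv (gradsq v) z)%E.
  exact: measurable_funeM.
apply: (@le_lt_trans _ _ (\int[leb3]_z (((fun=> B%:E) \_ A) z +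
    (moll_mass^-1 * K)%:E * kernel_conv (gradsq v) z))%E).
  apply: ge0_le_integral => //.
  - by move=> z _; rewrite lee_fin growth_ge0.
  - exact: (@measurable_vec3E R (fun x => growth (P x)) cG).
  - exact: emeasurable_funD.
  move=> z _; have [zL|Lz] := leP (L ^+ 2) (dist2 0 (vec3 z)).
    apply: (@le_trans _ _ ((moll_mass^-1 * K)%:E * kernel_conv (gradsq v) z)%E); last first.
      by rewrite leeDr.
    rewrite (EFinM moll_mass^-1 K) -muleA; have := HL _ zL; rewrite to_point_vec3.
    have : (0 <= K%:E * kernel_conv (gradsq v) z)%E by rewrite mule_ge0// lee_fin.
    (* Where the convolution is infinite there is nothing to prove. *)
    case: (K%:E * _)%E => [t| |] // t0 Ht; last first.
      by rewrite mulry gtr0_sg ?invr_gt0// mul1e leey.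
    rewrite -EFinM lee_fin; apply: le_trans (growth_le _) _.
    rewrite lee_fin in t0.
    rewrite opprD addrA; apply: ramp_le_scaled => //.
    move: Ht; rewrite -EFinD lee_fin => /(le_trans (ler_norm _)) Ht.
    rewrite mulrBr [moll_mass * (l / _)]mulrCA mulfV ?mulr1 ?gt_eqF//.
    by rewrite lerBlDl.
  have zA : A z.
    apply/cubeP => i; apply: abs_le_of_sqr; first exact: ltW.
    apply: ltW; apply: le_lt_trans Lz; apply: le_trans (coord_dist2 0 _ i).
    by rewrite /= (_ : vec3 (0, 0, 0) = 0)//; apply/rowP; apply: ord3P; rewrite vec3E mxE.
  rewrite patchE mem_set// -[leLHS]adde0; apply: leeD; last by rewrite mule_ge0.
  rewrite lee_fin; apply: HB => i; have := (cubeP _ _ _).1 zA i.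
  by rewrite (_ : vec3 (0, 0, 0) 0 i = 0) ?subr0//; move: i; apply: ord3P; rewrite vec3E.
rewrite ge0_integralD; [|by []|by []|exact: mind|by move=> z _; rewrite mule_ge0|exact: mkK].
rewrite -integral_mkcond (integral_cst_cube _ _ (ltW L0)).
rewrite ge0_integralZl_EFin; [|by []|by move=> z _; exact: kc0|exact: mk|exact: Km0].
apply: (@le_lt_trans _ _ ((B * (2 * L) ^+ 3)%:E +
  (moll_mass^-1 * K)%:E * (192%:E * nnint (gradsq v)))%E).
  by apply: leeD => //; apply: lee_wpmul2l; rewrite ?lee_fin// integral_kernel_conv.
have GE : nnint (gradsq v) = (fine (nnint (gradsq v)))%:E.
  by rewrite fineK// ge0_fin_numE ?nnint_gradsq_lty//; exact: nnint_ge0.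
by rewrite GE -!EFinM -EFinD ltry.
Qed.

Lemma head_le_limit x : Q x <= l / moll_mass.
Proof.
apply/ler_addgt0Pr => e e0; rewrite -subr_le0.
exact: (head_le0 Cv dv0 vv (Ck_shift _) (head_eqn_shift _) (nnint_growth_head e0)).
Qed.

End head_pressure_maximum.

(** * Rigidity *)

Section rigidity.
Context {R : realType}.
Implicit Types (x : 'rV[R]_3) (r s t : R).

(** On the support |x|^2 <= r^2 with r >= 1, so r^-2 is at most twice the Hardy weight, and 84 = 2 *
    42. It provides the domination in [vint_lap_cutoff_cvg0]. *)
Lemma lap_cutoff_hardy n x : `|lap (cutoff n.+1%:R) x| <= 84 * hardy_weight x.
Proof.
have r1 := @natS_ge1 R n; move: (n.+1%:R : R) r1 => r r1.
have r0 : 0 < r by exact: lt_le_trans r1.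
have h0 := @hardy_weight_gt0 R x.
have [s1|s1] := leP 1 (r ^- 2 * dist2 0 x).
  by rewrite lap_cutoff_out// normr0 mulr_ge0// ltW.
apply: le_trans (lap_cutoff_le r x) _.
rewrite (_ : 84 * _ = 42 * (2 * hardy_weight x)); last by rewrite mulrA -natrM.
apply: ler_wpM2l => //.
have sr : dist2 0 x <= r ^+ 2.
  by apply: ltW; move: s1; rewrite mulrC ltr_pdivrMr ?mul1r// exprn_gt0.
have q0 : 0 < Num.sqrt (1 + dist2 0 x ^+ 2) by rewrite sqrtr_gt0 one_sqr_gt0.
rewrite /hardy_weight /hardy_profile ler_pdivlMr// mulrC ler_pdivrMr ?exprn_gt0//.
have r21 : 1 <= r ^+ 2 by rewrite exprn_ege1.
have s0 := dist2_ge0 0 x; move: (dist2 0 x) (r ^+ 2) s0 sr r21 {q0} => s a s0 sa a1.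
have a0 : 0 <= 2 * a by rewrite mulr_ge0// (le_trans s0).
rewrite -[leRHS]ger0_norm// -sqrtr_sqr ler_wsqrtr//.
by rewrite exprMn; have : s ^+ 2 <= a ^+ 2; [rewrite lerXn2r ?nnegrE//; exact: le_trans sa|];
  have : 1 <= a ^+ 2; [rewrite exprn_ege1|]; move: (s ^+ 2) (a ^+ 2) => *; lra.
Qed.

Lemma vint_lap_cutoff_cvg0 (f : 'rV[R]_3 -> R) : continuous f -> (forall x, 0 <= f x) ->
  (nnint (fun x => f x * hardy_weight x)%R < +oo)%E ->
  vint (fun x => f x * lap (cutoff n.+1%:R) x) @[n --> \oo] --> (0 : R).
Proof.
move=> cf f0 foo.
have cw : continuous (fun x => f x * hardy_weight x).
  by apply: cont_M => //; exact: (Ck_continuous Ck_hardy_weight).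
have w0 x : 0 <= f x * hardy_weight x by rewrite mulr_ge0// ltW// hardy_weight_gt0.
have CL n : Cc (fun x => f x * lap (cutoff n.+1%:R) x).
  apply: CcMl => //; apply: Cc_sum => i.
  split; first exact: (Ck_continuous (Ck_partial i (Ck_partial i (Ck_cutoff _)))).
  by do 2 apply: bsupp_partial; apply: bsupp_cutoff; rewrite ltr0n.
have g84 : leb3.-integrable [set: point R]
    (fun z => (84 * (f (vec3 z) * hardy_weight (vec3 z)))%:E).
  apply: (@integrable_nn R (fun x => 84 * (f x * hardy_weight x))).
  - exact: cont_Z.
  - by move=> x; rewrite mulr_ge0.
  - by rewrite nnintZ// lte_mul_pinfty// lee_fin.
have [] := @dominated_convergence _ _ _ leb3 [set: point R] measurableT
  (fun n z => (f (vec3 z) * lap (cutoff n.+1%:R) (vec3 z))%:E) (fun=> 0%:E) _ _ _ _ g84 _.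
- by move=> n; apply: (@measurable_vec3E R (fun x => f x * lap (cutoff n.+1%:R) x)); exact: (CL n).1.
- exact: measurable_cst.
- apply: aeW => z _; apply: cvg_EFin; first by near=> n.
  apply: norm_cvg0.
  apply: (@squeeze_cvgr _ _ _ _ (fun=> 0) (fun n : nat => f (vec3 z) * 42 * n.+1%:R^-1)).
  + apply: nearW => n; rewrite normr_ge0/= normrM (ger0_norm (f0 _)) -mulrA.
    apply: ler_wpM2l => //; apply: le_trans (lap_cutoff_le _ _) _.
    apply: ler_wpM2l => //; rewrite lef_pV2 ?posrE ?exprn_gt0 ?ltr0n//.
    by rewrite expr2 ler_peMl ?ler0n// ler1n.
  + exact: cvg_cst.
  + rewrite -[X in _ --> X](mulr0 (f (vec3 z) * 42)).
    by apply: cvgMr; exact: cvg_harmonic.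
- apply: aeW => z n _; rewrite /= lee_fin normrM (ger0_norm (f0 _)) mulrCA.
  by apply: ler_wpM2l => //; exact: lap_cutoff_hardy.
move=> _ _; rewrite integral0 => H; exact: (fine_cvg H).
Unshelve. all: by end_near. Qed.

Variable v : 'I_3 -> 'rV[R]_3 -> R.
Variable Q : 'rV[R]_3 -> R.
Hypothesis Cv : forall i k, Ck k (v i).
Hypothesis dv0 : solenoidal v.
Hypothesis CQ : forall k, Ck k Q.
Hypothesis vQ : head_eqn v Q.
Hypothesis hH : (nnint (hardy_energy v) < +oo)%E.
Hypothesis vv : forall i, vanishing (v i).

Section irrotational.
Variable C : R.
Hypothesis C0 : 0 <= C.
Hypothesis vC : forall x, \sum_(i < 3) x 0 i * v i x <= C.

(** The gradient of the cutoff points inwards, so an upper bound on x . v is a lower bound on the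
    drift. The part of the Laplacian dropped here is nonnegative. *)
Lemma cutoff_test_ge r x : 0 < r ->
  - ((18 + 6 * C) * r ^- 2 * bump 2 (r ^- 2 * dist2 0 x)) <=
  lap (cutoff r) x + drift v (cutoff r) x.
Proof.
move=> r0; have i0 : 0 <= r ^- 2 by rewrite invr_ge0 sqr_ge0.
have -> : drift v (cutoff r) x =
    - (6 * r ^- 2 * bump 2 (r ^- 2 * dist2 0 x)) * \sum_(i < 3) x 0 i * v i x.
  rewrite /drift mulr_sumr; apply: eq_bigr => i _.
  rewrite partial_cutoff /radial_field /cutoff_slope mxE subr0.
  by move: (r ^- 2) (bump _ _) => a b; ring.
rewrite lap_cutoff; have s0 := @scaled_dist2_ge0 R r x.
have b10 := bump_ge0 1 (r ^- 2 * dist2 0 x); have b20 := bump_ge0 2 (r ^- 2 * dist2 0 x).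
have := vC x; move: (\sum_(i < 3) _) => m mC.
move: (bump 1 _) (bump 2 _) b10 b20 => b1 b2 b10 b20.
move: (r ^- 2 * _) s0 => s s0; move: (r ^- 2) i0 => a i0.
have h1 : 0 <= a * (s * b1) by rewrite !mulr_ge0.
have h2 : a * b2 * m <= a * b2 * C by apply: ler_wpM2l => //; rewrite mulr_ge0.
move: h1 h2; rewrite -subr_ge0 => h1; rewrite -subr_ge0 => h2.
rewrite -subr_ge0 (_ : _ - _ = 24 * (a * (s * b1) - 0) + 6 * (a * b2 * C - a * b2 * m)).
  by rewrite addr_ge0// mulr_ge0// subr0.
by ring.
Qed.

Lemma sqr_vort_eq0 x : sqr_vort v x = 0.
Proof.
have [l Ql] := mean0_limit Cv dv0 CQ vQ hH.
have m0 : 0 < (moll_mass : R) := moll_mass_gt0.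
pose P x := Q x + - (l / moll_mass).
have CP := Ck_shift CQ (- (l / moll_mass)); have vP := head_eqn_shift CQ vQ (- (l / moll_mass)).
have P0 y : P y <= 0.
  by rewrite subr_le0; exact: (head_le_limit Cv dv0 CQ vQ hH vv Ql).
have cP : continuous P by exact: (Ck_continuous (CP 0)).
have cs : continuous (sqr_vort v).
  apply: cont_Z; apply: cont_sum3 => i; apply: cont_sum3 => j; apply: cont_sqr.
  have D k m : continuous (partial k (v m)) by exact: (Ck_continuous (Ck_partial k (Cv m 1))).
  have := cont_D (D i j) (@cont_Z R _ (-1) (D j i)).
  by rewrite (_ : (fun y => _) = (fun y => partial i (v j) y - partial j (v i) y))//;
    apply/funext => y; rewrite mulN1r.
(* The factor 8/105 turns r^-2 [bump 2] into r times the mollifier. *)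
pose K := (18 + 6 * C) * (8 / 105).
have K0 : 0 <= K by rewrite !mulr_ge0// addr_ge0// mulr_ge0.
apply: (@eq0_of_cutoff _ _ (fun n => K * flux_tail v n)) => //.
- exact: sqr_vort_ge0.
- by rewrite -[X in _ --> X](mulr0 K); apply: cvgMr; exact: flux_tail_cvg0.
move=> n; set r : R := n.+1%:R; have r0 : 0 < r by rewrite ltr0n.
rewrite (@eq_vint _ _ (fun y => (lap P y - drift v P y) * cutoff r y)); last first.
  by move=> y; rewrite -(head_subsolution Cv dv0 vP).
rewrite (vint_lap_drift Cv dv0 (CP 2) (Ck_cutoff r) (bsupp_cutoff r0)).
have CL : Cc (fun y => P y * (lap (cutoff r) y + drift v (cutoff r) y)).
  by apply: CcMl => //; exact: Cc_cutoff_test.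
have Cm := Cc_mollifier (0 : 'rV[R]_3) r0.
have CPm : Cc (fun y => P y * mollifier 0 r y) by exact: CcMl.
have CQm : Cc (fun y => Q y * mollifier 0 r y).
  by apply: CcMl => //; exact: (Ck_continuous (CQ 0)).
apply: (@le_trans _ _ (vint (fun y => - (K * r) * (P y * mollifier 0 r y)))).
  apply: le_vint => [//||y]; first exact: CcZ.
  (* Multiplication by P <= 0 reverses the lower bound of [cutoff_test_ge] into the upper bound
     wanted here. *)
  apply: le_trans (ler_wnM2l (P0 y) (cutoff_test_ge y r0)) _.
  rewrite le_eqVlt; apply/orP; left; apply/eqP; rewrite /mollifier /K.
  by move: (P y) (bump 2 _) => p b; field; rewrite gt_eqF.
(* The mean of P is that of Q minus [l]; the factor r in front is exactly what the rate in [Ql]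
   compensates. *)
rewrite (vintZ _ CPm) (_ : vint _ = mean Q r 0 - l).
  rewrite mulNr -mulrN opprB -mulrA; apply: ler_wpM2l => //.
  apply: le_trans (Ql n); apply: ler_wpM2l; first exact: ltW.
  by rewrite distrC; exact: ler_norm.
rewrite (@eq_vint _ _ (fun y => Q y * mollifier 0 r y - l / moll_mass * mollifier 0 r y)).
  rewrite vintB//; last exact: CcZ.
  by rewrite (vintZ _ Cm) vint_mollifierE// divfK// gt_eqF.
by move=> y; rewrite /P mulrDl mulNr.
Qed.

Lemma partial_vort_sym i j : partial i (v j) = partial j (v i).
Proof.
apply/funext => x; have /eqP := sqr_vort_eq0 x.
rewrite mulf_eq0 invr_eq0 pnatr_eq0/= psumr_eq0; last first.
  by move=> k _; apply: sumr_ge0 => m _; exact: sqr_ge0.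
move=> /allP/(_ i); rewrite mem_index_enum => /(_ isT)/=.
rewrite psumr_eq0; last by move=> m _; exact: sqr_ge0.
move=> /allP/(_ j); rewrite mem_index_enum => /(_ isT)/=.
by rewrite sqrf_eq0 subr_eq0 => /eqP.
Qed.

(** For an irrotational field Lap v = grad (div v). *)
Lemma lap_velocity_eq0 j x : lap (v j) x = 0.
Proof.
rewrite -(solenoidal_partial Cv dv0 j x); apply: eq_bigr => i _.
by rewrite (partial_vort_sym i j) (partialC i j (Cv i 2)).
Qed.

(** Each v_i is harmonic, so Lap (v_i^2) = 2 |grad v_i|^2, to which [eq0_of_cutoff] applies. *)
Lemma velocity_gradient_eq0 i j x : partial j (v i) x = 0.
Proof.
have dv k y : derivable (v i) y (delta_mx 0 k) := @Ck_derivable R 0 _ k y (Cv i 1).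
have dpv k y : derivable (partial k (v i)) y (delta_mx 0 k).
  exact: (@Ck_derivable R 0 _ k y (Ck_partial k (Cv i 2))).
have lapE y : lap (fun y => v i y * v i y) y = 2 * grad2 (v i) y.
  have E k : partial k (partial k (fun y => v i y * v i y)) y =
      2 * (v i y * partial k (partial k (v i)) y) + 2 * partial k (v i) y ^+ 2.
    rewrite partialM// (_ : (fun x => _) = (fun x => v i x * (2 * partial k (v i) x))); last first.
      by apply/funext => z; ring.
    rewrite partialM//; last first.
      by move=> z; apply: derivableM => //; exact: derivable_cst.
    by rewrite partialM// partial_cst; ring.
  rewrite /lap (eq_bigr _ (fun k _ => E k)) big_split/= -!mulr_sumr.
  by rewrite -/(lap (v i) y) lap_velocity_eq0 !mulr0 add0r.
have C2 : Ck 2 (fun y => v i y * v i y) by apply: CkM; exact: Cv.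
have cg : continuous (grad2 (v i)).
  apply: cont_sum3 => k; apply: cont_sqr; exact: (Ck_continuous (Ck_partial k (Cv i 1))).
have g0 := grad2_ge0 (v i).
suff : grad2 (v i) x = 0.
  move/eqP; rewrite psumr_eq0; last by move=> k _; exact: sqr_ge0.
  move=> /allP/(_ j); rewrite mem_index_enum => /(_ isT)/=.
  by rewrite sqrf_eq0 => /eqP.
have cv2 : continuous (fun y => v i y * v i y) by exact: (Ck_continuous C2).
apply: (@eq0_of_cutoff _ _ (fun n =>
  2^-1 * vint (fun y => v i y * v i y * lap (cutoff n.+1%:R) y))) => //.
  rewrite -[X in _ --> X](mulr0 2^-1); apply: cvgMr.
  apply: vint_lap_cutoff_cvg0 => // [y|]; first by rewrite -expr2 sqr_ge0.
  apply: le_lt_trans hH; apply: le_nnint => [||y|y].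
  - by apply: cont_M => //; exact: (Ck_continuous Ck_hardy_weight).
  - exact: cont_hardy_energy.
  - by rewrite mulr_ge0// -?expr2 ?sqr_ge0// ltW// hardy_weight_gt0.
  - apply: (@le_trans _ _ (speed2 v y * hardy_weight y)).
      apply: ler_wpM2r; first exact: ltW (hardy_weight_gt0 y).
      rewrite -expr2 /speed2 (bigD1 i)//= lerDl.
      by apply: sumr_ge0 => k _; exact: sqr_ge0.
    by rewrite lerDl gradsq_ge0.
move=> n; have n0 : 0 < n.+1%:R :> R by rewrite ltr0n.
rewrite -(vint_lap C2 (Ck_cutoff _) (bsupp_cutoff n0)).
have Cgc : Cc (fun y => grad2 (v i) y * cutoff n.+1%:R y).
  by apply: CcMl => //; exact: Cc_cutoff.
rewrite (@eq_vint _ (fun y => lap _ y * _) (fun y => 2 * (grad2 (v i) y * cutoff n.+1%:R y))).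
  by rewrite (vintZ _ Cgc) mulKf.
by move=> y; rewrite lapE mulrA.
Qed.

Lemma velocity_eq0 i x : v i x = 0.
Proof.
have cst := cst_of_partial0 (Cv i 1) (velocity_gradient_eq0 i).
apply/normr0_eq0/eqP; rewrite eq_le normr_ge0 andbT; apply/ler_addgt0Pl => e e0.
rewrite addr0; have [M M0 HM] := vanishing_dist2 (vv i) e0.
(* Since |y|^2 >= (M + 1)^2 > M, the velocity is small at y, and constancy carries the bound to
   x. *)
pose y : 'rV[R]_3 := const_mx (M + 1).
rewrite cst -(cst y); apply: ltW; apply: HM.
apply: lt_le_trans (coord_dist2 0 y 0); rewrite !mxE subr0.
have M1 : 1 <= M + 1 by rewrite lerDr.
apply: (@lt_le_trans _ _ (M + 1)); first by rewrite ltrDl.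
by rewrite expr2 ler_peMl// (le_trans ler01).
Qed.

End irrotational.
End rigidity.

(** * From the stated hypotheses to the analytic ones *)

Section translation.
Context {R : realType}.
Implicit Types (x : 'rV[R]_3).

Lemma coord_le_enorm x i : `|x 0 i| <= enorm x.
Proof.
rewrite -sqrtr_sqr; apply: ler_wsqrtr; rewrite /dotv (bigD1 i)//= -expr2 lerDl.
by apply: sumr_ge0 => j _; rewrite -expr2 sqr_ge0.
Qed.

Lemma vanishing_coord (u : 'rV[R]_3 -> 'rV[R]_3) i : vanishes_at_infinity u ->
  vanishing (fun x => u x 0 i).
Proof.
move=> vu e /vu[M uM]; exists M => x j Mx.
apply: le_lt_trans (coord_le_enorm (u x) i) _; apply: uM.
exact: lt_le_trans (coord_le_enorm x j).
Qed.

(** Multiplying by |x| gives the form x . u <= C, which also holds at the origin, where the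
    left-hand side is 0. *)
Lemma radial_bound (u : 'rV[R]_3 -> 'rV[R]_3) (C : R) : 0 < C ->
  (forall x, x != 0 -> radial_component u x <= C / enorm x) ->
  forall x, \sum_(i < 3) x 0 i * u x 0 i <= C.
Proof.
move=> C0 uC x; have [->|x0] := eqVneq x 0.
  by rewrite big1 ?ltW// => i _; rewrite mxE mul0r.
have e0 : 0 < enorm x.
  have [i xi] : exists i, 0 < `|x 0 i|.
    apply: contrapT => /forallNP H; move/eqP: x0; apply; apply/rowP => i; rewrite mxE.
    by apply/eqP; have /negP := H i; rewrite normr_gt0 negbK.
  exact: lt_le_trans (coord_le_enorm x i).
have := uC x x0; rewrite /radial_component /dotv.
rewrite (eq_bigr (fun i => (enorm x)^-1 * (x 0 i * u x 0 i))); last first.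
  by move=> i _; rewrite mxE mulrC mulrA.
by rewrite -mulr_sumr mulrC ler_pM2r ?invr_gt0.
Qed.

Lemma hardy_energy_lty (v : 'I_3 -> 'rV[R]_3 -> R) : (forall i k, Ck k (v i)) ->
  (forall i, vanishing (v i)) -> (nnint (gradsq v) < +oo)%E ->
  (nnint (hardy_energy v) < +oo)%E.
Proof.
move=> Cv vv goo.
have cw : continuous (@hardy_weight R) by exact: (Ck_continuous Ck_hardy_weight).
have w0 x : 0 <= hardy_weight x by exact: ltW (hardy_weight_gt0 x).
pose f i x := v i x ^+ 2 * hardy_weight x.
have cf i : continuous (f i).
  by apply: cont_M => //; apply: cont_sqr; exact: (Ck_continuous (Cv i 0)).
have f0 i x : 0 <= f i x by rewrite mulr_ge0// sqr_ge0.
have foo i : (nnint (f i) < +oo)%E.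
  apply: le_lt_trans (hardy (Cv i 1) (vv i)) _.
  have : (nnint (grad2 (v i)) < +oo)%E.
    apply: le_lt_trans goo; apply: le_nnint => [||x|x].
    - apply: cont_sum3 => j; apply: cont_sqr.
      exact: (Ck_continuous (Ck_partial j (Cv i 1))).
    - exact: cont_gradsq.
    - exact: grad2_ge0.
    - by rewrite /gradsq (bigD1 i)//= lerDl; apply: sumr_ge0 => j _; exact: grad2_ge0.
  by move=> goo'; rewrite lte_mul_pinfty// lee_fin.
have cg := cont_gradsq Cv; have g0 := @gradsq_ge0 R v.
rewrite (_ : hardy_energy v = fun x => f 0 x + f 1 x + f 2%:R x + gradsq v x); last first.
  by apply/funext => x; rewrite /hardy_energy /speed2 sum3E !mulrDl.
have c2 := cont_D (cf 0) (cf 1); have c3 := cont_D c2 (cf 2%:R).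
have s2 x : 0 <= f 0 x + f 1 x by exact: addr_ge0.
have s3 x : 0 <= f 0 x + f 1 x + f 2%:R x by exact: addr_ge0.
rewrite (nnintD c3 cg s3 g0) (nnintD c2 (cf _) s2 (f0 _)) (nnintD (cf _) (cf _) (f0 _) (f0 _)).
by do 3 (apply: lte_add_pinfty => //); exact: foo.
Qed.

Lemma nnint_gradsq_dirichlet (u : 'rV[R]_3 -> 'rV[R]_3) : smooth u ->
  nnint (gradsq (fun i x => u x 0 i)) = dirichlet_integral u.
Proof.
move=> su; rewrite /dirichlet_integral -/leb3.
have -> : gradsq (fun i x => u x 0 i) = sqr_norm_grad u; last by [].
apply/funext => x; rewrite /gradsq /grad2 /sqr_norm_grad exchange_big/=.
by apply: eq_bigr => j _; apply: eq_bigr => i _; rewrite partial_coord_fun// => y; exact: (su [::]).2.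
Qed.

(** Rests on the identity (v . grad) v = w x v + grad (|v|^2/2). *)
Lemma head_eqn_navier_stokes (u : 'rV[R]_3 -> 'rV[R]_3) (p : 'rV[R]_3 -> R) :
  smooth u -> smooth p -> stationary_navier_stokes u p ->
  solenoidal (fun i x => u x 0 i) /\
  head_eqn (fun i x => u x 0 i) (fun x => p x + 2^-1 * \sum_(j < 3) u x 0 j * u x 0 j).
Proof.
move=> su sp ns.
pose v i x := u x 0 i.
have vE j i : partial j (v i) = fun x => partial j u x 0 i.
  by apply: partial_coord_fun => x; exact: (su [::]).2.
have dv i j x : derivable (v i) x (delta_mx 0 j).
  exact: (@Ck_derivable R 0 _ j x (smooth_vector_Ck i su 1)).
have dvv i j x : derivable (fun y => v i y * v i y) x (delta_mx 0 j) by exact: derivableM.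
split=> [x|i x].
  by rewrite -[RHS](ns x).2; apply: eq_bigr => j _; rewrite [partial j _]vE.
have lapE : lap (v i) x = laplacian u x 0 i.
  rewrite /lap /laplacian summxE; apply: eq_bigr => j _; rewrite vE partial_coord_fun// => y.
  exact: (su [:: j]).2.
have := congr1 (fun w : 'rV[R]_3 => w 0 i) (ns x).1.
rewrite !mxE -lapE summxE.
rewrite (eq_bigr (fun k => v k x * partial k (v i) x)); last first.
  by move=> k _; rewrite mxE vE.
move=> H.
have sE : partial i (fun y => \sum_(k < 3) v k y * v k y) x =
    2 * \sum_(k < 3) v k x * partial i (v k) x.
  rewrite partial_sum// mulr_sumr; apply: eq_bigr => k _.
  by rewrite partialM// mulrDl mul1r.
have ds y j : derivable (fun y => \sum_(k < 3) v k y * v k y) y (delta_mx 0 j).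
  have C1 : Ck 1 (fun y => \sum_(k < 3) v k y * v k y).
    by apply: Ck_sum => k; apply: CkM; exact: smooth_vector_Ck.
  exact: (@Ck_derivable R 0 _ j y C1).
rewrite partialD; last 2 first.
- by move=> y; exact: (sp [::]).2.
- by move=> y; apply: derivableM => //; exact: derivable_cst.
rewrite partialM// partial_cst mulr0 addr0 sE mulKf// -/v.
have -> : vort_cross v i x =
    \sum_(k < 3) v k x * partial k (v i) x - \sum_(k < 3) v k x * partial i (v k) x.
  by rewrite -sumrB; apply: eq_bigr => k _; rewrite mulrBr.
rewrite -/(v i); move: H; set a := \sum_(k < 3) _; set b := \sum_(k < 3) _.
by move: a b (lap _ _) (partial _ _ _) => a b c d H; lra.
Qed.

End translation.

Theorem theorem1p2 (R : realType) (u : 'rV[R]_3 -> 'rV[R]_3)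
  (hu : homogeneous_D_solution u)
  (hrad : exists C : R, 0 < C /\
     forall x : 'rV[R]_3, x != 0 -> radial_component u x <= C / enorm x) :
  forall x : 'rV[R]_3, u x = 0.
Proof.
have [su [p [sp ns]] uoo u0] := hu; have [C [C0 uC]] := hrad.
have [dv0 vQ] := head_eqn_navier_stokes su sp ns.
have Cv i k := smooth_vector_Ck i su k.
have vv i := vanishing_coord i u0.
have CQ k : Ck k (fun x => p x + 2^-1 * \sum_(j < 3) u x 0 j * u x 0 j).
  apply: CkD; first exact: smooth_scalar_Ck.
  by apply: CkZ; apply: Ck_sum => j; apply: CkM; exact: Cv.
have goo : (nnint (gradsq (fun i x => u x 0%R i)) < +oo)%E by rewrite nnint_gradsq_dirichlet.
have hH := hardy_energy_lty Cv vv goo.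
move=> x; apply/rowP => i; rewrite mxE.
exact: (velocity_eq0 Cv dv0 CQ vQ hH vv (ltW C0) (radial_bound C0 uC) i x).
Qed.
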